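(* Let $\Bbbk$ be an algebraically closed field and let $\Lambda$ be the path algebra over $\Bbbk$ of a quiver of type $A_n$. The number $e(\Lambda)$ of complete exceptional sequences in mod-$\Lambda$ is $$e(\Lambda)=h(\Lambda)\sum_{[(Q,R)]}\frac{\mathrm{LinExt}(Q,R)}{|\mathrm{Aut}(Q,R)|},$$ where the sum is over isomorphism classes of Hom-Ext quivers with relations $(Q,R)=(Q^\chi,R^\chi)$ of complete exceptional collections $\chi$ in mod-$\Lambda$, and $h(\Lambda)=n+1$ is the Coxeter number of $\Lambda$.
   Context: A quiver of type $A_n$ is one whose underlying graph is a path on $n$ vertices. mod-$\Lambda$ is the category of finitely generated $\Lambda$-modules, and $\mathrm{Ext}=\mathrm{Ext}^1_\Lambda$; modules are considered up to isomorphism. Exceptional collections. An indecomposable $\Lambda$-module $E$ is exceptional if $\mathrm{Ext}(E,E)=0$. A sequence of exceptional modules $(E_1,\dots,E_k)$ is an exceptional sequence if $\mathrm{Hom}(E_i,E_j)=0=\mathrm{Ext}(E_i,E_j)$ for all $i>j$; it is complete if $k=n$, the number of simple $\Lambda$-modules. A complete exceptional collection is an unordered set of modules that can be ordered into a complete exceptional sequence in at least one way. Hom-Ext quiver. For a complete exceptional collection $\chi=\{E_1,\dots,E_n\}$, let $A_\chi=\bigoplus_{i,j}\big(\mathrm{Hom}(E_i,E_j)\oplus\mathrm{Ext}^1(E_i,E_j)\big)$ be its Yoneda Ext algebra (products landing in $\mathrm{Ext}^{2}=0$ are zero). The Hom-Ext quiver with relations $(Q^\chi,R^\chi)$ is the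 quiver with relations of $A_\chi$, with the grading forgotten: the vertices are $E_1,\dots,E_n$; the number of arrows $E_i\to E_j$ is the dimension of the component of $\mathrm{rad}(A_\chi)/\mathrm{rad}^2(A_\chi)$ coming from $\mathrm{Hom}(E_i,E_j)\oplus\mathrm{Ext}^1(E_i,E_j)$; and $R^\chi$ is the ideal of relations, i.e. the kernel of the surjection $\Bbbk Q^\chi\to A_\chi$ obtained by lifting arrows to classes. (In type $A$ each space $\mathrm{Hom}(E_i,E_j)\oplus\mathrm{Ext}^1(E_i,E_j)$ has dimension at most one, so lifts are unique up to scalar.) An isomorphism of quivers with relations is an isomorphism of the underlying ungraded quivers carrying one ideal of relations onto the other, and $\mathrm{Aut}(Q^\chi,R^\chi)$ is the group of automorphisms of $(Q^\chi,R^\chi)$ as a quiver with relations in this sense (permutations of vertices and arrows). Linear extensions. On the vertices of $(Q^\chi,R^\chi)$ let $\le_e$ be the partial order generated by $E\le_e E'$ whenever there is an arrow $E\to E'$ in $Q^\chi$. $\mathrm{LinExt}(Q^\chi,R^\chi)$ is the number of linear extensions of $\le_e$, i.e. total orders on the vertices extending $\le_e$.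
   Formalization: The formal theorem assumes n > 1: for n = 1 the algebra is the field itself, which has one complete exceptional sequence, while the right-hand side equals (1+1)·1/1 = 2, so the formula as stated fails there. *)

(* Defs.v *)
From HB Require Import structures.
From mathcomp Require Import all_boot all_order all_algebra all_fingroup.
From mathcomp Require Import finmap monalg boolp.

Set Implicit Arguments.
Unset Strict Implicit.
Unset Printing Implicit Defensive.

Import GRing.Theory.
Local Open Scope ring_scope.

(* Quivers have a nonempty vertex set, so that their path algebras are
   nontrivial rings, as [algType] requires. *)
Record quiver := Quiver {
  vertex :> finType;
  arrow : finType;
  src : arrow -> vertex;
  tgt : arrow -> vertex;
  _ : (0 < #|vertex|)%N }.

Section Paths.
Variable Q : quiver.

Fixpoint walk (v : Q) (s : seq (arrow Q)) : bool :=
  if s is a :: s' then (src a == v) && walk (tgt a) s' else true.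

Definition walk_end (v : Q) (s : seq (arrow Q)) : Q := last v (map (@tgt Q) s).

(* A path is a starting vertex followed by the list of its arrows, in the
   order in which they are traversed; the empty list gives the trivial path. *)
Record qpath := QPath {
  qpath_val : Q * seq (arrow Q);
  _ : walk qpath_val.1 qpath_val.2 }.

HB.instance Definition _ := [isSub for qpath_val].
HB.instance Definition _ := [Choice of qpath by <:].

Definition qstart (p : qpath) : Q := (qpath_val p).1.
Definition qarrows (p : qpath) : seq (arrow Q) := (qpath_val p).2.
Definition qend (p : qpath) : Q := walk_end (qstart p) (qarrows p).

Lemma walk_cat v s t : walk v (s ++ t) = walk v s && walk (walk_end v s) t.
Proof. by elim: s v => [|a s IHs] v //=; rewrite IHs andbA. Qed.

Lemma walk_end_cat v s t : walk_end v (s ++ t) = walk_end (walk_end v s) t.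
Proof. by rewrite /walk_end map_cat last_cat. Qed.

End Paths.

(* The path algebra: finite formal linear combinations of paths.  The product
   is written like composition of maps: [p * q] is "first q, then p", so that
   left modules are the representations of the quiver. *)
Definition path_algebra (K : fieldType) (Q : quiver) : Type := {malg K[qpath Q]}.

HB.instance Definition _ (K : fieldType) (Q : quiver) :=
  GRing.Lmodule.copy (path_algebra K Q) {malg K[qpath Q]}.

(* The operations are locked for efficiency only: unfolding [malg] during
   unification is very slow. *)
HB.lock Definition qbasis (K : fieldType) (Q : quiver) (p : qpath Q) :
  path_algebra K Q := << p >>.
Canonical qbasis_unlockable := Unlockable qbasis.unlock.
Arguments qbasis {K Q} p.

(* The basis element of a walk, and 0 if the data is not a walk. *)
Definition walk_elt (K : fieldType) (Q : quiver) (v : Q) (s : seq (arrow Q)) :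
    path_algebra K Q :=
  if insub (v, s) is Some p then qbasis p else 0.
Arguments walk_elt {K Q} v s.

Definition lin_ext (K : fieldType) (Q : quiver) (V : lmodType K)
    (F : qpath Q -> V) (x : path_algebra K Q) : V :=
  \sum_(p <- msupp x) x@_p *: F p.

Definition path_mul (K : fieldType) (Q : quiver) (p q : qpath Q) :
    path_algebra K Q :=
  if qend q == qstart p then walk_elt (qstart q) (qarrows q ++ qarrows p) else 0.
Arguments path_mul {K Q} p q.

HB.lock Definition pa_mul (K : fieldType) (Q : quiver) (x y : path_algebra K Q) :
    path_algebra K Q :=
  lin_ext (fun p => lin_ext (fun q => path_mul p q) y) x.
Canonical pa_mul_unlockable := Unlockable pa_mul.unlock.
Arguments pa_mul {K Q} x y.

Definition pa_one (K : fieldType) (Q : quiver) : path_algebra K Q :=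
  \sum_(v : Q) walk_elt v [::].
Arguments pa_one {K Q}.

Section PathAlgebra.
Variables (K : fieldType) (Q : quiver).
Local Notation KQ := (path_algebra K Q).

Section LinExt.
Variable V : lmodType K.
Implicit Types F G : qpath Q -> V.

Lemma lin_extEw (d : {fset qpath Q}) F x : (msupp x `<=` d)%fset ->
  lin_ext F x = \sum_(p <- d) x@_p *: F p.
Proof.
move=> le; rewrite /lin_ext (big_fset_incl _ le) //= => p _ px.
by rewrite mcoeff_outdom ?scale0r.
Qed.

Lemma lin_ext_is_linear F : linear (lin_ext F).
Proof.
move=> c x y; pose d := (msupp x `|` msupp y `|` msupp (c *: x + y))%fset.
rewrite !(lin_extEw (d := d)); first last.
- exact: fsubsetUr.
- by rewrite /d -fsetUA fsubsetUl.
- by rewrite /d fsetUAC fsubsetUr.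
rewrite scaler_sumr -big_split /=; apply: eq_bigr => p _.
by rewrite (mcoeffD p (c *: x) y) mcoeffZ scalerDl scalerA.
Qed.

HB.instance Definition _ F :=
  GRing.isLinear.Build K KQ V *:%R (lin_ext F) (lin_ext_is_linear F).

Lemma lin_extU F p : lin_ext F (qbasis p) = F p.
Proof. by rewrite qbasis.unlock /lin_ext msuppU oner_eq0 big_seq_fset1 mcoeffUU scale1r. Qed.

Lemma eq_lin_ext F G : F =1 G -> lin_ext F =1 lin_ext G.
Proof. by move=> eqFG x; apply: eq_bigr => p _; rewrite eqFG. Qed.

End LinExt.

Lemma mcoeff_qbasis p q : (qbasis p : KQ)@_q = (p == q)%:R.
Proof. by rewrite qbasis.unlock mcoeffU. Qed.

Lemma lin_ext_id (x : KQ) : lin_ext qbasis x = x.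
Proof.
rewrite qbasis.unlock {2}[x]monalgE; apply: eq_bigr => p _; apply/malgP => q.
by rewrite [LHS]mcoeffZ [RHS]mcoeffU [in LHS]mcoeffU mulrnAr mulr1.
Qed.

Lemma lin_ext_comp (V W : lmodType K) (f : {linear V -> W}) (F : qpath Q -> V) x :
  f (lin_ext F x) = lin_ext (f \o F) x.
Proof. by rewrite linear_sum; apply: eq_bigr => p _; rewrite linearZ. Qed.

Lemma pa_mul_is_linear (x : KQ) : linear (pa_mul x).
Proof.
have E u : pa_mul x u = \sum_(p <- msupp x) x@_p *: lin_ext (path_mul p) u.
  by rewrite pa_mul.unlock.
move=> c y z; rewrite !E scaler_sumr -big_split /=.
by apply: eq_bigr => p _; rewrite linearP scalerDr !scalerA mulrC.
Qed.

HB.instance Definition _ x :=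
  GRing.isLinear.Build K KQ KQ *:%R (pa_mul x) (pa_mul_is_linear x).

Definition pa_rmul (y x : KQ) := pa_mul x y.

Lemma pa_mulr_is_linear y : linear (pa_rmul y).
Proof. by move=> c x z; rewrite /pa_rmul pa_mul.unlock linearP. Qed.

HB.instance Definition _ y :=
  GRing.isLinear.Build K KQ KQ *:%R (pa_rmul y) (pa_mulr_is_linear y).

Lemma pa_mul0l (y : KQ) : pa_mul 0 y = 0.
Proof. exact: (linear0 (pa_rmul y)). Qed.

Lemma pa_mul_suml (I : finType) (F : I -> KQ) y :
  pa_mul (\sum_i F i) y = \sum_i pa_mul (F i) y.
Proof. exact: (linear_sum (pa_rmul y)). Qed.

Lemma pa_mulUU (p q : qpath Q) : pa_mul (K := K) (qbasis p) (qbasis q) = path_mul p q.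
Proof. by rewrite pa_mul.unlock !lin_extU. Qed.

Lemma walk_eltE (v : Q) s (w : walk v s) : walk_elt v s = qbasis (K := K) (QPath (qpath_val := (v, s)) w).
Proof.
rewrite /walk_elt; case: insubP => [p _ pE|]; last by rewrite /= w.
by congr (qbasis _); apply: val_inj.
Qed.

Lemma qpathP (p : qpath Q) : walk (qstart p) (qarrows p).
Proof. by case: p. Qed.

Lemma walk_elt_qpath (p : qpath Q) : walk_elt (qstart p) (qarrows p) = qbasis p :> KQ.
Proof.
rewrite (walk_eltE (qpathP p)); congr (qbasis _); apply: val_inj => /=.
by rewrite /qstart /qarrows -surjective_pairing.
Qed.

Lemma pa_mulAU (p q r : qpath Q) :
  pa_mul (K := K) (path_mul p q) (qbasis r) = pa_mul (qbasis p) (path_mul q r).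
Proof.
have walkM (p1 p2 : qpath Q) : qend p2 = qstart p1 ->
    walk (qstart p2) (qarrows p2 ++ qarrows p1).
  by move=> e; rewrite walk_cat qpathP [walk_end _ _]e qpathP.
rewrite {1}/path_mul [path_mul q r]/path_mul.
case: (eqVneq (qend q) (qstart p)) => [pq|npq]; last first.
  rewrite pa_mul0l; case: eqP => [qr|_]; last by rewrite linear0.
  rewrite (walk_eltE (walkM _ _ qr)) pa_mulUU /path_mul.
  by rewrite [qend (QPath _)]walk_end_cat [walk_end _ (qarrows r)]qr (negPf npq).
rewrite (walk_eltE (walkM _ _ pq)) pa_mulUU {1}/path_mul.
rewrite (_ : qstart (QPath _) = qstart q) //.
rewrite (_ : qarrows (QPath _) = qarrows q ++ qarrows p) //.
case: eqP => [qr|_]; last by rewrite linear0.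
rewrite (walk_eltE (walkM _ _ qr)) pa_mulUU /path_mul.
rewrite [qend (QPath _)]walk_end_cat [walk_end _ (qarrows r)]qr.
by rewrite [walk_end _ _]pq eqxx catA.
Qed.

Lemma pa_mulEl (x y : KQ) : pa_mul x y = lin_ext (fun p => pa_mul (qbasis p) y) x.
Proof. by rewrite pa_mul.unlock; apply: eq_lin_ext => p; rewrite lin_extU. Qed.

Lemma pa_mulEr (x y : KQ) : pa_mul x y = lin_ext (fun q => pa_mul x (qbasis q)) y.
Proof. by rewrite -{1}(lin_ext_id y) (lin_ext_comp (pa_mul x)). Qed.

Lemma pa_mul_extl (F : qpath Q -> KQ) x z :
  pa_mul (lin_ext F x) z = lin_ext (fun p => pa_mul (F p) z) x.
Proof. exact: (lin_ext_comp (pa_rmul z) F x). Qed.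

Lemma pa_mul_extr u (F : qpath Q -> KQ) y :
  pa_mul u (lin_ext F y) = lin_ext (fun q => pa_mul u (F q)) y.
Proof. exact: (lin_ext_comp (pa_mul u) F y). Qed.

Lemma pa_mulA : associative (@pa_mul K Q).
Proof.
move=> x y z; rewrite (pa_mulEl x (pa_mul y z)) (pa_mulEl x y) pa_mul_extl.
apply: eq_lin_ext => p; rewrite (pa_mulEl y z) (pa_mulEr (qbasis p) y).
rewrite pa_mul_extl pa_mul_extr; apply: eq_lin_ext => q.
rewrite (pa_mulEr (qbasis q) z) (pa_mulEr _ z) pa_mul_extr.
by apply: eq_lin_ext => r; rewrite !pa_mulUU pa_mulAU.
Qed.

Lemma walk_elt0 (v : Q) : exists2 p : qpath Q,
  walk_elt v [::] = qbasis p :> KQ & qstart p = v /\ qarrows p = [::].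
Proof. by rewrite (walk_eltE (isT : walk v [::])); eexists; first reflexivity. Qed.

Lemma pa_mul1 : left_id pa_one (@pa_mul K Q).
Proof.
move=> y; rewrite pa_mulEr -[RHS]lin_ext_id; apply: eq_lin_ext => q.
rewrite pa_mul_suml (bigD1 (qend q)) //= big1 ?addr0 => [|v nv].
  have [p -> [pv p0]] := walk_elt0 (qend q).
  by rewrite pa_mulUU /path_mul pv eqxx p0 cats0 walk_elt_qpath.
have [p -> [pv p0]] := walk_elt0 v.
by rewrite pa_mulUU /path_mul pv eq_sym (negPf nv).
Qed.

Lemma pa_mulr1 : right_id pa_one (@pa_mul K Q).
Proof.
move=> x; rewrite pa_mulEl -[RHS]lin_ext_id; apply: eq_lin_ext => p.
rewrite linear_sum (bigD1 (qstart p)) //= big1 ?addr0 => [|v nv].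
  have [q -> [qv q0]] := walk_elt0 (qstart p).
  by rewrite pa_mulUU /path_mul /qend qv q0 eqxx walk_elt_qpath.
have [q -> [qv q0]] := walk_elt0 v.
by rewrite pa_mulUU /path_mul /qend qv q0 (negPf nv).
Qed.

Lemma pa_one_neq0 : pa_one != 0 :> KQ.
Proof.
have [v _] : exists v : Q, v \in Q.
  by case: Q => V A s t c; apply/card_gt0P.
have [p pE [pv _]] := walk_elt0 v.
apply/eqP => /(congr1 (mcoeff p)); rewrite mcoeff0 raddf_sum (bigD1 v) //=.
rewrite big1 ?addr0 => [|w nw].
  by rewrite pE mcoeff_qbasis eqxx => /eqP; rewrite oner_eq0.
have [q -> [qw _]] := walk_elt0 w.
rewrite mcoeff_qbasis; case: eqP => // qp.
by rewrite -qw qp pv eqxx in nw.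
Qed.

HB.instance Definition _ := GRing.Zmodule_isNzRing.Build KQ
  pa_mulA pa_mul1 pa_mulr1
  (fun x y z => linearD (pa_rmul z) x y) (fun x => linearD (pa_mul x))
  pa_one_neq0.

Lemma pa_scaleAl c (x y : KQ) : c *: (x * y) = (c *: x) * y.
Proof. exact: (esym (linearZ_LR (pa_rmul y) c x)). Qed.

HB.instance Definition _ := GRing.Lmodule_isLalgebra.Build K KQ pa_scaleAl.

Lemma pa_scaleAr c (x y : KQ) : c *: (x * y) = x * (c *: y).
Proof. exact: (esym (linearZ_LR (pa_mul x) c y)). Qed.

HB.instance Definition _ := GRing.Lalgebra_isAlgebra.Build K KQ pa_scaleAr.

End PathAlgebra.

(* The underlying graph of Q is the path v_0 - v_1 - ... - v_(n-1). *)
Definition type_A (n : nat) (Q : quiver) : Prop :=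
  exists (v : 'I_n -> Q) (a : 'I_n.-1 -> arrow Q),
  [/\ bijective v, bijective a &
      forall (l : 'I_n.-1) (i j : 'I_n), i = l :> nat -> j = l.+1 :> nat ->
        (src (a l) = v i /\ tgt (a l) = v j) \/
        (src (a l) = v j /\ tgt (a l) = v i)].

Section Modules.
Variables (K : fieldType) (L : algType K).

Record fgmod := FgMod {
  fgmod_carrier :> lmodType L;
  _ : exists (d : nat) (g : 'I_d -> fgmod_carrier), forall m : fgmod_carrier,
        exists c : 'I_d -> L, m = \sum_i c i *: g i }.

Definition isomorphic (M N : lmodType L) : Prop :=
  exists f : {linear M -> N}, bijective f.

Definition indecomposable (M : lmodType L) : Prop :=
  (exists m : M, m != 0) /\
  forall A B : lmodType L, isomorphic M (A * B)%type ->
    (forall a : A, a = 0) \/ (forall b : B, b = 0).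

Definition hom_zero (M N : lmodType L) : Prop :=
  forall (f : {linear M -> N}) (m : M), f m = 0.

(* K acts on an L-module through the structure map s |-> s%:A of L. *)
Definition klinear (M N : lmodType L) (h : M -> N) : Prop :=
  forall (s : K) (x y : M), h ((s%:A : L) *: x + y) = (s%:A : L) *: h x + h y.

(* Ext^1(M, N) is the space of 1-cocycles modulo coboundaries of the bar
   complex Hom_K(L^{(x) *} (x) M, N).  A cocycle c corresponds to the extension
   0 -> N -> N (+) M -> M -> 0 where a (y, x) = (a y + c a x, a x): every
   extension is of this form because it splits over K, and equivalence of
   extensions is congruence modulo coboundaries. *)
Definition cocycle (M N : lmodType L) (c : L -> M -> N) : Prop :=
  [/\ forall a, klinear (c a),
      forall (s : K) a b x, c (s *: a + b) x = (s%:A : L) *: c a x + c b x &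
      forall a b x, c (a * b) x = a *: c b x + c a (b *: x)].

Definition coboundary (M N : lmodType L) (c : L -> M -> N) : Prop :=
  exists2 h : M -> N, klinear h & forall a x, c a x = a *: h x - h (a *: x).

Definition ext_zero (M N : lmodType L) : Prop :=
  forall c : L -> M -> N, cocycle c -> coboundary c.

Definition exceptional (M : fgmod) : Prop :=
  indecomposable M /\ ext_zero M M.

Definition exceptional_seq (r : nat) (E : 'I_r -> fgmod) : Prop :=
  (forall i, exceptional (E i)) /\
  forall i j : 'I_r, (j < i)%N -> hom_zero (E i) (E j) /\ ext_zero (E i) (E j).

Definition seq_iso (r : nat) (E F : 'I_r -> fgmod) : Prop :=
  forall i, isomorphic (E i) (F i).

(* The family E, in no particular order, is an exceptional collection of
   n modules. *)
Definition exceptional_coll (n : nat) (I : finType) (E : I -> fgmod) : Prop :=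
  exists2 s : 'I_n -> I, bijective s & exceptional_seq (E \o s).

(* The algebra A = (+)_(i, j) Hom(E i, E j) (+) Ext^1(E i, E j).  Its elements
   are the x : yoneda satisfying [yelt], taken up to [yeq]. *)
Section Yoneda.
Variables (I : finType) (E : I -> fgmod).

Definition yoneda : Type := forall i j : I, (E i -> E j) * (L -> E i -> E j).

Implicit Types x y z : yoneda.

Definition yelt x : Prop :=
  forall i j, linear (x i j).1 /\ cocycle (x i j).2.

Definition yeq x y : Prop :=
  forall i j, (x i j).1 =1 (y i j).1 /\
              coboundary (fun a m => (x i j).2 a m - (y i j).2 a m).

Definition yzero : yoneda := fun i j => (fun=> 0, fun _ _ => 0).

Definition yadd x y : yoneda := fun i j =>
  (fun m => (x i j).1 m + (y i j).1 m, fun a m => (x i j).2 a m + (y i j).2 a m).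

Definition yscale (s : K) x : yoneda := fun i j =>
  (fun m => (s%:A : L) *: (x i j).1 m, fun a m => (s%:A : L) *: (x i j).2 a m).

Definition ysub x y : yoneda := yadd x (yscale (- 1) y).

(* Composition of maps, [ymul x y] being "first y, then x"; the products
   Hom Ext and Ext Hom are push-out and pull-back of extensions. *)
Definition ymul x y : yoneda := fun i l =>
  (fun m => \sum_j (x j l).1 ((y i j).1 m),
   fun a m => \sum_j ((x j l).1 ((y i j).2 a m) + (x j l).2 a ((y i j).1 m))).

(* The identity of E v, as an idempotent of A. *)
Definition yidem (v : I) : yoneda := fun i j =>
  (fun m => if i =P j is ReflectT ij
            then if i == v then ecast l (E l) ij m else 0 else 0,
   fun _ _ => 0).

Definition yone : yoneda := \big[yadd/yzero]_v yidem v.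

(* The Jacobson radical of A and its square. *)
Definition yrad x : Prop :=
  yelt x /\ forall a, yelt a ->
    exists b, yelt b /\ yeq (ymul b (ysub yone (ymul a x))) yone.

Definition yrad2 x : Prop :=
  yelt x /\ exists (r : nat) (a b : 'I_r -> yoneda),
    (forall t, yrad (a t) /\ yrad (b t)) /\
    yeq x (\big[yadd/yzero]_t ymul (a t) (b t)).

(* x lies in the summand Hom(E i, E j) (+) Ext^1(E i, E j). *)
Definition ycomponent (i j : I) x : Prop :=
  yelt x /\ yeq x (ymul (yidem j) (ymul x (yidem i))).

End Yoneda.

Section Presentation.
Variables (Q : quiver) (E : Q -> fgmod) (x : arrow Q -> yoneda E).

Definition arrow_comb (i j : Q) (s : arrow Q -> K) : yoneda E :=
  \big[@yadd _ E/yzero E]_(a | (src a == i) && (tgt a == j)) yscale (s a) (x a).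

(* For all i and j, the classes of the x a, where a runs over the arrows from
   i to j, form a basis of the (i, j) component of rad A / rad^2 A. *)
Definition arrow_lift : Prop :=
  (forall a, ycomponent (src a) (tgt a) (x a) /\ yrad (x a)) /\
  forall i j : Q,
    (forall s, yrad2 (arrow_comb i j s) ->
       forall a, src a = i -> tgt a = j -> s a = 0) /\
    (forall y, ycomponent i j y -> yrad y ->
       exists s, yrad2 (ysub y (arrow_comb i j s))).

(* The algebra map K Q -> A sending the arrow a to x a. *)
Definition path_eval (p : qpath Q) : yoneda E :=
  foldl (fun y a => ymul (x a) y) (yidem E (qstart p)) (qarrows p).

Definition pa_eval (z : path_algebra K Q) : yoneda E :=
  \big[@yadd _ E/yzero E]_(p <- msupp z) yscale z@_p (path_eval p).

End Presentation.
End Modules.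

(* A quiver Q together with an ideal of relations, a subset of K Q. *)
Record bound_quiver (K : fieldType) := BoundQuiver {
  bq_quiver :> quiver;
  bq_rel : path_algebra K bq_quiver -> Prop }.

(* B is (up to renaming of vertices and arrows) the Hom-Ext quiver with
   relations of a complete exceptional collection over L, n being the number
   of simple L-modules. *)
Definition hom_ext_quiver (K : fieldType) (L : algType K) (n : nat)
    (B : bound_quiver K) : Prop :=
  exists E : B -> fgmod L, exceptional_coll n E /\
  exists x : arrow B -> yoneda E, arrow_lift x /\
  forall z, bq_rel z <-> yeq (pa_eval x z) (yzero E).

Section BoundQuivers.
Variable K : fieldType.

Definition quiver_iso (Q Q' : quiver) (f : Q -> Q') (g : arrow Q -> arrow Q') :=
  [/\ bijective f, bijective g &
      forall a, src (g a) = f (src a) /\ tgt (g a) = f (tgt a)].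

Definition pa_map (Q Q' : quiver) (f : Q -> Q') (g : arrow Q -> arrow Q') :
    path_algebra K Q -> path_algebra K Q' :=
  lin_ext (fun p => walk_elt (f (qstart p)) (map g (qarrows p))).

Definition bq_iso (B B' : bound_quiver K) (f : B -> B')
    (g : arrow B -> arrow B') : Prop :=
  quiver_iso f g /\ forall z, bq_rel z <-> bq_rel (pa_map f g z).

Definition bq_isomorphic (B B' : bound_quiver K) : Prop :=
  exists (f : B -> B') (g : arrow B -> arrow B'), bq_iso f g.

Definition bq_aut (B : bound_quiver K) : {set {perm B} * {perm arrow B}} :=
  [set fg : {perm B} * {perm arrow B} |
     `[< bq_iso (fun v => fg.1 v) (fun a => fg.2 a) >]].

Definition le_e (Q : quiver) : rel Q :=
  connect (fun i j => [exists a : arrow Q, (src a == i) && (tgt a == j)]).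

Definition linear_extensions (Q : quiver) : {set {set Q * Q}} :=
  [set R : {set Q * Q} | `[<
     let le := fun i j : Q => (i, j) \in R in
     [/\ total le, antisymmetric le, transitive le &
         forall i j, le_e i j -> le i j] >]].

End BoundQuivers.

(* f lists, without repetition, representatives of the classes for r of the
   elements of T satisfying P. *)
Definition class_reps (T : Type) (P : T -> Prop) (r : T -> T -> Prop)
    (m : nat) (f : 'I_m -> T) : Prop :=
  [/\ forall i, P (f i),
      forall i j, r (f i) (f j) -> i = j &
      forall x, P x -> exists i, r x (f i)].

(* Main.v *)
Require Import Defs.
From HB Require Import structures.
From mathcomp Require Import all_boot all_order all_algebra all_fingroup.
From mathcomp Require Import finmap monalg boolp zify ring.

(** The idea is to draw the modules as chords of a circle, so that the group of
rotations of the circle, which has n+1 elements, acts freely on everything that is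
counted.

The indecomposable modules over a quiver of type A_n are the interval modules
[a, b), 0 <= a < b <= n ([indecomposable_segm]). Put the n+1 places 0, ..., n of the
line on a circle, going up along the places where the arrow points down and coming
back along the others, and draw [a, b) as the chord from a to b. Then
Hom(M, N) + Ext(M, N), whose dimension is at most one, is non-zero if and only if the
chords cross, or share an endpoint in a fixed sense of rotation ([HEc_circ]). The
orientation of the quiver has disappeared, and an exceptional sequence is a sequence
of n chords such that no chord is related to an earlier one.

The product of the transpositions of these n chords is the rotation of the circle by
one step ([prod_swap]). This gives the rigidity of exceptional families: two of
them with the same relation between their chords differ by a rotation, since a
matching of the points that carries one to the other commutes with the rotation
([fam_rot]).

Next, the Hom-Ext quiver with relations is the same thing as the relation between the
chords. The Yoneda algebra of an exceptional collection has a basis indexed by the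
related pairs, in which the product of two basis elements is a basis element if
the composite pair is related, and zero otherwise ([Lam_mul]). Hence the arrows are
the irreducible related pairs, and the ideal of relations consists of the combinations
of the paths whose start is not related to all of their vertices
([arrow_lift_draws], [pa_eval_zero]). Conversely the relation can be read off from the
ideal ([drawing_rel]). Call a map from the vertices of a bound quiver B to chords a
drawing if it presents B in this way. The drawings of B form a single free orbit of the
rotations, so there are n+1 of them.

Finally, count the pairs of an ordering s of the vertices of B that extends the partial
order, and a drawing f: there are LinExt(B) (n+1) of them ([card_linext]). The
composite f o s is an exceptional sequence of chords, and two pairs with the same
composite differ by exactly one automorphism of B. So (n+1) LinExt(B) / |Aut(B)|
exceptional sequences come from collections whose Hom-Ext quiver is B
([card_seqs_of]); summing over the isomorphism classes of B gives the formula. *)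

Set Implicit Arguments.
Unset Strict Implicit.
Unset Printing Implicit Defensive.
Import GRing.Theory Num.Theory.

(** * Chords of a circle and products of their transpositions *)

(** Chords x < y and z < w of a circle with the points 0, 1, 2, ... in this cyclic
order are related if they cross, or if they share an endpoint p such that, going
up the circle from p, the other end of the first chord comes no later than the
other end of the second. For the chords of two interval modules this is the
non-vanishing of Hom + Ext. *)
Definition nat_related (x y z w : nat) : bool :=
  [|| (x < z) && (z < y) && (y < w), (z < x) && (x < w) && (w < y),
      (x == z) && (y <= w), (y == w) && (x <= z) | x == w].

(** The endpoints need not be sorted: in the induction on products of
transpositions they are a point and its image. *)
Definition pts_related (x y z w : nat) : bool :=
  nat_related (minn x y) (maxn x y) (minn z w) (maxn z w).

Lemma pts_relatedC x y z w : pts_related x y z w = pts_related y x z w.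
Proof. by rewrite /pts_related minnC maxnC. Qed.

(** In a triangle p, u, v whose side uv can follow the side pu, a chord zw that can
follow both pu and uv can also follow the third side pv. *)
Lemma related_slide p u v z w :
  p != u -> u != v -> z < w ->
  ~~ pts_related u v p u -> ~~ pts_related z w p u -> ~~ pts_related z w u v ->
  p != v /\ ~~ pts_related z w p v.
Proof.
have lt2 a b : a < b -> (minn a b = a) * (maxn a b = b) * (minn b a = a) * (maxn b a = b).
  by move=> /ltnW l; rewrite (minn_idPl l) (maxn_idPr l) (minn_idPr l) (maxn_idPl l).
rewrite /pts_related; case: (ltngtP p u) => // pu _; case: (ltngtP u v) => // uv _ zw;
rewrite ?(lt2 _ _ pu) ?(lt2 _ _ uv) ?(lt2 _ _ zw).
all: case: (ltngtP p v) => pv; rewrite ?(lt2 _ _ pv).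
all: rewrite /nat_related.
all: lia.
Qed.

(** The number of steps up the circle of N points from p to q. It is N, not 0, when
q = p: a fixed point is thought of as making a full turn. *)
Definition gap (N p q : nat) := if p < q then q - p else N + q - p.

(** If uv can follow pu, then v lies on the arc that goes up from p to u. *)
Lemma gap_slide N p u v : p < N -> u < N -> v < N -> u != v ->
  (p == u) || ~~ pts_related u v p u -> gap N p u = gap N p v + gap N v u.
Proof.
rewrite /pts_related /gap => pN uN vN.
case: (ltngtP p u) => pu; case: (ltngtP u v) => //= uv _; rewrite /nat_related.
all: case: (ltnP p v) => pv; lia.
Qed.
Lemma gap_opp N u v : u < N -> v < N -> u != v -> gap N u v + gap N v u = N.
Proof. rewrite /gap; case: (ltnP u v) => uv; case: (ltnP v u) => vu; lia. Qed.
Lemma gap_gt0 N p q : p < N -> 0 < gap N p q.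
Proof. rewrite /gap; case: (ltnP p q); lia. Qed.

Section Circle.
Variable n : nat.
Notation pt := 'I_n.+1.

Definition chord : finType := {xy : pt * pt | xy.1 < xy.2}.
Definition lo (t : chord) : pt := (val t).1.
Definition hi (t : chord) : pt := (val t).2.
Lemma lo_lt_hi (t : chord) : lo t < hi t. Proof. exact: (valP t). Qed.
Lemma lo_neq_hi (t : chord) : lo t != hi t.
Proof. by have := lo_lt_hi t; rewrite -val_eqE /=; lia. Qed.

Definition related (t u : chord) : bool := nat_related (lo t) (hi t) (lo u) (hi u).
Definition swap (t : chord) : {perm pt} := tperm (lo t) (hi t).

(** No non-zero morphism or extension leads backwards, from u to t: the chord u may
stand after t in an exceptional sequence. *)
Definition compat : rel chord := fun t u => ~~ related u t.

(** The effect of one more transposition on a partial product w. The pairs p, w p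
behave like chords that are still compatible with all chords to come, by
[related_slide]; so the next chord shortens the two gaps that it changes, and by
[gap_opp] it shortens them by n+1 in total. *)
Lemma prod_swap_inv (s1 s2 : seq chord) : pairwise compat (s1 ++ s2) ->
  let w := (\prod_(t <- s1) swap t)%g in
  (forall p : pt, w p != p -> forall v, v \in s2 -> ~~ pts_related (lo v) (hi v) p (w p)) /\
  \sum_(p : pt) gap n.+1 p (w p) + n.+1 * size s1 = n.+1 * n.+1.
Proof.
elim/last_ind: s1 s2 => [|s1 t IH] s2.
  move=> _ /=; rewrite big_nil; split=> [p|]; first by rewrite perm1 eqxx.
  rewrite (eq_bigr (fun=> n.+1)) => [|p _]; last by rewrite perm1 /gap ltnn addnK.
  by rewrite sum_nat_const card_ord; lia.
rewrite cat_rcons => cs; have [] := IH _ cs.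
rewrite -cats1 big_cat big_seq1 /= => Hc Hs.
set w := (\prod_(t <- s1) swap t)%g in Hc Hs *.
have tl v : v \in s2 -> ~~ related v t.
  move=> vs; move: cs; rewrite pairwise_cat => /and3P[_ _ /=].
  by case/andP => /allP/(_ v vs).
(* Here a and b are the two endpoints of t, in either order. *)
have step (a b p : pt) : w p = a -> ((a == lo t) && (b == hi t)) || ((a == hi t) && (b == lo t)) ->
    (p != b -> forall v, v \in s2 -> ~~ pts_related (lo v) (hi v) p b) /\
    gap n.+1 p a = gap n.+1 p b + gap n.+1 b a.
  move=> wp ab.
  have nab : a != b.
    have := lo_neq_hi t.
    by case/orP: ab => /andP[/eqP-> /eqP->] //; rewrite eq_sym.
  have sab v : v \in s2 -> ~~ pts_related (lo v) (hi v) a b.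
    move=> vs; have := tl v vs.
    rewrite /related /pts_related (minn_idPl (ltnW (lo_lt_hi v))) (maxn_idPr (ltnW (lo_lt_hi v))).
    have [l1 l2] := (minn_idPl (ltnW (lo_lt_hi t)), maxn_idPr (ltnW (lo_lt_hi t))).
    by case/orP: ab => /andP[/eqP-> /eqP->]; rewrite ?l1 ?l2 // minnC maxnC l1 l2.
  have [pa|npa] := eqVneq p a.
    split=> [_ v vs|]; first by rewrite pa sab.
    by apply: gap_slide => //; rewrite ?pa ?eqxx.
  have C1 : ~~ pts_related a b p a.
    have wpp : w p != p by rewrite wp eq_sym.
    have := Hc p wpp t (mem_head _ _); rewrite wp.
    by case/orP: ab => /andP[/eqP-> /eqP->] //; rewrite pts_relatedC.
  split=> [npb v vs|]; last by apply: gap_slide => //; rewrite ?npa ?C1 ?orbT.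
  have wpp : w p != p by rewrite wp eq_sym.
  have := Hc p wpp v; rewrite inE vs orbT wp => /(_ isT) C2.
  by have [] := related_slide npa nab (lo_lt_hi v) C1 C2 (sab v vs).
have tpE (p : pt) : (w * swap t)%g p = swap t (w p) by rewrite permM.
split=> [p|].
  rewrite tpE /swap; case: tpermP => [wp|wp|_ _] np v vs.
  - by have [] := step (lo t) (hi t) p wp; rewrite ?eqxx // => /(_ _ v vs)->; rewrite // eq_sym.
  - by have [] := step (hi t) (lo t) p wp; rewrite ?eqxx ?orbT // => /(_ _ v vs)->; rewrite // eq_sym.
  - by apply: Hc => //; rewrite inE vs orbT.
(* Only the gaps at the two points that w maps to the endpoints of t change. *)
pose p0 := (w^-1)%g (lo t); pose p1 := (w^-1)%g (hi t).
have wp0 : w p0 = lo t by rewrite permKV.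
have wp1 : w p1 = hi t by rewrite permKV.
have np : p1 != p0 by rewrite (inj_eq perm_inj) eq_sym lo_neq_hi.
have [_ g0] := step _ (hi t) p0 wp0 (introT orP (or_introl (introT andP (conj (eqxx _) (eqxx _))))).
have [_ g1] := step _ (lo t) p1 wp1 (introT orP (or_intror (introT andP (conj (eqxx _) (eqxx _))))).
have oth (p : pt) : p != p0 -> p != p1 -> (w * swap t)%g p = w p.
  move=> n0 n1; rewrite tpE /swap tpermD //.
    by apply: contra n0 => /eqP e; rewrite /p0 e permK.
  by apply: contra n1 => /eqP e; rewrite /p1 e permK.
rewrite (bigD1 p0) // (bigD1 p1) //= in Hs.
rewrite (bigD1 p0) // (bigD1 p1) //= size_cat addn1.
rewrite (eq_bigr (fun p : pt => gap n.+1 p (w p))); last first.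
  by move=> p /andP[a b]; rewrite oth.
have go := gap_opp (ltn_ord (lo t)) (ltn_ord (hi t)) (lo_neq_hi t).
rewrite !tpE wp0 wp1 /swap tpermL tpermR.
rewrite wp0 wp1 g0 g1 in Hs.
move: Hs; set S := \sum_(i | _) _; nia.
Qed.

(** After n transpositions the n+1 gaps add up to (n+1)^2 - n(n+1) = n+1, so that
each of them is 1. *)
Lemma prod_swap (s : seq chord) : size s = n -> pairwise compat s ->
  forall p : pt, (\prod_(t <- s) swap t)%g p = ordS p.
Proof.
move=> sn ps p; have [] := @prod_swap_inv s [::]; first by rewrite cats0.
set w := (\prod_(t <- s) swap t)%g; move=> _; rewrite sn => Hs.
have g0 (q : pt) : 0 < gap n.+1 q (w q) by apply: gap_gt0.
have {}Hs : \sum_(q : pt) (gap n.+1 q (w q)).-1 = 0.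
  apply/eqP; rewrite -(eqn_add2r (\sum_(q : pt) 1)) -big_split /=.
  rewrite (eq_bigr (fun q : pt => gap n.+1 q (w q))); last first.
    by move=> q _; rewrite addn1 prednK.
  rewrite add0n sum1_card card_ord; apply/eqP; move: Hs; set S := (X in X + _ = _) => Hs; change (S = n.+1); nia.
move/eqP: Hs; rewrite sum_nat_eq0 => /forallP/(_ p)/implyP/(_ isT)/eqP.
have := g0 p; have := ltn_ord (w p); have := ltn_ord p.
rewrite /gap => l1 l2 l3 l4; apply/val_inj => /=; move: l3 l4.
case: (ltnP p (w p)) => pw l3 l4.
  by rewrite modn_small; lia.
have -> : p.+1 = n.+1 by lia.
by rewrite modnn; lia.
Qed.

Definition inc (p : pt) (t : chord) : bool := (p == lo t) || (p == hi t).
Definition meet (t u : chord) : bool := [exists p, inc p t && inc p u].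

Lemma meetE t u : meet t u =
  [|| lo t == lo u, lo t == hi u, hi t == lo u | hi t == hi u].
Proof.
apply/existsP/idP => [[p /andP[]]|].
  by case/orP => /eqP-> /orP[] ->; rewrite ?orbT.
by case/or4P => e; [exists (lo t)|exists (lo t)|exists (hi t)|exists (hi t)];
  rewrite /inc eqxx e ?orbT.
Qed.

Lemma chord_eqP (t u : chord) : lo t = lo u -> hi t = hi u -> t = u.
Proof.
move=> e1 e2; apply: val_inj; move: e1 e2; rewrite /lo /hi.
by case: (val t) (val u) => [a b] [c d] /= -> ->.
Qed.

Lemma inc2_eq p q t u : p != q -> inc p t -> inc q t -> inc p u -> inc q u -> t = u.
Proof.
move=> pq; have := lo_lt_hi t; have := lo_lt_hi u; rewrite /inc.
move=> l1 l2 i1 i2 i3 i4; apply: chord_eqP; apply: val_inj; move: pq i1 i2 i3 i4;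
  rewrite -!val_eqE /=; lia.
Qed.

Lemma related_refl t : related t t. Proof. by rewrite /related /nat_related !eqxx !leqnn !orbT. Qed.

(** Crossing is symmetric, so compatible chords do not cross: being related is then
sharing an endpoint. *)
Lemma compat_meet t u : compat t u -> meet t u = related t u.
Proof.
have := lo_lt_hi t; have := lo_lt_hi u.
rewrite /compat meetE /related /nat_related -!val_eqE /=; lia.
Qed.

Lemma meetC t u : meet t u = meet u t.
Proof. by apply: eq_existsb => p; rewrite andbC. Qed.

(** In a triangle with three different corners the relations at the corners run
round in a circle, so that its sides cannot be ordered. *)
Lemma compat_triangle t u v : compat t u -> compat t v -> compat u v ->
  meet t u -> meet t v -> meet u v -> exists p, [&& inc p t, inc p u & inc p v].
Proof.
move=> c1 c2 c3 m1 m2 m3.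
suff : [|| inc (lo t) u && inc (lo t) v | inc (hi t) u && inc (hi t) v].
  case/orP => /andP[i1 i2]; first by exists (lo t); rewrite i1 i2 /inc eqxx.
  by exists (hi t); rewrite i1 i2 /inc eqxx orbT.
move: m1 m2 m3 c1 c2 c3; rewrite !meetE /inc -!val_eqE.
have := lo_lt_hi t; have := lo_lt_hi u; have := lo_lt_hi v.
rewrite /compat /related /nat_related /=.
move: (nat_of_ord (lo t)) (nat_of_ord (lo u)) (nat_of_ord (lo v)) (nat_of_ord (hi t)) (nat_of_ord (hi u)) (nat_of_ord (hi v)).
move=> a b c d e f l1 l2 l3.
move=> /or4P[] /eqP E1; move=> /or4P[] /eqP E2; rewrite -?E1 -?E2 ?eqxx ?orbT //; lia.
Qed.
End Circle.

(** * Exceptional families of chords *)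

Section Families.
Variable n : nat.
Notation pt := 'I_n.+1.

(** The default value of [insubd] is never used, since g maps the two endpoints to
different points. *)
Definition permc (g : {perm pt}) (t : chord n) : chord n :=
  insubd t (if g (lo t) < g (hi t) then (g (lo t), g (hi t)) else (g (hi t), g (lo t))).

Lemma permcP (g : {perm pt}) (t : chord n) :
  (g (lo t) < g (hi t)) && (lo (permc g t) == g (lo t)) && (hi (permc g t) == g (hi t)) ||
  (g (hi t) < g (lo t)) && (lo (permc g t) == g (hi t)) && (hi (permc g t) == g (lo t)).
Proof.
have ne : g (lo t) != g (hi t) by rewrite (inj_eq perm_inj) lo_neq_hi.
rewrite /permc /lo /hi val_insubd /=; move: ne; rewrite -val_eqE /= /lo /hi.
by case: ltngtP => //= lt _; rewrite lt /= ?eqxx.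
Qed.

Lemma inc_permc (g : {perm pt}) (p : pt) (t : chord n) : inc (g p) (permc g t) = inc p t.
Proof.
by rewrite /inc; case/orP: (permcP g t) => /andP[/andP[_ /eqP->] /eqP->];
  rewrite !(inj_eq perm_inj) // orbC.
Qed.

Lemma inc_ext (t u : chord n) : (forall p : pt, inc p t -> inc p u) -> t = u.
Proof.
move=> h; apply: (inc2_eq (lo_neq_hi t)); rewrite ?h //; by rewrite /inc eqxx ?orbT.
Qed.

Lemma swap_permc (g : {perm pt}) (t : chord n) : swap (permc g t) = (swap t ^ g)%g.
Proof.
rewrite /swap tpermJ.
by case/orP: (permcP g t) => /andP[/andP[_ /eqP->] /eqP->]; rewrite // tpermC.
Qed.

Lemma permcM (g h : {perm pt}) (t : chord n) : permc (g * h)%g t = permc h (permc g t).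
Proof.
apply/inc_ext => p; rewrite -[p](permKV (g * h)%g) inc_permc.
by rewrite -(inc_permc g) -(inc_permc h) -permM.
Qed.

Definition rot : {perm pt} := perm (can_inj (@ordSK n.+1)).
Lemma rotE p : rot p = ordS p. Proof. by rewrite permE. Qed.

Lemma related_rot t u : related (permc rot t) (permc rot u) = related t u.
Proof.
have := permcP rot t; have := permcP rot u; rewrite !rotE -!val_eqE /=.
have E (p : pt) : p.+1 %% n.+1 = if p == n :> nat then 0 else p.+1.
  by case: eqP => [->|ne]; rewrite ?modnn // modn_small //; have := ltn_ord p; lia.
rewrite !E; have := lo_lt_hi t; have := lo_lt_hi u.
have := ltn_ord (hi t); have := ltn_ord (hi u).
have := lo_lt_hi (permc rot t); have := lo_lt_hi (permc rot u).
rewrite /related /nat_related.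
move: (nat_of_ord (lo t)) (nat_of_ord (lo u)) (nat_of_ord (hi t)) (nat_of_ord (hi u)).
move: (nat_of_ord (lo _)) (nat_of_ord (lo _)) (nat_of_ord (hi _)) (nat_of_ord (hi _)).
move=> a b c d x y z w.
case: (x =P n); case: (y =P n); case: (z =P n); case: (w =P n); lia.
Qed.

Lemma permc1 (t : chord n) : permc 1 t = t.
Proof. by apply/inc_ext => p; rewrite -{1}[p](perm1 p) inc_permc. Qed.

Lemma related_rotX r t u : related (permc (rot ^+ r) t) (permc (rot ^+ r) u) = related t u.
Proof.
elim: r => [|r IH]; first by rewrite expg0 !permc1.
by rewrite expgSr !permcM related_rot.
Qed.

Definition exc_order (I : Type) (f : I -> chord n) (s : 'I_n -> I) : Prop :=
  forall a b : 'I_n, a < b -> compat (f (s a)) (f (s b)).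

Definition exc_fam (I : Type) (f : I -> chord n) : Prop :=
  exists2 s : 'I_n -> I, bijective s & exc_order f s.

Section OneFamily.
Variables (I : finType) (f : I -> chord n).
Hypothesis ef : exc_fam f.

Lemma fam_compat i j : i != j -> compat (f i) (f j) || compat (f j) (f i).
Proof.
case: ef => s [s' sK s'K] so; rewrite -(s'K i) -(s'K j).
move: (s' i) (s' j) => a b ne.
have : a != b by apply: contraNneq ne => ->.
by rewrite -val_eqE /=; case: (ltngtP a b) => // lt _; rewrite (so _ _ lt) ?orbT.
Qed.

Lemma fam_inj : injective f.
Proof.
move=> i j e; apply/eqP/negPn/negP => /fam_compat.
by rewrite /compat e related_refl.
Qed.

Lemma fam_meet i j : meet (f i) (f j) = related (f i) (f j) || related (f j) (f i).
Proof.
have [->|/fam_compat] := eqVneq i j.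
  by rewrite orbb related_refl meetE eqxx.
case/orP => c; have := compat_meet c; move: c; rewrite /compat.
  by case: (related (f j) (f i)) => //; rewrite orbF.
by rewrite meetC; case: (related (f i) (f j)).
Qed.

Lemma fam_triangle i j k : i != j -> i != k -> j != k ->
  meet (f i) (f j) -> meet (f i) (f k) -> meet (f j) (f k) ->
  exists p, [&& inc p (f i), inc p (f j) & inc p (f k)].
Proof.
case: ef => s [s' sK s'K] so; rewrite -(s'K i) -(s'K j) -(s'K k).
move: (s' i) (s' j) (s' k) => {i j k} a b c.
rewrite !(inj_eq (can_inj sK)) -!val_eqE /= => ab ac bc m1 m2 m3.
have m1' : meet (f (s b)) (f (s a)) by rewrite meetC.
have m2' : meet (f (s c)) (f (s a)) by rewrite meetC.
have m3' : meet (f (s c)) (f (s b)) by rewrite meetC.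
have T := @compat_triangle n.
move: ab ac bc; case: (ltngtP a b) => // ab _; case: (ltngtP a c) => // ac _; case: (ltngtP b c) => // bc _.
- by have [p /and3P[x y z]] := T _ _ _ (so _ _ ab) (so _ _ ac) (so _ _ bc) m1 m2 m3; exists p; rewrite x y z.
- by have [p /and3P[x y z]] := T _ _ _ (so _ _ ac) (so _ _ ab) (so _ _ bc) m2 m1 m3'; exists p; rewrite x y z.
- by have := ltn_trans ab (ltn_trans bc ac); rewrite ltnn.
- by have [p /and3P[x y z]] := T _ _ _ (so _ _ ac) (so _ _ bc) (so _ _ ab) m2' m3' m1; exists p; rewrite x y z.
- by have [p /and3P[x y z]] := T _ _ _ (so _ _ ab) (so _ _ bc) (so _ _ ac) m1' m3 m2; exists p; rewrite x y z.
- by have := ltn_trans ab (ltn_trans ac bc); rewrite ltnn.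
- by have [p /and3P[x y z]] := T _ _ _ (so _ _ bc) (so _ _ ab) (so _ _ ac) m3 m1' m2'; exists p; rewrite x y z.
- by have [p /and3P[x y z]] := T _ _ _ (so _ _ bc) (so _ _ ac) (so _ _ ab) m3' m2' m1'; exists p; rewrite x y z.
Qed.

Lemma fam_prod s : bijective s -> exc_order f s ->
  (\prod_(t <- [seq f (s a) | a <- enum 'I_n]) swap t)%g = rot.
Proof.
move=> bs so; apply/permP => p; rewrite rotE; apply: prod_swap.
  by rewrite size_map size_enum_ord.
rewrite pairwise_map; apply: (@sub_pairwise _ (relpre val ltn)).
  by move=> a b /= /so.
rewrite -pairwise_map val_enum_ord; rewrite -sorted_pairwise; first exact: iota_ltn_sorted.
exact: ltn_trans.
Qed.

Lemma prod_swap_stable (A : {pred pt}) (ts : seq (chord n)) :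
  (forall t, t \in ts -> (lo t \in A) = (hi t \in A)) ->
  forall p, ((\prod_(t <- ts) swap t)%g p \in A) = (p \in A).
Proof.
elim: ts => [|t ts IH] h p; first by rewrite big_nil perm1.
rewrite big_cons permM IH; last by move=> u us; rewrite h // inE us orbT.
have ht := h t (mem_head _ _); rewrite /swap.
by case: tpermP => [->|->|] //; rewrite ht.
Qed.

(** The rotation is a product of the transpositions of the chords, so a set of points
that contains both ends or no end of each chord is stable under it, hence empty or
everything.
This gives the next two lemmas: the chords cover the points, and separate them. *)
Lemma rot_stable (A : {pred pt}) :
  (forall i, (lo (f i) \in A) = (hi (f i) \in A)) ->
  forall p, (ordS p \in A) = (p \in A).
Proof.
case: (ef) => s bs so h p; rewrite -rotE -(fam_prod bs so).
by apply: prod_swap_stable => t /mapP[a _ ->].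
Qed.

Lemma fam_cover p : 0 < n -> exists i, inc p (f i).
Proof.
move=> n0; apply/existsP; rewrite -[[exists _, _]]negbK; apply/negP.
rewrite negb_exists => /forallP h.
have := @rot_stable (pred1 p) _ p; rewrite !inE eqxx => e.
have : (ordS p == p); last first.
  rewrite -val_eqE /=; have := ltn_ord p; rewrite ltnS leq_eqVlt.
  by case/orP=> [/eqP->|lt]; [rewrite modnn; lia|rewrite modn_small //; lia].
apply: e => i; have := h i; rewrite /inc negb_or => /andP[a b].
by rewrite !inE ![_ == p]eq_sym (negPf a) (negPf b).
Qed.

(** Otherwise every chord would have both ends or no end in {p, q}, which is not all of
the circle as n > 1. *)
Lemma fam_sep p q : 1 < n -> (forall i, inc p (f i) = inc q (f i)) -> p = q.
Proof.
move=> n1 h; apply/eqP/negPn/negP => npq.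
have st := @rot_stable (pred2 p q) _.
have {}st : forall x, (ordS x \in pred2 p q) = (x \in pred2 p q).
  apply: st => i; have := h i; have := lo_neq_hi (f i); rewrite /inc !inE.
  move: npq; rewrite -!val_eqE /=; lia.
have := st p; have := st (ordS p); have := st q; rewrite !inE !eqxx /= orbT.
have E (x : pt) : x.+1 %% n.+1 = if x == n :> nat then 0 else x.+1.
  by case: eqP => [->|ne]; rewrite ?modnn // modn_small //; have := ltn_ord x; lia.
move: npq; rewrite -!val_eqE /= !E; have := ltn_ord p; have := ltn_ord q.
move: (nat_of_ord p) (nat_of_ord q) => x y.
case: (x =P n); case: (y =P n); case: (x.+1 =P n); case: (0 =P n); lia.
Qed.

Lemma exc_fam_rot r : exc_fam (fun i => permc (rot ^+ r) (f i)).
Proof. by case: ef => s bs so; exists s => // a b /so; rewrite /compat related_rotX. Qed.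

Lemma iter_ordS0 (p : pt) : iter p (@ordS n.+1) ord0 = p.
Proof.
suff h m : m < n.+1 -> iter m (@ordS n.+1) ord0 = m :> nat by apply/val_inj/h.
elim: m => [|m IH] // lt; rewrite iterS /= IH ?modn_small //; exact: ltnW.
Qed.

Lemma rotXE r p : (rot ^+ r)%g p = iter r (@ordS n.+1) p.
Proof. by rewrite permX; apply: eq_iter => x; rewrite rotE. Qed.

Lemma rot_free (r r' : pt) : 1 < n ->
  (forall i, permc (rot ^+ r) (f i) = permc (rot ^+ r') (f i)) -> r = r'.
Proof.
move=> n1 h; apply: (perm_inj (s := 1)); rewrite !perm1.
rewrite -(iter_ordS0 r) -(iter_ordS0 r') -!rotXE.
suff : forall p, (rot ^+ r)%g p = (rot ^+ r')%g p by apply.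
case: (exc_fam_rot r) => s bs so.
have ef' : exc_fam (fun i => permc (rot ^+ r) (f i)) by exists s.
move=> p.
have sep' : forall x y : pt,
  (forall i, inc x (permc (rot ^+ r) (f i)) = inc y (permc (rot ^+ r) (f i))) -> x = y.
  move=> x y hxy.
  pose x0 := ((rot ^+ r)^-1)%g x; pose y0 := ((rot ^+ r)^-1)%g y.
  rewrite -(permKV (rot ^+ r)%g x) -(permKV (rot ^+ r)%g y); congr (fun_of_perm _ _).
  apply: fam_sep => // i.
  by rewrite -(inc_permc (rot ^+ r) x0) -(inc_permc (rot ^+ r) y0) !permKV hxy.
by apply: sep' => i; rewrite inc_permc h inc_permc.
Qed.
End OneFamily.
End Families.

(** * Exceptional families with the same relation differ by a rotation *)

Section Match.
Variables (n : nat) (I : finType).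
Notation pt := 'I_n.+1.

(** A point on two chords can be recognized from the relation of meeting alone: a
third chord that meets both passes through their common point, by
[fam_triangle]. *)
Lemma match_deg2 (f f' : I -> chord n) i j p : exc_fam f -> exc_fam f' ->
  (forall i j, meet (f i) (f j) = meet (f' i) (f' j)) ->
  i != j -> inc p (f i) -> inc p (f j) ->
  exists p' : pt, forall k, inc p (f k) = inc p' (f' k).
Proof.
move=> ef ef' mm ij pi pj.
have mI (g : I -> chord n) x a b : inc x (g a) -> inc x (g b) -> meet (g a) (g b).
  by move=> h1 h2; apply/existsP; exists x; rewrite h1 h2.
have : meet (f' i) (f' j) by rewrite -mm; apply: mI pi pj.
case/existsP => p' /andP[pi' pj']; exists p' => k.
(* A third chord that meets the two others is not the third side of a triangle, so it passes
   through their common point. *)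
have key (g g' : I -> chord n) x x' : exc_fam g -> exc_fam g' ->
    (forall a b, meet (g a) (g b) = meet (g' a) (g' b)) ->
    inc x (g i) -> inc x (g j) -> inc x' (g' i) -> inc x' (g' j) -> inc x (g k) -> inc x' (g' k).
  move=> eg eg' m xi xj xi' xj' xk.
  have [->//|ki] := eqVneq k i; have [->//|kj] := eqVneq k j.
  rewrite eq_sym in ki; rewrite eq_sym in kj.
  have [] := fam_triangle eg' ij ki kj; rewrite -?m; [exact: mI xi xj|exact: mI xi xk|exact: mI xj xk|].
  move=> y /and3P[yi yj yk]; have [<-//|ny] := eqVneq y x'.
  by have := fam_inj eg' (inc2_eq ny yi xi' yj xj') => e; rewrite e eqxx in ij.
apply/idP/idP.
  by apply: (key f f').
by apply: (key f' f) => // a b; rewrite mm.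
Qed.

(** A point on a single chord f i is recognized as the other end of f i: the first
end lies on a second chord, or the two ends would not be separated. *)
Lemma match_pt (f f' : I -> chord n) : 1 < n -> exc_fam f -> exc_fam f' ->
  (forall i j, meet (f i) (f j) = meet (f' i) (f' j)) ->
  forall p : pt, exists p' : pt, forall k, inc p (f k) = inc p' (f' k).
Proof.
move=> n1 ef ef' mm p.
have [i pi] := fam_cover ef p (ltnW n1).
have [/existsP[j /andP[ij pj]]|] := boolP [exists j, (i != j) && inc p (f j)].
  exact: match_deg2 ij pi pj.
rewrite negb_exists => /forallP deg1.
have only k : inc p (f k) = (k == i).
  have [->//|ki] := eqVneq k i; have := deg1 k; rewrite negb_and negbK eq_sym (negPf ki) /=.
  by move/negPf.
have [q [pq qi]] : exists q, p != q /\ inc q (f i).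
  have := lo_neq_hi (f i); case/orP: pi => /eqP-> ne; [exists (hi (f i))|exists (lo (f i))];
  by rewrite /inc eqxx ?orbT // eq_sym.
have [/existsP[j /andP[ij qj]]|] := boolP [exists j, (i != j) && inc q (f j)]; last first.
  rewrite negb_exists => /forallP deg1'.
  suff e : p = q by rewrite e eqxx in pq.
  apply: (fam_sep ef) => // k; rewrite only.
  have [->|ki] := eqVneq k i; first by rewrite qi.
  by have := deg1' k; rewrite negb_and negbK eq_sym (negPf ki) /= => /negPf.
have [q' hq'] := match_deg2 ef ef' mm ij qi qj.
have qi' : inc q' (f' i) by rewrite -hq'.
have [p' [pq' pi']] : exists p', p' != q' /\ inc p' (f' i).
  have := lo_neq_hi (f' i); case/orP: qi' => /eqP-> ne; [exists (hi (f' i))|exists (lo (f' i))];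
  by rewrite /inc eqxx ?orbT // eq_sym.
exists p' => k; rewrite only; have [->|ki] := eqVneq k i; first by rewrite pi'.
apply/esym/negP => pk'.
have mm' a b : meet (f' a) (f' b) = meet (f a) (f b) by rewrite mm.
rewrite eq_sym in ki.
have [p'' hp''] := match_deg2 ef' ef mm' ki pi' pk'.
have := hp'' i; have := hp'' k; rewrite pi' pk' => /esym ek /esym ei.
have [e|ne] := eqVneq p'' p.
  by rewrite e only eq_sym (negPf ki) in ek.
have [e|ne'] := eqVneq p'' q.
  suff e' : p' = q' by rewrite e' eqxx in pq'.
  by apply: (fam_sep ef') => // a; rewrite hp'' e hq'.
have : inc p'' (f i) by [].
move: pi qi pq ne ne'; rewrite ei /inc -!val_eqE /= => *.
by have := ei; rewrite /inc -!val_eqE /=; lia.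
Qed.

(** A point is determined by the chords through it, so the points of the two families
can be matched by a permutation g that carries every chord to its counterpart.
Along a common ordering, g conjugates the product of the transpositions of one
family into that of the other; both products are the rotation, and a permutation
that commutes with the rotation is a power of it. *)
Lemma fam_rot (f f' : I -> chord n) : 1 < n -> exc_fam f -> exc_fam f' ->
  (forall i j, related (f i) (f j) = related (f' i) (f' j)) ->
  exists r : pt, forall i, f' i = permc (rot n ^+ r) (f i).
Proof.
move=> n1 ef ef' rr.
have mm i j : meet (f i) (f j) = meet (f' i) (f' j).
  by rewrite (fam_meet ef) (fam_meet ef') !rr.
have [phi phiP] := fin_all_exists (match_pt n1 ef ef' mm).
have phi_inj : injective phi.
  by move=> p q e; apply: (fam_sep ef) => // i; rewrite !phiP e.
pose g := perm phi_inj.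
have f'E i : f' i = permc g (f i).
  apply/esym/inc_ext => p; rewrite -[p](permKV g) inc_permc phiP.
  by rewrite -[phi _](permE phi_inj).
case: (ef) => s bs so.
have so' : exc_order f' s by move=> a b /so; rewrite /compat rr.
have e := fam_prod bs so; have e' := fam_prod bs so'.
have cg : (rot n ^ g)%g = rot n.
  rewrite -{2}e' -e !big_map; elim/big_rec2: _ => [|a x y _ <-]; first by rewrite conj1g.
  by rewrite conjMg f'E swap_permc.
have comm p : g (ordS p) = ordS (g p).
  by rewrite -!rotE -{2}cg permJ.
exists (g ord0) => i; rewrite f'E; congr (permc _ _); apply/permP => p.
have sw m q : g (iter m (@ordS n.+1) q) = iter m (@ordS n.+1) (g q).
  by elim: m => //= m <-; rewrite comm.
rewrite rotXE; transitivity (iter p (@ordS n.+1) (g ord0)).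
  by rewrite -sw iter_ordS0.
transitivity (iter p (@ordS n.+1) (iter (g ord0) (@ordS n.+1) ord0)).
  by rewrite iter_ordS0.
by rewrite -iterD addnC iterD iter_ordS0.
Qed.

End Match.

Section Chains.
Variables (n : nat) (I : finType) (f : I -> chord n).
Hypothesis ef : exc_fam f.
Let R i j := related (f i) (f j).

Lemma R_anti i j : R i j -> R j i -> i = j.
Proof.
move=> rij rji; apply/eqP/negPn/negP => /(fam_compat ef).
by rewrite /compat -/(R j i) -/(R i j) rij rji.
Qed.

Lemma R_order s : exc_order f s -> forall a b : 'I_n, R (s a) (s b) -> a <= b.
Proof.
by move=> so a b; apply: contraTT; rewrite -ltnNge => /so.
Qed.

Lemma R_meet i j : R i j -> meet (f i) (f j).
Proof. by move=> r; rewrite (fam_meet ef) -/(R i j) r. Qed.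

Lemma meet_R i j : meet (f i) (f j) -> R i j || R j i.
Proof. by rewrite (fam_meet ef). Qed.

(** All chords between two related ones i and j pass through the common endpoint of
f i and f j. *)
Lemma R_between i j x y : R i j -> i != j -> R i x -> R x j -> R i y -> R y j ->
  R x y || R y x.
Proof.
move=> rij nij ix xj iy yj; apply: meet_R.
have [p [pi pj]] : exists p, inc p (f i) /\ inc p (f j).
  by have /existsP[p /andP[]] := R_meet rij; exists p.
have through z : R i z -> R z j -> inc p (f z).
  move=> iz zj.
  have [<-//|niz] := eqVneq i z; have [<-//|njz] := eqVneq j z.
  have [|||q /and3P[qi qj qz]] := fam_triangle ef nij niz njz.
  - exact: R_meet. - exact: R_meet. - by rewrite meetC; exact: R_meet.
  have [<-//|nqp] := eqVneq q p.
  by have := fam_inj ef (inc2_eq nqp qi pi qj pj) => e; rewrite e eqxx in nij.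
by apply/existsP; exists p; rewrite !through.
Qed.

(** The relation is not transitive: the chords may meet at different points. Here
all four pass through one point, and around a point it is transitive. *)
Lemma R_trans_between i j k l : R i j -> i != j -> R i k -> k != j -> R k j -> R k l -> R l j ->
  R i l.
Proof.
move=> rij nij ik nkj kj kl lj.
have [->//|nki] := eqVneq i k.
have [<-//|nkl] := eqVneq k l.
have [->//|nlj] := eqVneq l j.
have njk : j != k by rewrite eq_sym.
have njl : j != l by rewrite eq_sym.
(* The chords at i, j, k share a point, and so do those at k, j, l; it is the same point, as
   it is common to the chords at j and k. *)
have [|||p /and3P[pi pj pk]] := fam_triangle ef nij nki njk.
- exact: R_meet. - exact: R_meet. - by rewrite meetC; exact: R_meet.
have [|||q /and3P[qk qj ql]] := fam_triangle ef nkj nkl njl.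
- exact: R_meet. - exact: R_meet. - by rewrite meetC; exact: R_meet.
have epq : q = p.
  apply/eqP/negPn/negP => ne.
  by have := fam_inj ef (inc2_eq ne qk pk qj pj) => e; rewrite e eqxx in nkj.
have mil : meet (f i) (f l) by apply/existsP; exists p; rewrite pi -epq.
case/orP: (meet_R mil) => // li.
case: (ef) => s bs so; case: (bs) => s' sK s'K.
have ord x y : R x y -> s' x <= s' y.
  by move=> r; apply: (R_order so); rewrite !s'K.
have a1 := ord _ _ ik; have a2 := ord _ _ kl; have a3 := ord _ _ li.
have e : s' i = s' k :> nat by apply/eqP; rewrite eqn_leq a1 (leq_trans a2 a3).
by have /(can_inj s'K) e' := val_inj e; rewrite e' eqxx in nki.
Qed.

End Chains.

(** * Bound quivers drawn by chords *)

Section Emb.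
Variables (K : fieldType) (n : nat).

Definition visited (Q : quiver) (p : qpath Q) : seq Q :=
  qstart p :: map (@tgt Q) (qarrows p).

(** In the Yoneda algebra of modules drawn as chords, these are the paths with a
non-zero value: a product of basis elements vanishes as soon as the start is not
related to the vertex that has been reached. *)
Definition good (Q : quiver) (f : Q -> chord n) (p : qpath Q) : bool :=
  all (fun w => related (f (qstart p)) (f w)) (visited p).

Definition covers (I : finType) (f : I -> chord n) (i j : I) : bool :=
  [&& i != j, related (f i) (f j) &
      [forall k, ~~ [&& k != i, k != j, related (f i) (f k) & related (f k) (f j)]]].

(** The arrows of a Hom-Ext quiver are the irreducible related pairs: those which
are not composed of two others. *)
Definition draws (Q : quiver) (f : Q -> chord n) : Prop :=
  [/\ exc_fam f,
      forall a : arrow Q, covers f (src a) (tgt a),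
      forall a b : arrow Q, src a = src b -> tgt a = tgt b -> a = b &
      forall i j : Q, covers f i j -> exists2 a : arrow Q, src a = i & tgt a = j].

(** Good paths with different ends are independent, and two good paths with the same
ends are equal; so the ideal consists of the combinations of all other paths. *)
Definition drawing (B : bound_quiver K) (f : B -> chord n) : Prop :=
  draws f /\ forall z : path_algebra K B,
    bq_rel z <-> forall p, good f p -> (z@_p = 0)%R.

Section Draws.
Variables (Q : quiver) (f : Q -> chord n).
Hypothesis df : draws f.

Lemma draws_exc : exc_fam f. Proof. by case: df. Qed.

Lemma good_rcons (v : Q) s a (w : walk v (rcons s a)) :
  exists2 w' : walk v s, src a = walk_end v s &
  good f (QPath (qpath_val := (v, rcons s a)) w) =
  good f (QPath (qpath_val := (v, s)) w') && related (f v) (f (tgt a)).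
Proof.
have /andP[w' /eqP e] : walk v s && (src a == walk_end v s).
  by move: w; rewrite -cats1 walk_cat /= andbT.
exists w' => //.
by rewrite /good /visited /qstart /qarrows /= map_rcons all_rcons related_refl /= andbC.
Qed.

Lemma good_end p : good f p -> related (f (qstart p)) (f (qend p)).
Proof.
move/allP => h; apply: h; rewrite /visited /qend /walk_end; exact: mem_last.
Qed.

Lemma arrow_rel (a : arrow Q) : related (f (src a)) (f (tgt a)) /\ src a != tgt a.
Proof. by case: df => _ /(_ a) /and3P[-> -> _]. Qed.

Lemma walk_rank s s' v t (w : walk v t) :
  exc_order f s -> cancel s' s ->
  s' v + size t <= s' (walk_end v t).
Proof.
move=> so s'K; elim: t v w => [|a t IH] v /=; first by rewrite addn0.
case/andP => /eqP <- w; have [r ne] := arrow_rel a.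
have le : s' (src a) <= s' (tgt a) by apply: (R_order so); rewrite !s'K.
have lt : s' (src a) < s' (tgt a).
  by rewrite ltn_neqAle le andbT; apply: contra ne => /eqP/val_inj/(can_inj s'K)->.
have := IH _ w; rewrite /walk_end /=; lia.
Qed.

(** The last but one vertices of two good paths lie between the common start and the
common end, so they are related by [R_between]; both are covered by the end, so
they are equal. *)
Lemma good_uniq p q : good f p -> good f q -> qstart p = qstart q -> qend p = qend q -> p = q.
Proof.
case: p q => [[v s] w] [[v' t] w'] /=; rewrite /qend /qstart /qarrows /= => gp gq e.
subst v'; move=> ee; apply: val_inj => /=; congr (_, _).
have ef := draws_exc; case: (ef) => o bo so; case: (bo) => o' oK o'K.
have no_loop (u : Q) (t' : seq (arrow Q)) (wu : walk u t') : u = walk_end u t' -> t' = [::].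
  move=> e; have := walk_rank wu so o'K; rewrite -e -[X in _ <= X]addn0 leq_add2l leqn0.
  by move/nilP.
elim/last_ind: s t w w' gp gq ee => [|s a IH] t w w' gp gq ee.
  by rewrite (no_loop v t).
case/lastP: t w' gq ee => [|t b] w' gq ee.
  by rewrite (no_loop v (rcons s a)).
have [ws ea ga] := good_rcons w; have [wt eb gb] := good_rcons w'.
have tab : tgt a = tgt b.
  by move: ee; rewrite /walk_end !map_rcons !last_rcons.
move: gp gq; rewrite ga gb => /andP[gs ra] /andP[gt rb].
have rs := good_end gs; have rt := good_end gt.
rewrite /qend /qstart /qarrows /= -ea -?eb in rs rt.
have [Ra na] := arrow_rel a; have [Rb nb] := arrow_rel b.
have va : v != tgt a.
  apply/eqP => e; have := no_loop v _ w.
  by rewrite /walk_end map_rcons last_rcons => /(_ e) /(congr1 size); rewrite size_rcons.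
have sab : src a = src b.
  apply/eqP/negPn/negP => ne.
  rewrite -tab in Rb nb.
  have cov (x y : arrow Q) : tgt x = tgt y -> src x != src y -> ~~ related (f (src x)) (f (src y)).
    move=> txy nxy; apply/negP => rxy; case: (df) => _ /(_ x) /and3P[_ _ /forallP/(_ (src y))] + _ _.
    have [Ry ny] := arrow_rel y.
    by rewrite rxy txy Ry ny eq_sym nxy.
  have := R_between ef ra va rs Ra rt Rb.
  by rewrite (negPf (cov _ _ tab ne)) (negPf (cov _ _ (esym tab) _)) // eq_sym.
have eab : a = b by case: (df) => _ _ h _; apply: h.
subst b; congr (rcons _ _); apply: (IH t ws wt gs gt).
by rewrite -ea -eb.
Qed.

(** By induction on the place of the end: the latest vertex that is strictly before
the end and related to both i and j is covered by j, by [R_trans_between]. *)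
Lemma good_exists i j : related (f i) (f j) ->
  exists p : qpath Q, [/\ good f p, qstart p = i & qend p = j].
Proof.
have ef := draws_exc; case: (ef) => o bo so; case: (bo) => o' oK o'K.
have rk x y : related (f x) (f y) -> x != y -> o' x < o' y.
  move=> r ne; have le : o' x <= o' y by apply: (R_order so); rewrite !o'K.
  by rewrite ltn_neqAle le andbT; apply: contra ne => /eqP/val_inj/(can_inj o'K)->.
have [m] := ubnP (o' j); elim: m j => // m IH j lt rij.
have [->|nij] := eqVneq i j.
  exists (QPath (qpath_val := (j, [::])) isT).
  by rewrite /good /= /qend /qstart /= related_refl.
have [k [nkj cik rik]] : exists k, [/\ k != j, covers f k j & related (f i) (f k)].
  pose P k := [&& k != j, related (f i) (f k) & related (f k) (f j)].
  have Pi : P i by rewrite /P nij related_refl rij.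
  case: (@arg_maxnP Q i P (fun k => o' k)) => // k /and3P[nkj ik kj] mx.
  exists k; split => //; apply/and3P; split=> //; apply/forallP => l.
  apply/negP => /and4P[nlk nlj kl lj].
  have il : related (f i) (f l) by apply: (R_trans_between ef rij nij ik nkj kj kl lj).
  have := mx l; rewrite /P nlj il lj => /(_ isT) /=.
  by have := rk _ _ kl; rewrite eq_sym nlk => /(_ isT); rewrite ltnNge => /negP.
have rkj : related (f k) (f j) by case/and3P: cik.
have [|[[v s] w] [gp vi ek]] := IH k _ rik.
  by apply: leq_trans (rk _ _ rkj nkj) _; rewrite -ltnS.
have [a sa ta] : exists2 a : arrow Q, src a = k & tgt a = j by case: df => _ _ _; apply.
have w2 : walk v (rcons s a).
  by rewrite -cats1 walk_cat /= w sa -ek /qend /= eqxx.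
exists (QPath (qpath_val := (v, rcons s a)) w2).
have [w' _ ->] := good_rcons w2; split=> //; last first.
  by rewrite /qend /= /qarrows /= /walk_end map_rcons last_rcons.
have -> : w' = w by exact: bool_irrelevance.
by rewrite gp ta; move: rij; rewrite -vi.
Qed.
End Draws.

(** The ideal determines the relation between the chords of any drawing. *)
Lemma drawing_rel (B : bound_quiver K) (f : B -> chord n) i j : drawing f ->
  related (f i) (f j) <->
  exists p : qpath B, [/\ ~ bq_rel (qbasis p : path_algebra K B), qstart p = i & qend p = j].
Proof.
move=> [df rf]; split.
  move=> r; have [p [gp pi pj]] := good_exists df r.
  exists p; split=> // /rf/(_ p gp); rewrite mcoeff_qbasis eqxx => /eqP.
  by rewrite oner_eq0.
case=> p [np <- <-]; apply: (good_end (f := f)); apply/negPn/negP => ngp.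
apply: np; apply/rf => q gq; rewrite mcoeff_qbasis; case: eqP => // e.
by rewrite e gq in ngp.
Qed.

Lemma drawing_rel_eq (B : bound_quiver K) (f f' : B -> chord n) : drawing f -> drawing f' ->
  forall i j, related (f i) (f j) = related (f' i) (f' j).
Proof.
move=> df df' i j; apply/idP/idP.
  by move/(drawing_rel i j df)/(drawing_rel i j df').
by move/(drawing_rel i j df')/(drawing_rel i j df).
Qed.
End Emb.

(** * Drawings and isomorphisms of bound quivers *)

Section QuiverMap.
Variables (K : fieldType) (Q Q' : quiver) (f : Q -> Q') (g : arrow Q -> arrow Q').
Hypothesis fg : quiver_iso f g.

Lemma qiso_walk v s : walk (f v) (map g s) = walk v s.
Proof.
case: fg => [[f' fK _] _ h]; elim: s v => //= a s IH v.
by case: (h a) => -> ->; rewrite IH (inj_eq (can_inj fK)).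
Qed.

Lemma qiso_map_tgt s : map (@tgt Q') (map g s) = map f (map (@tgt Q) s).
Proof. by rewrite -!map_comp; apply: eq_map => a /=; case: fg => _ _ /(_ a) []. Qed.

Definition qmap (p : qpath Q) : qpath Q' :=
  QPath (qpath_val := (f (qstart p), map g (qarrows p)))
    (etrans (qiso_walk _ _) (qpathP p)).

Lemma qmap_inj : injective qmap.
Proof.
case: fg => [[f' fK _] [g' gK _] _].
case=> [[v s] w] [[v' s'] w'] /(congr1 (@qpath_val Q')) [] /(can_inj fK).
rewrite /qstart /qarrows /= => e /(inj_map (can_inj gK)) e'.
by apply: val_inj => /=; rewrite e e'.
Qed.

Lemma qmap_surj p : exists q, p = qmap q.
Proof.
case: (fg) => [[f' _ f'K] [g' _ g'K] _].
case: p => [[v s] w] /=.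
have w' : walk (f' v) (map g' s).
  by rewrite -qiso_walk f'K -map_comp map_id_in // => a _ /=; rewrite g'K.
exists (QPath (qpath_val := (f' v, map g' s)) w'); apply: val_inj => /=.
by rewrite /qstart /qarrows /= f'K -map_comp map_id_in // => a _ /=; rewrite g'K.
Qed.

Lemma pa_mapE (z : path_algebra K Q) : pa_map f g z = lin_ext (fun p => qbasis (qmap p)) z.
Proof.
by apply: eq_lin_ext => p; rewrite -walk_elt_qpath.
Qed.

Lemma pa_map_coef (z : path_algebra K Q) p : ((pa_map f g z)@_(qmap p) = z@_p)%R.
Proof.
rewrite pa_mapE -[in RHS](lin_ext_id z) /lin_ext !raddf_sum; apply: eq_bigr => q _ /=.
rewrite !mcoeffZ !mcoeff_qbasis; congr (_ * _)%R.
by rewrite (inj_eq qmap_inj).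
Qed.

Lemma good_qmap n (h : Q' -> chord n) p : good h (qmap p) = good (h \o f) p.
Proof.
rewrite /good /visited /qstart /qarrows /= qiso_map_tgt !related_refl /=.
by rewrite all_map.
Qed.
End QuiverMap.

Section Transport.
Variables (K : fieldType) (n : nat) (B B' : bound_quiver K) (phi : B -> B').
Hypothesis bphi : bijective phi.

Lemma covers_comp (I J : finType) (h : I -> J) (f : J -> chord n) i j : bijective h ->
  covers (f \o h) i j = covers f (h i) (h j).
Proof.
move=> [h' hK h'K]; rewrite /covers /= (inj_eq (can_inj hK)); congr [&& _, _ & _].
apply/forallP/forallP => H k; last by have := H (h k); rewrite !(inj_eq (can_inj hK)).
by have := H (h' k); rewrite -!(inj_eq (can_inj hK)) h'K.
Qed.

Lemma exc_fam_comp (I J : Type) (h : I -> J) (f : J -> chord n) : bijective h ->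
  exc_fam f -> exc_fam (f \o h).
Proof.
move=> [h' hK h'K] [s bs so]; exists (h' \o s).
  by apply: bij_comp => //; exists h.
by move=> a b /so; rewrite /= !h'K.
Qed.

(** A bound quiver can be recovered from any of its drawings. *)
Lemma drawing_iso (f : B -> chord n) (f' : B' -> chord n) :
  drawing f -> drawing f' -> f =1 f' \o phi -> exists psi, bq_iso phi psi.
Proof.
move=> [df rf] [df' rf'] ff'.
have cE i j : covers f i j = covers f' (phi i) (phi j).
  rewrite -covers_comp // /covers ff' ff'; congr [&& _, _ & _].
  by apply: eq_forallb => k; rewrite !ff'.
case: (df) => _ ca ua ea; case: (df') => _ ca' ua' ea'.
have ex a : exists b : arrow B', src b = phi (src a) /\ tgt b = phi (tgt a).
  have := ca a; rewrite cE => /ea' [b sb tb]; by exists b.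
have [psi psiP] := fin_all_exists ex.
have psi_inj : injective psi.
  move=> a b e; have [s1 t1] := psiP a; have [s2 t2] := psiP b.
  by apply: ua; apply: (bij_inj bphi); rewrite -?s1 -?s2 -?t1 -?t2 e.
case: (bphi) => phi' phiK phi'K.
have ex' b : exists a, psi a = b.
  have := ca' b; rewrite -(phi'K (src b)) -(phi'K (tgt b)) -cE => /ea [a sa ta].
  by exists a; have [s1 t1] := psiP a; apply: ua'; rewrite ?s1 ?t1 ?sa ?ta phi'K.
have [psi' psi'K] := fin_all_exists ex'.
exists psi; have qi : quiver_iso phi psi.
  by split=> //; exists psi' => // a; apply: psi_inj; rewrite psi'K.
split=> // z; rewrite rf rf'; split=> H p gp.
  have [q e] := qmap_surj qi p; rewrite e pa_map_coef; apply: H.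
  move: gp; rewrite e good_qmap /good => /allP gp; apply/allP => w /gp /=.
  by rewrite !ff'.
rewrite -(pa_map_coef qi); apply: H; rewrite good_qmap /good.
by move: gp => /allP gp; apply/allP => w /gp; rewrite /= !ff'.
Qed.

Lemma iso_drawing (f' : B' -> chord n) psi : bq_iso phi psi -> drawing f' -> drawing (f' \o phi).
Proof.
move=> [qi ri] [[ef' ca' ua' ea'] rf'].
case: (qi) => _ [psi' psiK psi'K] st.
have inj := bij_inj bphi.
split; last first.
  move=> z; rewrite ri rf'; split=> H p gp.
    by rewrite -(pa_map_coef qi); apply: H; rewrite good_qmap.
  have [q e] := qmap_surj qi p; rewrite e pa_map_coef; apply: H.
  by rewrite -(good_qmap qi) -e.
split.
- exact: exc_fam_comp.
- by move=> a; rewrite covers_comp //; have [<- <-] := st a.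
- move=> a b sab tab; apply: (can_inj psiK); have [s1 t1] := st a; have [s2 t2] := st b.
  by apply: ua'; rewrite ?s1 ?s2 ?t1 ?t2 ?sab ?tab.
- move=> i j; rewrite covers_comp // => /ea' [b sb tb]; exists (psi' b).
    by apply: inj; rewrite -(st _).1 psi'K.
  by apply: inj; rewrite -(st _).2 psi'K.
Qed.
End Transport.

(** * Counting orderings, drawings and automorphisms *)

Section Count.
Variables (K : fieldType) (n : nat).
Hypothesis n1 : 1 < n.

Definition orderings (I : finType) (f : I -> chord n) : {set {ffun 'I_n -> I}} :=
  [set s : {ffun 'I_n -> I} | injectiveb s &
     [forall a : 'I_n, forall b : 'I_n, (a < b) ==> compat (f (s a)) (f (s b))]].

Lemma orderingsP (I : finType) (f : I -> chord n) (s : {ffun 'I_n -> I}) :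
  reflect (injective s /\ exc_order f s) (s \in orderings f).
Proof.
rewrite inE; apply: (iffP andP) => [[/injectiveP i h]|[i h]]; split=> //.
- by move=> a b ab; move/forallP/(_ a)/forallP/(_ b)/implyP: h; apply.
- exact/injectiveP.
- by apply/forallP => a; apply/forallP => b; apply/implyP; apply: h.
Qed.

Definition exc_seqs : {set {ffun 'I_n -> chord n}} :=
  [set s : {ffun 'I_n -> chord n} |
     [forall a : 'I_n, forall b : 'I_n, (a < b) ==> compat (s a) (s b)]].

Lemma exc_seqsP (s : {ffun 'I_n -> chord n}) : reflect (exc_order s id) (s \in exc_seqs).
Proof.
rewrite inE; apply: (iffP idP) => [h|h].
- by move=> a b ab; move/forallP/(_ a)/forallP/(_ b)/implyP: h; apply.
- by apply/forallP => a; apply/forallP => b; apply/implyP; apply: h.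
Qed.

Section LinearExtensions.
Variables (Q : quiver) (f : Q -> chord n).
Hypothesis df : draws f.
Let R i j := related (f i) (f j).

Lemma draws_card : #|Q| = n.
Proof.
by case: (draws_exc df) => s bs _; rewrite -(bij_eq_card bs) card_ord.
Qed.

Lemma inj_bij_ord (s : 'I_n -> Q) : injective s -> bijective s.
Proof. by move=> i; apply: inj_card_bij => //; rewrite draws_card card_ord. Qed.

(** Related vertices are joined by a path, so the arrows and the relation generate
the same partial order. *)
Lemma le_e_rel (le : rel Q) : reflexive le -> transitive le ->
  (forall i j, le_e i j -> le i j) <-> (forall i j, R i j -> le i j).
Proof.
move=> lr lt; split=> H i j.
  move=> /(good_exists df) [[[v s] w] [_ <- <-]]; apply: H.
  rewrite /qend /qstart /qarrows /=; elim: s v w => [|a s IH] v /=; first by rewrite /le_e connect0.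
  case/andP => /eqP <- w; apply: connect_trans (connect1 _) (IH _ w).
  by apply/existsP; exists a; rewrite !eqxx.
case/connectP => p; elim: p i => [|k p IH] i /=; first by move=> _ ->; apply: lr.
case/andP => /existsP[a /andP[/eqP <- /eqP <-]] hp e.
by apply: lt (IH _ hp e); apply: H; have [] := arrow_rel df a.
Qed.

(** The total order of an enumeration s, in the form in which linear extensions are
given: as a set of pairs. *)
Definition chain_of (s : {ffun 'I_n -> Q}) : {set Q * Q} :=
  [set ij | [exists a : 'I_n, exists b : 'I_n, [&& a <= b, ij.1 == s a & ij.2 == s b]]].

Lemma chain_ofE (s : {ffun 'I_n -> Q}) a b : injective s -> ((s a, s b) \in chain_of s) = (a <= b).
Proof.
move=> si; rewrite inE; apply/existsP/idP => [[a' /existsP[b' /= /and3P[le]]]|le].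
  by move=> /eqP/si-> /eqP/si->.
by exists a; apply/existsP; exists b; rewrite le !eqxx.
Qed.

Lemma chain_of_linext (s : {ffun 'I_n -> Q}) : s \in orderings f -> chain_of s \in linear_extensions Q.
Proof.
move=> /orderingsP[si so]; rewrite inE; apply/asboolP => le.
have [s' sK s'K] := inj_bij_ord si.
have leE i j : le i j = (s' i <= s' j).
  by rewrite /le -{1}(s'K i) -{1}(s'K j) chain_ofE.
have ltr : transitive le by move=> y x z; rewrite !leE; apply: leq_trans.
split=> //.
- by move=> i j; rewrite !leE leq_total.
- move=> i j; rewrite !leE => e; apply: (can_inj s'K); apply: val_inj => /=.
  by apply/eqP; rewrite eqn_leq.
- apply/(le_e_rel _ ltr) => [i|i j r]; first by rewrite leE.
  by rewrite leE; apply: (R_order so); rewrite !s'K.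
Qed.

Lemma chain_of_inj : {in orderings f &, injective chain_of}.
Proof.
move=> s t /orderingsP[si so] /orderingsP[ti to] e.
pose le i j := (i, j) \in chain_of s.
have := chain_of_linext (introT (orderingsP f s) (conj si so)).
rewrite inE => /asboolP [_ an tr _].
have srt (u : {ffun 'I_n -> Q}) : injective u -> chain_of u = chain_of s -> sorted le (map u (enum 'I_n)).
  move=> ui eu; rewrite sorted_map; apply: (@sub_sorted _ (relpre val leq)).
    by move=> a b /= ab; rewrite /le -eu chain_ofE.
  by rewrite -sorted_map val_enum_ord; apply: iota_sorted.
have : map s (enum 'I_n) = map t (enum 'I_n).
  apply: (sorted_eq tr an); rewrite ?srt //.
  apply: uniq_perm => [||x].
  - by rewrite (map_inj_uniq si) enum_uniq.
  - by rewrite (map_inj_uniq ti) enum_uniq.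
  have [s' _ s'K] := inj_bij_ord si; have [t' _ t'K] := inj_bij_ord ti.
  by rewrite -{1}(s'K x) -{2}(t'K x) !map_f ?mem_enum.
move/eq_in_map => h; apply/ffunP => a; apply: h; exact: mem_enum.
Qed.

Lemma chain_of_surj S : S \in linear_extensions Q -> exists2 s, s \in orderings f & S = chain_of s.
Proof.
rewrite inE => /asboolP /=; set le := (fun i j => _).
case=> tot an tr ext.
have refl : reflexive le by move=> i; have := tot i i; rewrite orbb.
pose q := sort le (enum Q).
have sq : size q = n by rewrite size_sort -cardE draws_card.
have [x0 _] : exists x : Q, true.
  have := draws_card; case: (pickP (predT : {pred Q})) => [x _|e0] _; first by exists x.
  by have := draws_card; rewrite (eq_card0 e0); lia.
pose s : {ffun 'I_n -> Q} := [ffun a : 'I_n => nth x0 q a].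
have uq : uniq q by rewrite sort_uniq enum_uniq.
have si : injective s.
  move=> a b; rewrite !ffunE => /eqP; rewrite nth_uniq ?sq // => /eqP e; exact: val_inj.
have leE a b : le (s a) (s b) = (a <= b).
  have mono (c d : 'I_n) : c <= d -> le (s c) (s d).
    move=> cd; rewrite !ffunE; apply: (sorted_leq_nth tr refl) => //.
    - exact: sort_sorted. - by rewrite inE sq. - by rewrite inE sq.
  apply/idP/idP; last exact: mono.
  move=> l; rewrite leqNgt; apply/negP => ba.
  have l' := mono _ _ (ltnW ba).
  have /si e : s a = s b by apply: an; rewrite l l'.
  by rewrite e ltnn in ba.
exists s.
  apply/orderingsP; split=> // a b ab; apply/negP => r.
  have /(le_e_rel refl tr) h := ext.
  by have := h _ _ r; rewrite leE leqNgt ab.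
apply/setP => -[i j]; have [s' sK s'K] := inj_bij_ord si.
by rewrite -(s'K i) -(s'K j) chain_ofE //; apply: leE.
Qed.

Lemma card_linext : #|linear_extensions Q| = #|orderings f|.
Proof.
rewrite -(card_in_imset chain_of_inj); apply: eq_card => S.
apply/idP/imsetP => [/chain_of_surj[s so ->]|[s so ->]]; first by exists s.
exact: chain_of_linext.
Qed.
End LinearExtensions.

Section Fibres.
Variable B : bound_quiver K.

Definition drawings : {set {ffun B -> chord n}} := [set f : {ffun B -> chord n} | `[< drawing f >]].

Lemma eq_drawing (f g : B -> chord n) : f =1 g -> drawing f -> drawing g.
Proof. by move=> /funext ->. Qed.

Lemma drawing_permc (f : B -> chord n) r : drawing f -> drawing (fun i => permc (rot n ^+ r) (f i)).
Proof.
move=> [[ef ca ua ea] rf].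
have cE i j : covers (fun i => permc (rot n ^+ r) (f i)) i j = covers f i j.
  rewrite /covers related_rotX; congr [&& _, _ & _]; apply: eq_forallb => k.
  by rewrite !related_rotX.
split; last first.
  move=> z; rewrite rf; split=> H p gp; apply: H; move: gp; rewrite /good => /allP h; apply/allP => w /h;
  by rewrite related_rotX.
split=> //; first exact: exc_fam_rot.
- by move=> a; rewrite cE.
- by move=> i j; rewrite cE; apply: ea.
Qed.

(** The drawings of B form one free orbit under the rotations, by [fam_rot] and
[rot_free]. *)
Lemma card_drawings (f : B -> chord n) : drawing f -> #|drawings| = n.+1.
Proof.
move=> df; have [dd _] := df; have ef := draws_exc dd.
pose h (r : 'I_n.+1) : {ffun B -> chord n} := [ffun i => permc (rot n ^+ r) (f i)].
have hi : injective h.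
  move=> r r' /ffunP e; apply: (rot_free ef n1) => i; have := e i; by rewrite !ffunE.
rewrite -(card_ord n.+1) -(card_imset _ hi); apply: eq_card => g.
rewrite inE; apply/asboolP/imsetP => [dg|[r _ ->]].
  have eg := draws_exc (proj1 dg).
  have [r hr] := fam_rot n1 ef eg (drawing_rel_eq df dg).
  by exists r => //; apply/ffunP => i; rewrite ffunE -hr.
apply: eq_drawing (drawing_permc r df) => i; by rewrite ffunE.
Qed.

Definition seqs_of : {set {ffun 'I_n -> chord n}} :=
  [set s : {ffun 'I_n -> chord n} | (s \in exc_seqs) &&
    `[< exists f : B -> chord n, drawing f /\ exists2 t : 'I_n -> B, bijective t & s =1 f \o t >]].

Let compose (x : {ffun 'I_n -> B} * {ffun B -> chord n}) : {ffun 'I_n -> chord n} :=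
  [ffun a => x.2 (x.1 a)].

Let composeE s f a : compose (s, f) a = f (s a). Proof. by rewrite ffunE. Qed.

Let pairs (f : B -> chord n) : {set {ffun 'I_n -> B} * {ffun B -> chord n}} :=
  setX (orderings f) drawings.

Lemma orderings_eq (f g : B -> chord n) : drawing f -> drawing g -> orderings f = orderings g.
Proof.
move=> df dg; apply/setP => s; rewrite !inE; congr (_ && _).
apply: eq_forallb => a; apply: eq_forallb => b; congr (_ ==> _).
by rewrite /compat (drawing_rel_eq df dg).
Qed.

Lemma bq_autP (x : {perm B} * {perm arrow B}) :
  x \in bq_aut B <-> bq_iso (fun v => x.1 v) (fun a => x.2 a).
Proof. by rewrite /bq_aut finset.in_set; split=> [/asboolP|h] //; apply/asboolP. Qed.

Lemma aut_eq (x y : {perm B} * {perm arrow B}) (f : B -> chord n) : drawing f ->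
  x \in bq_aut B -> y \in bq_aut B -> x.1 = y.1 -> x = y.
Proof.
case: x y => [p a] [p' b] [[_ _ ua _] _]; rewrite !inE => /asboolP [[_ _ sa] _] /asboolP [[_ _ sb] _] /= e.
rewrite /= in sa sb.
subst p'; congr (_, _); apply/permP => c; have [s1 t1] := sa c; have [s2 t2] := sb c.
by apply: ua; rewrite ?s1 ?s2 ?t1 ?t2.
Qed.

(** Two pairs (s, f) with the same composite f o s differ by the permutation of the
vertices that compares s with s0; it is an automorphism by [drawing_iso]. *)
Lemma card_fibre (f0 : B -> chord n) x0 : drawing f0 -> x0 \in pairs f0 ->
  #|[set x in pairs f0 | compose x == compose x0]| = #|bq_aut B|.
Proof.
case: x0 => [s0 g0] df0; rewrite inE /= => /andP[os0]; rewrite inE => /asboolP dg0.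
rewrite (orderings_eq df0 dg0) in os0.
have [si0 so0] := orderingsP _ _ os0.
have [dd0 _] := dg0; have [s0' s0K s0'K] := inj_bij_ord dd0 si0.
pose h (x : {perm B} * {perm arrow B}) : {ffun 'I_n -> B} * {ffun B -> chord n} :=
  ([ffun a => (x.1^-1)%g (s0 a)], [ffun i => g0 (x.1 i)]).
have hi : {in bq_aut B &, injective h}.
  move=> x y xa ya [_ /ffunP e]; apply: (aut_eq dg0 xa ya); apply/permP => i.
  by have := e i; rewrite !ffunE => /(fam_inj (draws_exc dd0)).
rewrite -(card_in_imset hi); apply: eq_card => -[s g].
apply/idP/imsetP => [|[[p q] pq [-> ->]]]; last first.
  move/bq_autP: pq => /= pq.
  have dp : drawing (g0 \o p). have bp : bijective (fun v => p v) by exists (p^-1)%g; [exact: permK|exact: permKV].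
    exact: (iso_drawing bp pq dg0).
  rewrite inE; apply/andP; split; last first.
    by apply/eqP/ffunP => a; rewrite !composeE !ffunE permKV.
  rewrite in_setX; apply/andP; split => /=.
    rewrite (orderings_eq df0 dp); apply/orderingsP; split.
      by move=> a b; rewrite !ffunE => /perm_inj/si0.
    have E a : (g0 \o p) ([ffun a => (p^-1)%g (s0 a)] a) = g0 (s0 a) by rewrite /= ffunE permKV.
    by move=> a b /so0; rewrite !E.
  by rewrite inE; apply/asboolP; apply: eq_drawing dp => i; rewrite ffunE.
rewrite inE => /andP[]; rewrite inE => /andP[/= os]; rewrite inE => /asboolP dg /eqP/ffunP e.
rewrite (orderings_eq df0 dg) in os.
have [si so] := orderingsP _ _ os.
have [s' sK s'K] := inj_bij_ord dd0 si.
have pi : injective (s0 \o s').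
  by apply: inj_comp => //; apply: can_inj s'K.
have gE : g =1 g0 \o perm pi.
  move=> i; rewrite /= permE /=; have := e (s' i); by rewrite !composeE /= s'K.
have bp : bijective (perm pi) by exists ((perm pi)^-1)%g; [exact: permK|exact: permKV].
have [psi iso] := drawing_iso bp dg dg0 gE.
have psi_inj : injective psi by case: iso => [[_ /bij_inj]].
exists (perm pi, perm psi_inj).
  rewrite inE; apply/asboolP => /=.
  by have -> : (fun a => perm psi_inj a) = psi by apply/funext => a; rewrite permE.
congr (_, _); apply/ffunP => i; rewrite ffunE /=; last by rewrite gE.
by apply: (@perm_inj _ (perm pi)); rewrite permKV permE /= sK.
Qed.

(** Both sides count the pairs (s, f) of an ordering of the vertices and a drawing.
There are n+1 drawings, each with the same orderings; and the fibres of
(s, f) |-> f o s are counted by the automorphisms. *)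
Lemma card_seqs_of (f : B -> chord n) : drawing f ->
  #|orderings f| * n.+1 = #|seqs_of| * #|bq_aut B|.
Proof.
move=> df; rewrite -(card_drawings df) -cardsX -/(pairs f) -sum1_card.
rewrite (partition_big compose [in seqs_of]) /=.
  rewrite -sum_nat_const; apply: eq_bigr => s.
  rewrite inE => /andP[/exc_seqsP es /asboolP[g [dg [t bt st]]]].
  have pt : ([ffun a => t a], [ffun i => g i]) \in pairs f.
    rewrite inE /= (orderings_eq df dg); apply/andP; split.
      apply/orderingsP; split; first by move=> a b; rewrite !ffunE => /(bij_inj bt).
      by move=> a b ab; have := es a b ab; rewrite /= !st /= !ffunE.
    by rewrite inE; apply/asboolP; apply: eq_drawing dg => i; rewrite ffunE.
  rewrite sum1_card -(card_fibre df pt); apply: eq_card => x.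
  rewrite [RHS]inE [LHS]unfold_in /=; congr (_ && (_ == _)).
  by apply/ffunP => a; rewrite st composeE !ffunE.
move=> [s g]; rewrite inE /= => /andP[os]; rewrite inE => /asboolP dg.
rewrite (orderings_eq df dg) in os; have [si so] := orderingsP _ _ os.
rewrite inE; apply/andP; split.
  by apply/exc_seqsP => a b /so; rewrite !composeE.
apply/asboolP; exists g; split=> //; exists s; first exact: inj_bij_ord (proj1 dg) _ si.
by move=> a; rewrite composeE.
Qed.

Lemma bq_aut_gt0 : 0 < #|bq_aut B|.
Proof.
apply/card_gt0P; exists (1%g, 1%g); rewrite inE; apply/asboolP; split=> [|z].
  split=> [||a]; rewrite ?perm1 //; by exists id => x; rewrite perm1.
suff -> : pa_map (fun v => (1%g : {perm B}) v) (fun a => (1%g : {perm arrow B}) a) z = z by [].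
rewrite -[RHS]lin_ext_id; apply: eq_lin_ext => p; rewrite perm1.
by rewrite (eq_map (g := id)) ?map_id ?walk_elt_qpath // => a; rewrite perm1.
Qed.
End Fibres.
End Count.

(** * The counting formula for classes of bound quivers *)

(** If every class contains some g i, the g i whose index is the least in its class
represent the classes. *)
Lemma class_reps_fin (T : Type) (P : T -> Prop) (r : T -> T -> Prop) (N : nat) (g : 'I_N -> T) :
  (forall i, P (g i)) -> (forall x, P x -> exists i, r x (g i)) ->
  (forall x y, P x -> P y -> r x y -> r y x) ->
  (forall x y z, P x -> P y -> P z -> r x y -> r y z -> r x z) ->
  exists (m : nat) (f : 'I_m -> T), class_reps P r f.
Proof.
move=> Pg cov sym trn.
pose A := [set i : 'I_N | [forall j : 'I_N, (j < i) ==> ~~ `[< r (g j) (g i) >]]].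
exists #|A|, (fun i => g (enum_val i)); split=> [i|i j rij|x Px]; first exact: Pg.
  have no (a b : 'I_#|A|) : r (g (enum_val a)) (g (enum_val b)) -> ~~ (enum_val a < enum_val b).
    move=> rab; apply/negP => lt; have := enum_valP b.
    by rewrite inE => /forallP/(_ (enum_val a))/implyP/(_ lt)/asboolP.
  apply: enum_val_inj; apply: val_inj => /=.
  have := no _ _ rij; have := no _ _ (sym _ _ (Pg _) (Pg _) rij); rewrite -!leqNgt => l1 l2.
  by apply/eqP; rewrite eqn_leq l1 l2.
have [i0 ri0] := cov x Px.
have Pi0 : `[< r x (g i0) >] by apply/asboolP.
case: (@arg_minnP _ i0 (fun i => `[< r x (g i) >]) (fun i => i) Pi0) => i /asboolP ri mi.
have iA : i \in A.
  rewrite inE; apply/forallP => j; apply/implyP => ji; apply/asboolP => rji.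
  have : j >= i by apply: mi; apply/asboolP; apply: trn ri _ => //; apply: sym rji.
  by rewrite leqNgt ji.
by exists (enum_rank_in iA i); rewrite enum_rankK_in.
Qed.

Section Formula.
Variables (K : fieldType) (n : nat).
Hypothesis n1 : 1 < n.

Lemma inv_drawing (B B' : bound_quiver K) phi psi (f : B -> chord n) (g : B' -> chord n) :
  bq_iso phi psi -> drawing f -> drawing g ->
  exists phi', [/\ cancel phi phi', cancel phi' phi & drawing (B := B') (f \o phi')].
Proof.
move=> iso df dg; case: (iso) => [[bphi _ _] _]; case: (bphi) => phi' phiK phi'K.
exists phi'; split=> //; have dgp := iso_drawing bphi iso dg.
have bphi' : bijective phi' by exists phi.
have [|psi' iso'] := drawing_iso bphi' dg dgp; first by move=> i; rewrite /= phi'K.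
exact: (iso_drawing bphi' iso' df).
Qed.

Lemma bq_iso_sym (B B' : bound_quiver K) (f : B -> chord n) (g : B' -> chord n) :
  drawing f -> drawing g -> bq_isomorphic B B' -> bq_isomorphic B' B.
Proof.
move=> df dg [phi [psi iso]]; have [phi' [phiK phi'K dfp]] := inv_drawing iso df dg.
have bphi' : bijective phi' by exists phi.
by have [psi' iso'] := drawing_iso bphi' dfp df (fun _ => erefl); exists phi', psi'.
Qed.

Lemma bq_iso_trans (B B' B'' : bound_quiver K) (h : B'' -> chord n) : drawing h ->
  bq_isomorphic B B' -> bq_isomorphic B' B'' -> bq_isomorphic B B''.
Proof.
move=> dh [phi [psi iso]] [phi' [psi' iso']].
case: (iso) (iso') => [[b _ _] _] [[b' _ _] _].
have d' := iso_drawing b' iso' dh; have d := iso_drawing b iso d'.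
have bb : bijective (phi' \o phi) by apply: bij_comp.
by have [p q] := drawing_iso bb d dh (fun _ => erefl); exists (phi' \o phi), p.
Qed.

Variable P : bound_quiver K -> Prop.
Hypothesis P_drawing : forall B, P B -> exists f : B -> chord n, drawing f.
Hypothesis P_seq : forall s : {ffun 'I_n -> chord n}, s \in exc_seqs n ->
  exists2 B, P B & s \in seqs_of n B.

Lemma seqs_of_nonempty B : P B -> exists2 s, s \in exc_seqs n & s \in seqs_of n B.
Proof.
move=> PB; have [f df] := P_drawing PB; case: (draws_exc (proj1 df)) => t bt ot.
pose s : {ffun 'I_n -> chord n} := [ffun a => f (t a)].
have es : s \in exc_seqs n by apply/exc_seqsP => a b /ot; rewrite !ffunE.
exists s => //; rewrite inE es; apply/asboolP; exists f; split=> //; exists t => // a.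
by rewrite ffunE.
Qed.

Lemma seqs_of_exc (B : bound_quiver K) s : s \in seqs_of n B -> s \in exc_seqs n.
Proof. by rewrite inE => /andP[]. Qed.

(** A drawn bound quiver is determined by any sequence of chords that it yields, so
the sets [seqs_of n B] partition the exceptional sequences of chords. *)
Lemma seqs_of_iso (B B' : bound_quiver K) (s : {ffun 'I_n -> chord n}) :
  s \in seqs_of n B -> s \in seqs_of n B' -> bq_isomorphic B B'.
Proof.
rewrite !inE => /andP[_ /asboolP[f [df [t bt st]]]] /andP[_ /asboolP[f' [df' [t' bt' st']]]].
case: (bt) => u tK uK.
have bb : bijective (t' \o u) by apply: bij_comp => //; exists t.
have [|psi iso] := drawing_iso bb df df'; last by exists (t' \o u), psi.
by move=> i /=; rewrite -{1}(uK i) -[LHS]st st'.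
Qed.

Lemma seqs_of_iso_trans (B B' : bound_quiver K) (g : B' -> chord n) (s : {ffun 'I_n -> chord n}) : drawing g ->
  bq_isomorphic B B' -> s \in seqs_of n B -> s \in seqs_of n B'.
Proof.
move=> dg [phi [psi iso]]; rewrite !inE => /andP[-> /asboolP[f [df [t bt st]]]] /=.
have [phi' [phiK phi'K d]] := inv_drawing iso df dg.
apply/asboolP; exists (f \o phi'); split=> //; exists (phi \o t).
  by apply: bij_comp => //; exists phi'.
by move=> a; rewrite st /= phiK.
Qed.

Lemma reps_exist : exists (m : nat) (B : 'I_m -> bound_quiver K), class_reps P (@bq_isomorphic K) B.
Proof.
pose N := #|exc_seqs n|.
have ch : forall i : 'I_N, exists B, P B /\ enum_val i \in seqs_of n B.
  by move=> i; have [B PB sB] := P_seq (enum_valP i); exists B.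
have [g gP] := choice ch.
apply: (class_reps_fin (g := g)).
- by move=> i; have [] := gP i.
- move=> B /seqs_of_nonempty [s es sB]; exists (enum_rank_in es s).
  apply: seqs_of_iso sB _; rewrite -{1}(enum_rankK_in es es).
  by have [] := gP (enum_rank_in es s).
- move=> x y /P_drawing[f df] /P_drawing[g' dg]; exact: bq_iso_sym df dg.
- by move=> x y z _ _ /P_drawing[h dh]; apply: bq_iso_trans dh.
Qed.

(** The exceptional sequences of chords are partitioned by the isomorphism classes
of bound quivers, and the part of B has n+1 times LinExt over Aut elements by
[card_seqs_of]. *)
Lemma reps_formula m (B : 'I_m -> bound_quiver K) : class_reps P (@bq_isomorphic K) B ->
  (#|exc_seqs n|%:R = n.+1%:R *
     \sum_(i < m) #|linear_extensions (B i)|%:R / #|bq_aut (B i)|%:R :> rat)%R.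
Proof.
case=> PB inj cov.
have eqs : #|exc_seqs n| = \sum_(i < m) #|seqs_of n (B i)|.
  (* The class of a sequence; it is None, later sent to 0, for the functions that are not
     exceptional sequences, and the classes are shifted by one to make room for it. *)
  have ex (s : {ffun 'I_n -> chord n}) : exists i : option 'I_m, s \in exc_seqs n ->
      exists2 j, i = Some j & s \in seqs_of n (B j).
    have [es|_] := boolP (s \in exc_seqs n); last by exists None.
    have [B' PB' sB'] := P_seq es; have [j iso] := cov _ PB'; exists (Some j) => _; exists j => //.
    by have [g dg] := P_drawing (PB j); apply: seqs_of_iso_trans dg iso sB'.
  have [cl clP] := choice ex.
  rewrite -sum1_card (partition_big (fun s => odflt (ord0) (omap (@lift _ ord0) (cl s))) predT) //=.
  rewrite big_ord_recl [X in X + _]big1 ?add0n => [|s /andP[es /eqP]]; last first.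
    by have [j -> _] := clP s es => /= /eqP; rewrite eq_sym (negPf (neq_lift _ _)).
  apply: eq_bigr => i _; rewrite sum1_card; apply: eq_card => s.
  apply/idP/idP; rewrite unfold_in /=.
    case/andP => es; have [j -> sj] := clP s es => /= /eqP/lift_inj <- //.
  move=> si; have es : s \in exc_seqs n by apply: seqs_of_exc si.
  apply/andP; split; first exact: es.
  have [j -> sj] := clP s es; rewrite /=.
  by rewrite (inj _ _ (seqs_of_iso sj si)).
rewrite eqs natr_sum mulr_sumr; apply: eq_bigr => i _.
have [f df] := P_drawing (PB i).
have := card_seqs_of n1 df; rewrite -(card_linext n1 (proj1 df)) => e.
have a0 : (#|bq_aut (B i)|%:R != 0 :> rat)%R by rewrite pnatr_eq0 -lt0n bq_aut_gt0.
apply: (mulIf a0); rewrite -!mulrA mulVf // mulr1 -!natrM; congr (_%:R)%R.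
by rewrite -e mulnC.
Qed.
End Formula.

(** * The overlap of two intervals of a line *)

Section Line.
Variables (n : nat) (low : nat -> bool).
Hypotheses (low0 : low 0) (lown : low n).

(** The place i of the line is the gap between its vertices i.-1 and i; [low i] says
that the arrow there points down, from i to i.-1. An arrow is eligible if it
leads from the interval [a, b) into the interval [c, d). *)
Definition elig (a b c d i : nat) : bool :=
  [&& 0 < i, i < n & if low i then (a <= i < b) && (c <= i.-1 < d)
                     else (a <= i.-1 < b) && (c <= i < d)].

(** The complex computing Hom and Ext of two interval modules has a generator for
each common vertex and one for each eligible arrow, that is, for the places
max(a,c) <= i <= min(b,d), of which the inner ones are always eligible. Hom is
non-zero if neither of the two outer places is, and Ext if both are. *)
Definition hom_cond (a b c d : nat) : bool :=
  [&& maxn a c < minn b d, ~~ elig a b c d (maxn a c) & ~~ elig a b c d (minn b d)].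
Definition ext_cond (a b c d : nat) : bool :=
  [&& maxn a c <= minn b d, elig a b c d (maxn a c) & elig a b c d (minn b d)].

(** The height of the places on the circle: the low ones in their order, and on top
of them the others in the opposite order. The ends 0 and n of the line carry no
arrow; that they count as low only fixes the point of the circle at which the heights start. *)
Definition key (x : nat) : nat := if low x then x else n.*2.+1 - x.

Lemma low_inner x : low x || (0 < x) && (x != n).
Proof.
have [//|nl] := boolP (low x); case: (x =P 0) nl => [->|x0]; first by rewrite low0.
by case: (x =P n) => [->|_ _]; rewrite ?lown //=; lia.
Qed.

Lemma key_sort a b : a < b -> b <= n ->
  minn (key a) (key b) = (if low a then key a else key b) /\
  maxn (key a) (key b) = (if low a then key b else key a).
Proof.
move=> ab bn; have := low_inner a; have := low_inner b; rewrite /key.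
by case: (low a); case: (low b) => /=; lia.
Qed.

Lemma elig_lo a b c d : a < b -> b <= n -> c < d -> d <= n ->
  maxn a c <= minn b d -> elig a b c d (maxn a c) =
  if a == c then false else if a < c then ~~ low c else low a.
Proof.
move=> ab bn cd dn; rewrite /elig; case: (ltngtP a c) => ac m.
- by case: (low c); lia.
- by case: (low a); lia.
- by case: ac => <-; case: (low a); lia.
Qed.

Lemma elig_hi a b c d : a < b -> b <= n -> c < d -> d <= n ->
  maxn a c <= minn b d -> elig a b c d (minn b d) =
  if b == d then false else if b < d then ~~ low b else low d.
Proof.
move=> ab bn cd dn; rewrite /elig; case: (ltngtP b d) => bd m.
- by case: (low b); lia.
- by case: (low d); lia.
- by case: bd => <-; case: (low b); lia.
Qed.

Lemma hom_condE a b c d : a < b -> b <= n -> c < d -> d <= n ->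
  hom_cond a b c d = [&& maxn a c < minn b d,
    if a == c then true else if a < c then low c else ~~ low a &
    if b == d then true else if b < d then low b else ~~ low d].
Proof.
move=> ab bn cd dn; rewrite /hom_cond; have [/ltnW m|//] := boolP (maxn a c < minn b d).
rewrite elig_lo // elig_hi //.
by case: eqP => _; case: eqP => _ //=; case: ifP => _; rewrite ?negbK //; case: ifP => _; rewrite ?negbK.
Qed.

Lemma ext_condE a b c d : a < b -> b <= n -> c < d -> d <= n ->
  ext_cond a b c d = [&& maxn a c <= minn b d,
    if a == c then false else if a < c then ~~ low c else low a &
    if b == d then false else if b < d then ~~ low b else low d].
Proof.
move=> ab bn cd dn; rewrite /ext_cond; have [m|//] := boolP (maxn a c <= minn b d).
by rewrite elig_lo // elig_hi.
Qed.

(** By inspection of the relative position of the four ends and of the direction of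
the arrows there. *)
Lemma HE_key a b c d : a < b -> b <= n -> c < d -> d <= n ->
  hom_cond a b c d || ext_cond a b c d = pts_related (key a) (key b) (key c) (key d).
Proof.
move=> ab bn cd dn; rewrite /pts_related.
have [-> ->] := key_sort ab bn; have [-> ->] := key_sort cd dn.
have := low_inner a; have := low_inner b; have := low_inner c; have := low_inner d.
rewrite hom_condE // ext_condE // /key.
case: (ltngtP a c) => ac; case: (ltngtP b d) => bd; case: (ltngtP b c) => bc; case: (ltngtP a d) => ad;
  try (exfalso; clear -ab cd ac bd bc ad; lia).
all: subst; rewrite ?ltnn ?leqnn ?bd ?ac ?bc ?ad.
all: try (move: (low a) => la); try (move: (low b) => lb); try (move: (low c) => lc); try (move: (low d) => ld).
all: repeat match goal with x : bool |- _ => case: x => /= end.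
all: rewrite /nat_related.
all: lia.
Qed.

Definition ends (x a b : nat) : bool := (x == a) || (x == b).

(** In an exceptional collection, three pairwise related intervals have chords with
a common endpoint x. In this and the next three lemmas that is what makes the
composite of two basis elements a basis element: each overlap is seen by the
composite, and as soon as an Ext is involved it is a single place. *)
Lemma prod_hom_hom x a b c d e f : a < b -> b <= n -> c < d -> d <= n -> e < f -> f <= n ->
  ends x a b -> ends x c d -> ends x e f -> hom_cond a b c d -> hom_cond c d e f ->
  hom_cond a b e f /\ c <= maxn a e < d.
Proof.
move=> ab bn cd dn ef fn; rewrite /ends !hom_condE //.
case/orP=> /eqP ? /orP[] /eqP ? /orP[] /eqP ?; subst; rewrite ?eqxx /=; try by lia.
all: try (case: (ltngtP b d) => ?; case: (ltngtP d f) => ?; case: (ltngtP b f) => ?; subst; rewrite ?eqxx /=; try (exfalso; lia)).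
all: try (case: (ltngtP a c) => ?; case: (ltngtP c e) => ?; case: (ltngtP a e) => ?; subst; rewrite ?eqxx /=; try (exfalso; lia)).
all: try (move: (low a) => la); try (move: (low b) => lb); try (move: (low c) => lc); try (move: (low d) => ld); try (move: (low e) => le); try (move: (low f) => lf).
all: try lia.
Qed.
Lemma prod_hom_ext x a b c d e f : a < b -> b <= n -> c < d -> d <= n -> e < f -> f <= n ->
  ends x a b -> ends x c d -> ends x e f -> hom_cond a b c d -> ext_cond c d e f ->
  ext_cond a b e f /\ maxn c e = maxn a e /\ minn d f = maxn a e /\ minn b f = maxn a e.
Proof.
move=> ab bn cd dn ef fn; rewrite /ends ?hom_condE // ?ext_condE //.
case/orP=> /eqP ? /orP[] /eqP ? /orP[] /eqP ?; subst; rewrite ?eqxx /=; try by lia.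
all: repeat (match goal with |- context [if ?x == ?y then _ else _] => case: (ltngtP x y) => ? end; subst; rewrite ?eqxx /=).
all: repeat match goal with |- context [low ?x] => move: (low x) => ? end.
all: lia.
Qed.

Lemma prod_ext_hom x a b c d e f : a < b -> b <= n -> c < d -> d <= n -> e < f -> f <= n ->
  ends x a b -> ends x c d -> ends x e f -> ext_cond a b c d -> hom_cond c d e f ->
  ext_cond a b e f /\ maxn a c = maxn a e /\ minn b d = maxn a e /\ minn b f = maxn a e.
Proof.
move=> ab bn cd dn ef fn; rewrite /ends ?hom_condE // ?ext_condE //.
case/orP=> /eqP ? /orP[] /eqP ? /orP[] /eqP ?; subst; rewrite ?eqxx /=; try by lia.
all: repeat (match goal with |- context [if ?x == ?y then _ else _] => case: (ltngtP x y) => ? end; subst; rewrite ?eqxx /=).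
all: repeat match goal with |- context [low ?x] => move: (low x) => ? end.
all: lia.
Qed.

Lemma prod_ext_ext x a b c d e f : a < b -> b <= n -> c < d -> d <= n -> e < f -> f <= n ->
  ends x a b -> ends x c d -> ends x e f -> ext_cond a b c d -> ext_cond c d e f -> False.
Proof.
move=> ab bn cd dn ef fn; rewrite /ends ?hom_condE // ?ext_condE //.
case/orP=> /eqP ? /orP[] /eqP ? /orP[] /eqP ?; subst; rewrite ?eqxx /=; try by lia.
all: repeat (match goal with |- context [if ?x == ?y then _ else _] => case: (ltngtP x y) => ? end; subst; rewrite ?eqxx /=).
all: repeat match goal with |- context [low ?x] => move: (low x) => ? end.
all: lia.
Qed.
End Line.

(** * Modules over a path algebra *)

Local Open Scope ring_scope.

Section PathAlgebraBasics.
Variables (K : fieldType) (Q : quiver).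
Local Notation L := (path_algebra K Q).

Definition ev (v : Q) : L := walk_elt v [::].
Definition arr (a : arrow Q) : L := walk_elt (src a) [:: a].

Lemma walk_mul v s w t : walk v s -> walk w t ->
  walk_elt w t * walk_elt v s = (if walk_end v s == w then walk_elt v (s ++ t) else 0) :> L.
Proof.
move=> ws wt; rewrite (walk_eltE _ ws) (walk_eltE _ wt).
exact: pa_mulUU.
Qed.

Lemma ev_mul v w : ev v * ev w = if v == w then ev v else 0 :> L.
Proof. by rewrite /ev walk_mul // /walk_end /= eq_sym; case: eqP => // ->. Qed.

Lemma sum_ev : \sum_v ev v = 1 :> L. Proof. by []. Qed.

Lemma arr_ev a v : arr a * ev v = if v == src a then arr a else 0 :> L.
Proof. by rewrite /arr /ev walk_mul //= ?eqxx // /walk_end /=; case: eqP => // ->. Qed.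

Lemma ev_arr a v : ev v * arr a = if v == tgt a then arr a else 0 :> L.
Proof. by rewrite /arr /ev walk_mul //= ?eqxx // /walk_end /= eq_sym. Qed.

Lemma walk_elt_cons a s : walk (tgt a) s ->
  walk_elt (src a) (a :: s) = walk_elt (tgt a) s * arr a :> L.
Proof. by move=> w; rewrite /arr walk_mul //= /walk_end /= eqxx. Qed.

Lemma walk_elt_ind (P : L -> Prop) :
  (forall v, P (ev v)) ->
  (forall a s, walk (tgt a) s -> P (walk_elt (tgt a) s) -> P (walk_elt (tgt a) s * arr a)) ->
  forall v s, walk v s -> P (walk_elt v s).
Proof.
move=> Pv Pa v s; elim: s v => [|a s IH] v /=; first by move=> _; apply: Pv.
by case/andP => /eqP <- w; rewrite walk_elt_cons //; apply: Pa => //; apply: IH.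
Qed.

Lemma pa_ind (P : L -> Prop) :
  (forall c x y, P x -> P y -> P (c *: x + y)) -> P 0 ->
  (forall v s, walk v s -> P (walk_elt v s)) -> forall z, P z.
Proof.
move=> Pl P0 Pw z; rewrite -(lin_ext_id z) /lin_ext.
elim/big_rec: _ => // p x _ Px; apply: Pl => //.
by rewrite -walk_elt_qpath; apply: Pw; apply: qpathP.
Qed.
End PathAlgebraBasics.
Arguments ev {K Q} v.
Arguments arr {K Q} a.

(** The action of scalars of K, locked so that conversion does not unfold the
multiplication of the path algebra. *)
HB.lock Definition kscale (K : fieldType) (Q : quiver) (M : lmodType (path_algebra K Q)) (s : K) (x : M) : M :=
  (s%:A : path_algebra K Q) *: x.
Arguments kscale {K Q M} s x.
Notation "s *k x" := (kscale s x) (at level 40).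

Section ScalarRestriction.
Variables (K : fieldType) (Q : quiver).
Local Notation L := (path_algebra K Q).
Variable M : lmodType L.

Lemma kscE (s : K) (x : M) : s *k x = (s%:A : L) *: x. Proof. by rewrite kscale.unlock. Qed.
Lemma kscZ (s : K) (z : L) (x : M) : (s *: z) *: x = s *k (z *: x).
Proof.
apply: esym; apply: etrans (kscE _ _) _.
exact: (etrans (scalerA (s%:A) z x) (congr1 (fun u => u *: x) (mulr_algl s z))).
Qed.
Lemma kscC (s : K) (z : L) (x : M) : s *k (z *: x) = z *: (s *k x).
Proof.
rewrite -kscZ (kscE s x); apply: esym.
exact: (etrans (scalerA z (s%:A) x) (congr1 (fun u => u *: x) (mulr_algr s z))).
Qed.
Lemma kscA (s t : K) (x : M) : s *k (t *k x) = (s * t) *k x.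
Proof.
rewrite (kscE t x) -kscZ (kscE (s * t) x).
exact: (congr1 (fun u : L => u *: x) (scalerA s t (1 : L))).
Qed.
Lemma ksc1 (x : M) : 1 *k x = x.
Proof. by rewrite kscE (scale1r (1 : L)) (scale1r x). Qed.
Lemma ksc0 (x : M) : 0 *k x = 0.
Proof. by rewrite kscE (scale0r (1 : L)) (scale0r x). Qed.
Lemma ksc0r (s : K) : s *k (0 : M) = 0. Proof. by rewrite kscE (scaler0 _ (s%:A : L)). Qed.
Lemma kscDl (s t : K) (x : M) : (s + t) *k x = s *k x + t *k x.
Proof. by rewrite !kscE (scalerDl (1 : L) s t) (scalerDl x (s%:A : L) (t%:A : L)). Qed.
Lemma kscDr (s : K) (x y : M) : s *k (x + y) = s *k x + s *k y.
Proof. by rewrite !kscE (scalerDr (s%:A : L) x y). Qed.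
Lemma kscNl (s : K) (x : M) : (- s) *k x = - (s *k x).
Proof. by apply/eqP; rewrite -addr_eq0 -kscDl addNr ksc0. Qed.
Lemma ksc_sumr (I : Type) (r : seq I) (P : pred I) (F : I -> M) (s : K) :
  s *k (\sum_(i <- r | P i) F i) = \sum_(i <- r | P i) s *k F i.
Proof. by elim/big_rec2: _ => [|i y z _ <-]; rewrite ?ksc0r // kscDr. Qed.

Lemma kscNr (s : K) (x : M) : s *k (- x) = - (s *k x).
Proof. by apply/eqP; rewrite -addr_eq0 -kscDr addNr ksc0r. Qed.
Lemma kscBr (s : K) (x y : M) : s *k (x - y) = s *k x - s *k y.
Proof. by rewrite kscDr kscNr. Qed.
Lemma scalerP (z : L) (s : K) (x y : M) : z *: (s *k x + y) = s *k (z *: x) + z *: y.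
Proof. by rewrite scalerDr -kscC. Qed.

(** M as a vector space over K. *)
Definition kmod : Type := M.
HB.instance Definition _ := GRing.Zmodule.on kmod.
Fact kmod_D (x : M) : {morph (fun s : K => s *k x) : s t / s + t}.
Proof. move=> s t; exact: kscDl. Qed.
HB.instance Definition _ := GRing.Zmodule_isLmodule.Build K kmod
  kscA ksc1 kscDr kmod_D.
End ScalarRestriction.

(** A representation of Q with the spaces at all vertices put into one: [rep_v v] is
the projection to the space at v. *)
Record qrep (K : fieldType) (Q : quiver) := QRep {
  rep_space :> lmodType K;
  rep_v : Q -> rep_space -> rep_space;
  rep_a : arrow Q -> rep_space -> rep_space;
  rep_v_lin : forall v, linear (rep_v v);
  rep_a_lin : forall a, linear (rep_a a);
  rep_vv : forall v w x, rep_v v (rep_v w x) = if v == w then rep_v v x else 0;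
  rep_sum : forall x, \sum_v rep_v v x = x;
  rep_av : forall a x, rep_a a (rep_v (src a) x) = rep_a a x;
  rep_va : forall a x, rep_v (tgt a) (rep_a a x) = rep_a a x }.

Lemma linear_at0 (R : pzRingType) (U V : lmodType R) (f : U -> V) : linear f -> f 0 = 0.
Proof. by move=> lf; have := lf (-1) 0 0; rewrite scaler0 addr0 scaleN1r addNr. Qed.

Section RepModule.
Variables (K : fieldType) (Q : quiver) (r : qrep K Q).
Local Notation L := (path_algebra K Q).

(** The action of a path; it extends linearly to an action of the path algebra. *)
Definition pact (p : qpath Q) (x : r) : r :=
  foldl (fun y a => rep_a a y) (rep_v (qstart p) x) (qarrows p).

Lemma rep_a0 a : rep_a a 0 = 0 :> r.
Proof. exact/linear_at0/rep_a_lin. Qed.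

Lemma pact_lin p : linear (pact p).
Proof.
rewrite /pact => c x y; rewrite rep_v_lin.
elim: (qarrows p) (rep_v _ x) (rep_v _ y) => //= a s IH u v.
by rewrite rep_a_lin IH.
Qed.

Definition rscale (z : L) (x : r) : r := lin_ext (fun p => pact p x) z.

Lemma rscale_linl x : linear (fun z => rscale z x).
Proof. by move=> c y z; rewrite /rscale linearP. Qed.

Lemma rscale_linr z : linear (rscale z).
Proof.
move=> c x y; rewrite /rscale /lin_ext scaler_sumr -big_split /=.
by apply: eq_bigr => p _; rewrite pact_lin scalerDr !scalerA mulrC.
Qed.

Lemma rscale_walk v s x : walk v s ->
  rscale (walk_elt v s) x = foldl (fun y a => rep_a a y) (rep_v v x) s.
Proof. by move=> w; rewrite (walk_eltE _ w) /rscale lin_extU. Qed.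

Lemma rep_end p x : rep_v (qend p) (pact p x) = pact p x.
Proof.
rewrite /pact /qend /walk_end; case: p => [[v s] /= w]; rewrite /qstart /qarrows /=.
case/lastP: s w => [|s a] w /=; first by rewrite rep_vv eqxx.
by rewrite map_rcons last_rcons foldl_rcons rep_va.
Qed.

Lemma pact0 p : pact p 0 = 0.
Proof. exact/linear_at0/pact_lin. Qed.

Lemma rscaleA (y z : L) (x : r) : rscale y (rscale z x) = rscale (y * z) x.
Proof.
have ly (w : L) u : rscale (w * z) u = rscale (pa_mul w z) u by [].
elim/pa_ind: y => [c y1 y2 h1 h2||v s w].
- by rewrite rscale_linl h1 h2 mulrDl -scalerAl rscale_linl.
- by rewrite mul0r /rscale !linear0.
elim/pa_ind: z {ly} => [c z1 z2 h1 h2||u t wt].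
- by rewrite rscale_linl rscale_linr h1 h2 mulrDr -scalerAr rscale_linl.
- by rewrite mulr0 /rscale linear0 /lin_ext big1 // => p _; rewrite pact0 scaler0.
rewrite walk_mul //.
pose p := QPath (qpath_val := (u, t)) wt.
rewrite [rscale (walk_elt u t) x](_ : _ = pact p x); last by rewrite rscale_walk.
have ep : qend p = walk_end u t by [].
rewrite -rep_end rscale_walk // rep_vv ep.
have [e|ne] := eqVneq v (walk_end u t).
  subst v; have w' : walk u (t ++ s) by rewrite walk_cat wt.
  by rewrite ?eqxx /= rscale_walk // foldl_cat -ep rep_end.
rewrite /= /rscale linear0.
by elim: (s) => //= a s' IH; rewrite rep_a0.
Qed.

Lemma rscale1 x : rscale 1 x = x.
Proof.
rewrite -[RHS]rep_sum -(sum_ev K Q) /rscale linear_sum; apply: eq_bigr => v _ /=.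
exact: (rscale_walk x (isT : walk v [::])).
Qed.

Definition rep_mod : Type := r.
HB.instance Definition _ := GRing.Zmodule.on rep_mod.

Lemma rscaleDr z : {morph rscale z : x y / x + y}.
Proof. by move=> x y; have := rscale_linr z 1 x y; rewrite !scale1r. Qed.
Lemma rscaleDl x : {morph (rscale^~ x) : y z / y + z}.
Proof. by move=> y z; have := rscale_linl x 1 y z; rewrite !scale1r. Qed.

HB.instance Definition _ := GRing.Zmodule_isLmodule.Build L rep_mod
  rscaleA rscale1 rscaleDr rscaleDl.

Lemma rep_mod_ev v (x : rep_mod) : ev v *: x = rep_v v x.
Proof. exact: (rscale_walk x (isT : walk v [::])). Qed.

Lemma rep_mod_arr a (x : rep_mod) : arr a *: x = rep_a a x.
Proof.
have w : walk (src a) [:: a] by rewrite /= eqxx.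
by rewrite -[LHS]/(rscale _ _) rscale_walk //= rep_av.
Qed.

Lemma rep_mod_ksc (s : K) (x : rep_mod) : s *k x = s *: (x : r).
Proof.
have := rscale_linl x s 1 0; rewrite addr0 rscale1 [rscale 0 x]linear0 addr0 => <-.
by rewrite kscE.
Qed.
End RepModule.

(** * Thin modules *)

Section KLinear.
Variables (K : fieldType) (Q : quiver).
Local Notation L := (path_algebra K Q).
Implicit Types M N : lmodType L.

Section Klin.
Variables (M N : lmodType L) (h : M -> N).
Hypothesis kh : klinear h.
Lemma klinP s x y : h (s *k x + y) = s *k h x + h y.
Proof. rewrite (kscE s x) (kscE s (h x)); exact: kh. Qed.
Lemma klinD x y : h (x + y) = h x + h y.
Proof. by have := klinP 1 x y; rewrite !ksc1. Qed.
Lemma klin0 : h 0 = 0.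
Proof. by apply: (addrI (h 0)); rewrite -klinD !addr0. Qed.
Lemma klinZ s x : h (s *k x) = s *k h x.
Proof. by have := klinP s x 0; rewrite !addr0 klin0 addr0. Qed.
Lemma klin_sum I (r : seq I) (P : pred I) (F : I -> M) :
  h (\sum_(i <- r | P i) F i) = \sum_(i <- r | P i) h (F i).
Proof. by elim/big_rec2: _ => [|i y s _ <-]; rewrite ?klin0 // klinD. Qed.
End Klin.

Lemma linear_klin M N (f : M -> N) : linear f -> klinear f.
Proof. by move=> lf s x y; apply: lf. Qed.

Lemma linear_addZ M N (f : M -> N) : linear f -> forall z x, f (z *: x) = z *: f x.
Proof. by move=> lf z x; have := lf z x 0; rewrite !addr0 (linear_at0 lf) addr0. Qed.

(** The path algebra is generated by the vertices and the arrows. *)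
Lemma linear_crit M N (f : M -> N) : klinear f ->
  (forall v x, f (ev v *: x) = ev v *: f x) ->
  (forall a x, f (arr a *: x) = arr a *: f x) -> linear f.
Proof.
move=> kf fv fa; suff H (z : L) : forall x, f (z *: x) = z *: f x.
  by move=> z x y; rewrite (klinD kf) H.
elim/pa_ind: z => [c y z hy hz x||v s w x].
- by rewrite !scalerDl !kscZ (klinD kf) (klinZ kf) hy hz.
- by move=> x; rewrite !scale0r (klin0 kf).
elim/walk_elt_ind: w x => [u x|a t wt IH x]; first exact: fv.
by rewrite -!(scalerA (walk_elt _ _)) IH fa.
Qed.
End KLinear.

Section IntervalBasis.
Variables (K : fieldType) (Q : quiver).
Local Notation L := (path_algebra K Q).

(** M has a basis vector b v for each v in I, with the dual basis be, and all the arrows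
inside I act as 1. The families b and be are extended by zero outside I. *)
Record thin (M : lmodType L) (I : pred Q) (b : Q -> M) (be : Q -> M -> K) : Prop := Thin {
  thin_lin : forall v s x y, be v (s *k x + y) = s * be v x + be v y;
  thin_dual : forall v w, be v (b w) = ((v == w) && I v)%:R;
  thin_exp : forall x, x = \sum_v be v x *k b v;
  thin_v : forall u v, ev u *: b v = if u == v then b v else 0;
  thin_a : forall a v, arr a *: b v = if (src a == v) && I v then b (tgt a) else 0 }.

Section ThinTheory.
Variables (M : lmodType L) (I : pred Q) (b : Q -> M) (be : Q -> M -> K).
Hypothesis tM : thin I b be.

Lemma be0 v : be v 0 = 0.
Proof.
have := thin_lin tM v (-1) 0 0; rewrite ksc0r addr0 mulN1r addNr; exact.
Qed.
Lemma beD v x y : be v (x + y) = be v x + be v y.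
Proof. by have := thin_lin tM v 1 x y; rewrite ksc1 mul1r. Qed.
Lemma beZ v s x : be v (s *k x) = s * be v x.
Proof. by have := thin_lin tM v s x 0; rewrite !addr0 be0 addr0. Qed.
Lemma beN v x : be v (- x) = - be v x.
Proof. by apply/eqP; rewrite -addr_eq0 -beD addNr be0. Qed.
Lemma be_sum v J (r : seq J) (P : pred J) (F : J -> M) :
  be v (\sum_(i <- r | P i) F i) = \sum_(i <- r | P i) be v (F i).
Proof. by elim/big_rec2: _ => [|i y s _ <-]; rewrite ?be0 // beD. Qed.

Lemma b_out v : ~~ I v -> b v = 0.
Proof.
move=> nI; rewrite (thin_exp tM (b v)) big1 // => u _.
by rewrite (thin_dual tM); case: eqP => [->|_] /=; rewrite ?(negPf nI) ksc0.
Qed.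

Lemma be_out v x : ~~ I v -> be v x = 0.
Proof.
move=> nI; rewrite (thin_exp tM x) be_sum big1 // => u _.
by rewrite beZ (thin_dual tM) (negPf nI) andbF mulr0.
Qed.

Lemma thin_ext x y : (forall v, I v -> be v x = be v y) -> x = y.
Proof.
move=> h; rewrite (thin_exp tM x) (thin_exp tM y); apply: eq_bigr => v _.
by have [/h-> //|nI] := boolP (I v); rewrite b_out // !ksc0r.
Qed.

Lemma be_ev u v x : be u (ev v *: x) = if u == v then be u x else 0.
Proof.
rewrite {1}(thin_exp tM x) scaler_sumr be_sum (bigD1 v) //= big1 => [|w nw].
  rewrite -kscC beZ (thin_v tM) eqxx (thin_dual tM) addr0.
  case: eqP => [->|_] /=; last by rewrite mulr0.
  by have [_|nI] := boolP (I v); rewrite ?mulr1 // (be_out _ nI) mul0r.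
by rewrite -kscC beZ (thin_v tM) eq_sym (negPf nw) be0 mulr0.
Qed.

Lemma be_arr a v x : be v (arr a *: x) =
  if [&& v == tgt a, I v & I (src a)] then be (src a) x else 0.
Proof.
rewrite {1}(thin_exp tM x) scaler_sumr be_sum (bigD1 (src a)) //= big1 => [|w nw]; last first.
  by rewrite -kscC beZ (thin_a tM) eq_sym (negPf nw) be0 mulr0.
rewrite -kscC beZ (thin_a tM) eqxx /= addr0.
have [Is|nI] := boolP (I (src a)); last by rewrite !andbF be0 mulr0.
by rewrite (thin_dual tM) andbT; case: ifP; rewrite ?mulr1 ?mulr0.
Qed.

Lemma ev_exp v x : ev v *: x = be v x *k b v.
Proof.
apply: thin_ext => u Iu; rewrite be_ev beZ (thin_dual tM) Iu andbT.
by case: eqP => [->|_]; rewrite ?mulr1 ?mulr0.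
Qed.

End ThinTheory.

Section ThinRep.
Variable I : pred Q.
Definition thin_rep_v (v : Q) (x : {ffun {v : Q | I v} -> K^o}) : {ffun {v : Q | I v} -> K^o} :=
  [ffun u => if val u == v then x u else 0].
Definition thin_rep_a (a : arrow Q) (x : {ffun {v : Q | I v} -> K^o}) : {ffun {v : Q | I v} -> K^o} :=
  [ffun u => if val u == tgt a then \sum_(w | val w == src a) x w else 0].

Lemma thin_rep_v_lin v : linear (thin_rep_v v).
Proof. by move=> c x y; apply/ffunP => u; rewrite !ffunE; case: ifP => _; rewrite ?scaler0 ?addr0 // !ffunE. Qed.
Lemma thin_rep_a_lin a : linear (thin_rep_a a).
Proof.
move=> c x y; apply/ffunP => u; rewrite !ffunE; case: ifP => _; last by rewrite scaler0 addr0.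
by rewrite scaler_sumr -big_split; apply: eq_bigr => w _; rewrite !ffunE.
Qed.

Program Definition thin_rep : qrep K Q :=
  @QRep K Q {ffun {v : Q | I v} -> K^o} thin_rep_v thin_rep_a thin_rep_v_lin thin_rep_a_lin _ _ _ _.
Next Obligation.
apply/ffunP => u; rewrite !ffunE; have [e|ne] := eqVneq (val u) v.
  by rewrite e; case: eqP => // ev; rewrite !ffunE // e eqxx.
by case: eqP => _; rewrite ffunE // (negPf ne).
Qed.
Next Obligation.
apply/ffunP => u; rewrite sum_ffunE (bigD1 (val u)) //= ffunE eqxx big1 ?addr0 // => v nv.
by rewrite ffunE eq_sym (negPf nv).
Qed.
Next Obligation.
apply/ffunP => u; rewrite !ffunE; case: ifP => // _; apply: eq_bigr => w e.
by rewrite ffunE e.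
Qed.
Next Obligation.
by apply/ffunP => u; rewrite !ffunE; case: (val u =P tgt a).
Qed.

Definition thin_mod : lmodType L := rep_mod thin_rep.
Definition thin_b (v : Q) : thin_mod := ([ffun u => (val u == v)%:R] : {ffun {v : Q | I v} -> K^o}).
Definition thin_be (v : Q) (x : thin_mod) : K := \sum_(u | val u == v) (x : {ffun {v : Q | I v} -> K^o}) u.

Lemma thin_sum v (F : {v : Q | I v} -> K) : \sum_(u | val u == v) F u =
  if insub v is Some u then F u else 0.
Proof.
case: insubP => [u Iv e|nI].
  by rewrite (bigD1 u) ?e //= big1 ?addr0 // => w; rewrite -{1}e; case/andP=> /eqP/val_inj->; rewrite eqxx.
by rewrite big1 // => u /eqP e; have := valP u; rewrite e (negPf nI).
Qed.

Lemma thin_mod_thin : thin I thin_b thin_be.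
Proof.
split.
- move=> v s x y; rewrite /thin_be rep_mod_ksc mulr_sumr -big_split /=.
  by apply: eq_bigr => u _; rewrite !ffunE.
- move=> v w; rewrite /thin_be thin_sum; case: insubP => [u Iv e|nI].
    by rewrite ffunE e Iv andbT.
  by rewrite (negPf nI) andbF.
- move=> x; apply/ffunP => u; rewrite sum_ffunE (bigD1 (val u)) //= big1 => [|w nw]; last first.
    by rewrite rep_mod_ksc !ffunE eq_sym (negPf nw) [LHS]mulr0.
  by rewrite rep_mod_ksc !ffunE eqxx /thin_be thin_sum valK addr0 [RHS]mulr1.
- move=> u v; rewrite rep_mod_ev; apply/ffunP => w; rewrite ffunE.
  have [->|ne] := eqVneq u v; rewrite !ffunE; first by case: (val w =P v).
  by case: (val w =P u) => // ->; rewrite (negPf ne).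
- move=> a v; rewrite rep_mod_arr; apply/ffunP => w; rewrite ffunE thin_sum.
  have z0 : (0 : thin_mod) = [ffun=> 0] :> {ffun {v : Q | I v} -> K^o} by [].
  case: insubP => [u Is e|nI]; last first.
    case: (src a =P v) => [<-|_] /=; rewrite ?(negPf nI) /= z0 !ffunE; by case: ifP.
  rewrite [thin_b v u]ffunE e; case: (src a =P v) => [sv|_] /=; last by rewrite z0 ffunE; case: ifP.
  by rewrite -sv Is ffunE; case: ifP.
Qed.
End ThinRep.

Lemma thin_fg (M : lmodType L) I b be : @thin M I b be ->
  exists (d : nat) (g : 'I_d -> M), forall m : M, exists c : 'I_d -> L, m = \sum_i c i *: g i.
Proof.
move=> tM; exists #|Q|, (fun i => b (enum_val i)) => m.
exists (fun i => (be (enum_val i) m)%:A); rewrite {1}(thin_exp tM m).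
rewrite (eq_bigl (mem Q)) // big_enum_val; apply: eq_bigr => i _; exact: kscE.
Qed.
End IntervalBasis.

(** * Coordinates of homomorphisms and cocycles between thin modules *)

Section HomExt.
Variables (K : fieldType) (Q : quiver).
Local Notation L := (path_algebra K Q).

Section Cocycles.
Variables (M N : lmodType L).

Definition cob (h : M -> N) : L -> M -> N := fun a x => a *: h x - h (a *: x).

Section Co.
Variable c : L -> M -> N.
Hypothesis coc : cocycle c.
Lemma coc_klin a : klinear (c a). Proof. by case: coc. Qed.
Lemma cocDl a a' x : c (a + a') x = c a x + c a' x.
Proof. by case: coc => _ h _; rewrite -[a]scale1r h -kscE ksc1 scale1r. Qed.
Lemma coc0l x : c 0 x = 0.
Proof. by apply: (addrI (c 0 x)); rewrite -cocDl !addr0. Qed.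
Lemma cocZl s a x : c (s *: a) x = s *k c a x.
Proof. by case: coc => _ h _; have := h s a 0 x; rewrite !addr0 coc0l addr0 -kscE. Qed.
Lemma cocM a b x : c (a * b) x = a *: c b x + c a (b *: x).
Proof. by case: coc. Qed.

(** A cocycle is a derivation, so it is determined by its values on vertices and
arrows. *)
Lemma cocycle_zero : (forall v x, c (ev v) x = 0) -> (forall a x, c (arr a) x = 0) ->
  forall z x, c z x = 0.
Proof.
move=> hv ha; elim/pa_ind => [s y z hy hz x||v s w]; last first.
- elim/walk_elt_ind: w => // a t wt IH x.
  by rewrite cocM ha IH scaler0 addr0.
- exact: coc0l.
- by rewrite cocDl cocZl hy hz ksc0r addr0.
Qed.
End Co.

Lemma cob_cocycle h : klinear h -> cocycle (cob h).
Proof.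
have add4 (V : zmodType) (x y z t : V) : x + y - (z + t) = (x - z) + (y - t).
  by rewrite opprD addrACA.
move=> kh; split=> [a s x y|s a b x|a b x].
- rewrite /cob -(kscE s x) -(kscE s (_ - _)) (klinP kh) !scalerP (klinP kh) kscBr.
  exact: add4.
- rewrite /cob -(kscE s (_ - _)) !scalerDl !kscZ (klinP kh) kscBr; exact: add4.
- rewrite /cob -!scalerA scalerBr addrA subrK; congr (_ - _).
Qed.

Lemma coc_sub (c d : L -> M -> N) : cocycle c -> cocycle d -> cocycle (fun a x => c a x - d a x).
Proof.
have add4 (V : zmodType) (x y z t : V) : x + y - (z + t) = (x - z) + (y - t).
  by rewrite opprD addrACA.
move=> cc cd; split=> [a s x y|s a b x|a b x].
- rewrite -(kscE s x) -(kscE s (_ - _)) (klinP (coc_klin cc a)) (klinP (coc_klin cd a)) kscBr.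
  exact: add4.
- rewrite -(kscE s (_ - _)) (cocDl cc) (cocDl cd) (cocZl cc) (cocZl cd) kscBr; exact: add4.
- rewrite (cocM cc) (cocM cd) scalerBr; exact: add4.
Qed.
End Cocycles.

Section ThinPair.
Variables (M N : lmodType L) (I J : pred Q).
Variables (b : Q -> M) (be : Q -> M -> K) (b' : Q -> N) (be' : Q -> N -> K).
Hypotheses (tM : thin I b be) (tN : thin J b' be').

Definition supp2 (h : Q -> K) : Prop := forall v, ~~ (I v && J v) -> h v = 0.
Definition closed0 (h : Q -> K) : Prop :=
  forall a : arrow Q, I (src a) -> J (tgt a) -> h (src a) = h (tgt a).

(** A linear map between thin modules has one matrix entry for every common vertex,
and a cocycle one entry for every arrow that leads from I into J; they form the
complex that computes Hom and Ext. *)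
Definition hc (f : M -> N) (v : Q) : K := be' v (f (b v)).
Definition cc (c : L -> M -> N) (a : arrow Q) : K := be' (tgt a) (c (arr a) (b (src a))).

Lemma hc_supp f : f 0 = 0 -> supp2 (hc f).
Proof.
move=> f0 v; rewrite negb_and /hc => /orP[nI|nJ]; last exact: (be_out tN).
by rewrite (b_out tM nI) f0 (be0 tN).
Qed.

Lemma hc_exp f : linear f -> forall x, f x = \sum_v (be v x * hc f v) *k b' v.
Proof.
move=> lf x; have kf := linear_klin lf.
rewrite {1}(thin_exp tM x) (klin_sum kf); apply: eq_bigr => v _.
rewrite (klinZ kf) -kscA; congr (_ *k _).
have {1}-> : b v = ev v *: b v by rewrite (thin_v tM) eqxx.
by rewrite (linear_addZ lf) (ev_exp tN).
Qed.

Lemma hc_closed f : linear f -> closed0 (hc f).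
Proof.
move=> lf a Is Jt; have := congr1 (be' (tgt a)) (linear_addZ lf (arr a) (b (src a))).
rewrite (thin_a tM) eqxx Is /= -/(hc f (tgt a)) => ->.
rewrite (be_arr tN) eqxx Jt /=; have [//|nJ] := boolP (J (src a)).
by rewrite /hc (be_out tN).
Qed.

Definition hom_of (h : Q -> K) (x : M) : N := \sum_v (be v x * h v) *k b' v.

Lemma be_hom_of h v x : be' v (hom_of h x) = (J v)%:R * (be v x * h v).
Proof.
rewrite /hom_of (be_sum tN) (bigD1 v) //= big1 => [|w nw].
  by rewrite addr0 (beZ tN) (thin_dual tN) eqxx mulrC.
by rewrite (beZ tN) (thin_dual tN) eq_sym (negPf nw) mulr0.
Qed.

Lemma hom_of_klin h : klinear (hom_of h).
Proof.
move=> s x y; rewrite -(kscE s x) -(kscE s (hom_of h x)).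
apply: (thin_ext tN) => v Jv; rewrite (beD tN) (beZ tN) !be_hom_of (thin_lin tM).
by ring.
Qed.

Lemma hom_of_linear h : supp2 h -> closed0 h -> linear (hom_of h).
Proof.
move=> sh ch; apply: linear_crit; first exact: hom_of_klin.
- move=> v x; apply: (thin_ext tN) => w Jw; rewrite (be_ev tN) !be_hom_of (be_ev tM).
  by case: eqP; rewrite ?mul0r ?mulr0.
- move=> a x; apply: (thin_ext tN) => w Jw; rewrite (be_arr tN) !be_hom_of (be_arr tM) Jw mul1r.
  case: (w =P tgt a) Jw => [->|_ _] /=; last by rewrite mul0r.
  move=> Jt.
  have [Is|nI] := boolP (I (src a)); last first.
    by rewrite (be_out tM _ nI) andbF !mul0r mulr0 if_same.
  rewrite andbT; have cE := ch a Is Jt.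
  have -> : (if I (tgt a) then be (src a) x else 0) * h (tgt a) = be (src a) x * h (tgt a).
    by case: ifP => // nI; rewrite sh ?nI // !mulr0.
  rewrite -cE; case: ifP => Js; first by rewrite ?Js mul1r.
  by rewrite (sh (src a)) ?Js ?andbF // mulr0.
Qed.

Lemma hc_hom_of h v : supp2 h -> hc (hom_of h) v = h v.
Proof.
move=> sh; rewrite /hc be_hom_of (thin_dual tM) eqxx /=.
have [/andP[-> ->]|n] := boolP (I v && J v); first by rewrite !mul1r.
by rewrite (sh v n) !mulr0.
Qed.

Lemma cc_cob h a : klinear h -> I (src a) -> J (tgt a) ->
  cc (cob h) a = hc h (src a) - hc h (tgt a).
Proof.
move=> kh Is Jt; rewrite /cc /cob (beD tN) (beN tN) (be_arr tN) eqxx Jt /= (thin_a tM) eqxx Is /=.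
congr (_ - _); case: ifP => // nJ; by rewrite /hc (be_out tN) ?nJ.
Qed.

Lemma coboundary_cc c : coboundary c ->
  exists2 h, supp2 h & forall a, I (src a) -> J (tgt a) -> cc c a = h (src a) - h (tgt a).
Proof.
case=> h kh ch; exists (hc h); first by apply: hc_supp; apply: klin0 kh.
by move=> a Is Jt; rewrite -cc_cob // /cc ch.
Qed.

Lemma coc_ev (c : L -> M -> N) v x : cocycle c -> ev v *: c (ev v) (ev v *: x) = 0.
Proof.
move=> coc; have := cocM coc (ev v) (ev v) x; rewrite ev_mul eqxx => e.
have : ev v *: c (ev v) x = ev v *: (ev v *: c (ev v) x + c (ev v) (ev v *: x)) by rewrite -e.
rewrite scalerDr scalerA ev_mul eqxx => /eqP; rewrite -subr_eq0 opprD addrA subrr add0r oppr_eq0.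
by move/eqP.
Qed.

(** Subtracting the coboundary of this map makes a cocycle vanish on the idempotents
of the vertices. It is the usual averaging over a separable subalgebra, here the
one spanned by these idempotents. *)
Definition avg (c : L -> M -> N) (x : M) : N := \sum_v ev v *: c (ev v) x.

Lemma avg_klin c : cocycle c -> klinear (avg c).
Proof.
move=> coc s x y; rewrite -(kscE s x) -(kscE s (avg c x)) /avg ksc_sumr -big_split.
by apply: eq_bigr => v _; rewrite (klinP (coc_klin coc _)) scalerP.
Qed.

Lemma avg_ev c u x : cocycle c -> cob (avg c) (ev u) x = c (ev u) x.
Proof.
move=> coc; rewrite /cob /avg scaler_sumr -sumrB.
rewrite (eq_bigr (fun v => ev v *: c (ev u) x)) => [|v _]; last first.
  have := cocM coc (ev v) (ev u) x; rewrite ev_mul scalerA ev_mul.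
  have [-> e|ne] := eqVneq u v.
    have -> : c (ev v) (ev v *: x) = c (ev v) x - ev v *: c (ev v) x.
      by apply/eqP; rewrite eq_sym subr_eq addrC -e.
    by rewrite scalerBr scalerA ev_mul eqxx subrr subr0.
  rewrite (coc0l coc) scale0r sub0r => /esym/eqP; rewrite addr_eq0 => /eqP e.
  rewrite -scalerN; have -> : - c (ev v) (ev u *: x) = ev v *: c (ev u) x by rewrite e.
  by rewrite scalerA ev_mul eqxx.
by rewrite -scaler_suml sum_ev scale1r.
Qed.

Lemma cc_eq0 c : cocycle c -> (forall v x, c (ev v) x = 0) ->
  (forall a, I (src a) -> J (tgt a) -> cc c a = 0) -> forall z x, c z x = 0.
Proof.
move=> coc hv ha; apply: cocycle_zero => // a x.
have ae : arr a = arr a * ev (src a) :> L by rewrite arr_ev eqxx.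
have ea : arr a = ev (tgt a) * arr a :> L by rewrite ev_arr eqxx.
rewrite ae (cocM coc) hv scaler0 add0r (ev_exp tM) (klinZ (coc_klin coc _)).
have [Is|nI] := boolP (I (src a)); last by rewrite (be_out tM _ nI) ksc0.
rewrite ea (cocM coc) hv addr0 (ev_exp tN).
have [Jt|nJ] := boolP (J (tgt a)); last by rewrite (be_out tN _ nJ) ksc0 ksc0r.
by rewrite -/(cc c a) ha // ksc0 ksc0r.
Qed.

(** Once it vanishes on the vertices, a cocycle is determined by its entries at the
arrows, and the map with entries h has the same ones. *)
Lemma cc_coboundary c h : cocycle c -> supp2 h ->
  (forall a, I (src a) -> J (tgt a) -> cc c a = h (src a) - h (tgt a)) -> coboundary c.
Proof.
move=> coc sh hh; have kh := hom_of_klin h; have ka := avg_klin coc.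
pose c' := fun z x => c z x - cob (avg c) z x - cob (hom_of h) z x.
have coc' : cocycle c' by apply: coc_sub; [apply: coc_sub => //; apply: cob_cocycle|apply: cob_cocycle].
have c'0 z x : c' z x = 0.
  apply: cc_eq0 z x => // [v x|a Is Jt].
    rewrite /c' avg_ev // subrr sub0r; apply/eqP; rewrite oppr_eq0; apply/eqP.
    rewrite /cob; apply/eqP; rewrite subr_eq0; apply/eqP; apply: (thin_ext tN) => w Jw.
    by rewrite (be_ev tN) !be_hom_of (be_ev tM); case: eqP; rewrite ?mul0r ?mulr0.
  have e0 v : hc (avg c) v = 0.
    have bv : b v = ev v *: b v by rewrite (thin_v tM) eqxx.
    rewrite /hc /avg (be_sum tN) (bigD1 v) //= big1 => [|w nw]; last first.
      by rewrite (be_ev tN) eq_sym (negPf nw).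
    by rewrite bv coc_ev // (be0 tN) addr0.
  have ccB (d1 d2 : L -> M -> N) : cc (fun z x => d1 z x - d2 z x) a = cc d1 a - cc d2 a.
    by rewrite /cc (beD tN) (beN tN).
  rewrite /c' ccB (ccB c) (cc_cob kh Is Jt) (cc_cob ka Is Jt) !e0 !hc_hom_of // -hh //.
  by rewrite subrr subr0 subrr.
exists (fun x => avg c x + hom_of h x) => [s x y|z x].
  rewrite -(kscE s x) -(kscE s (_ + _)) (klinP kh) (klinP ka) kscDr -!addrA; congr (_ + _).
  by rewrite addrCA.
have := c'0 z x; rewrite /c' /cob => /eqP; rewrite -addrA -opprD subr_eq0 => /eqP ->.
by rewrite scalerDr opprD addrACA.
Qed.

Section Extension.
Variable ga : arrow Q -> K.
Let V : lmodType K := (kmod N * kmod M)%type.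
Let tw (a : arrow Q) (x : M) : N := (be (src a) x * ga a) *k b' (tgt a).

(** An extension of M by N with prescribed entries: the arrow a acts on the direct
sum of N and M with the additional term that sends the basis vector of M at the
source to [ga a] times the basis vector of N at the target. *)
Definition ext_v (v : Q) (x : V) : V := ((ev v *: (x.1 : N) : kmod N), (ev v *: (x.2 : M) : kmod M)).
Definition ext_a (a : arrow Q) (x : V) : V :=
  ((arr a *: (x.1 : N) + tw a x.2 : kmod N), (arr a *: (x.2 : M) : kmod M)).

Lemma ext_v_lin v : linear (ext_v v).
Proof.
move=> s [x1 x2] [y1 y2]; rewrite /ext_v /=; congr (_, _).
  exact: (scalerP (ev v) s (x1 : N) (y1 : N)).
exact: (scalerP (ev v) s (x2 : M) (y2 : M)).
Qed.

Lemma ext_a_lin a : linear (ext_a a).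
Proof.
move=> s [x1 x2] [y1 y2]; rewrite /ext_a /=; congr (_, _); last first.
  exact: (scalerP (arr a) s (x2 : M) (y2 : M)).
rewrite -[LHS]/(arr a *: (s *k (x1 : N) + y1) + tw a (s *k (x2 : M) + y2)).
rewrite -[RHS]/(s *k (arr a *: (x1 : N) + tw a x2) + (arr a *: (y1 : N) + tw a y2)).
rewrite scalerP kscDr addrACA; congr (_ + _).
by rewrite /tw (thin_lin tM) mulrDl kscDl kscA mulrA.
Qed.

Lemma ext_vv v w x : ext_v v (ext_v w x) = if v == w then ext_v v x else 0.
Proof.
case: x => [y x]; rewrite /ext_v /= !scalerA !ev_mul; case: eqP => // _.
by rewrite (scale0r (y : N)) (scale0r (x : M)).
Qed.

Lemma ext_sum x : \sum_v ext_v v x = x.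
Proof.
case: x => [y x]; have : forall r : seq Q, \sum_(v <- r) ext_v v (y, x) =
    ((\sum_(v <- r) ev v *: (y : N) : kmod N), (\sum_(v <- r) ev v *: (x : M) : kmod M)).
  elim=> [|v r IH]; first by rewrite !big_nil.
  by rewrite !big_cons IH.
move=> ->; congr (_, _); rewrite -scaler_suml.
  exact: (scale1r (y : N)).
exact: (scale1r (x : M)).
Qed.

Lemma ext_av a x : ext_a a (ext_v (src a) x) = ext_a a x.
Proof.
case: x => [y x]; rewrite /ext_a /ext_v /= !scalerA !arr_ev !eqxx /tw.
by rewrite (be_ev tM) eqxx.
Qed.

Lemma ext_va a x : ext_v (tgt a) (ext_a a x) = ext_a a x.
Proof.
case: x => [y x]; rewrite /ext_a /ext_v /= scalerDr !scalerA !ev_arr !eqxx /tw.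
by rewrite -kscC (thin_v tN) eqxx.
Qed.

Definition ext_rep : qrep K Q :=
  @QRep K Q V ext_v ext_a ext_v_lin ext_a_lin ext_vv ext_sum ext_av ext_va.
Let X := rep_mod ext_rep.

(** The cocycle of the extension, for the obvious splitting over K. *)
Definition ext_cocycle (z : L) (x : M) : N := (z *: (((0 : N), x) : X)).1.

Lemma ext_kscE s (x : X) : s *k x = ((s *k (x.1 : N) : N), (s *k (x.2 : M) : M)) :> X.
Proof. by rewrite rep_mod_ksc. Qed.

Lemma ext_snd_linear : linear (fun x : X => x.2 : M).
Proof.
apply: linear_crit => [s x y|v x|a x].
- by rewrite -(kscE s x) ext_kscE -(kscE s (x.2 : M)).
- by rewrite rep_mod_ev.
- by rewrite rep_mod_arr.
Qed.

Lemma ext_fst_linear : linear (fun y : N => ((y, (0 : M)) : X)).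
Proof.
apply: linear_crit => [s x y|v x|a x].
- rewrite -(kscE s x) -(kscE s ((x, 0) : X)) ext_kscE /= ksc0r.
  by congr (_, _); rewrite /= addr0.
- by rewrite rep_mod_ev /= /ext_v /= scaler0.
- by rewrite rep_mod_arr /= /ext_a /tw /= scaler0 (be0 tM) mul0r ksc0 addr0.
Qed.

Lemma ext_cocycle_cocycle : cocycle ext_cocycle.
Proof.
split=> [z s x y|s z w x|z w x].
- rewrite -(kscE s x) -(kscE s (ext_cocycle z x)) /ext_cocycle.
  have -> : (((0 : N), s *k x + y) : X) = s *k (((0 : N), x) : X) + (((0 : N), y) : X).
    by rewrite ext_kscE /= ksc0r; congr (_, _); rewrite /= addr0.
  by rewrite scalerP ext_kscE.
- rewrite -(kscE s (ext_cocycle z x)) /ext_cocycle scalerDl kscZ ext_kscE.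
  by [].
- rewrite /ext_cocycle.
  have -> : (z * w) *: (((0 : N), x) : X) =
     z *: (((w *: (((0 : N), x) : X)).1, (0 : M)) : X) + z *: (((0 : N), w *: x) : X).
    rewrite -scalerDr -scalerA; congr (_ *: _).
    have := linear_addZ ext_snd_linear w (((0 : N), x) : X).
    case: (w *: _) => y x' /= ->; by congr (_, _); rewrite /= ?addr0 ?add0r.
  by rewrite -(linear_addZ ext_fst_linear).
Qed.

Lemma cc_ext_cocycle a : I (src a) -> J (tgt a) -> cc ext_cocycle a = ga a.
Proof.
move=> Is Jt; rewrite /cc /ext_cocycle rep_mod_arr /= /ext_a /= scaler0 add0r /tw.
by rewrite (beZ tN) (thin_dual tM) (thin_dual tN) !eqxx Is Jt mulr1 mul1r.
Qed.

End Extension.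

End ThinPair.
End HomExt.

(** * The two-term complex of an overlap *)

Section Solve.
Variables (n : nat) (low : nat -> bool) (K : zmodType).
Variables (a b c d : nat).
Local Notation p := (maxn a c).
Local Notation q := (minn b d).
Local Notation el := (elig n low a b c d).

Lemma elig_range i : el i -> (0 < i)%N && (p <= i <= q)%N.
Proof. by rewrite /elig; case: (low i); lia. Qed.

Lemma elig_mid i : (b <= n)%N -> (d <= n)%N -> (p < i < q)%N -> el i.
Proof. by move=> bn dn; rewrite /elig; case: (low i); lia. Qed.

(** A closed cochain is constant on the overlap, and an eligible outer place forces
the constant to be zero. *)
Lemma cochain_zero (h : nat -> K) : (b <= n)%N -> (d <= n)%N -> ~~ hom_cond n low a b c d ->
  (forall k, ~~ (p <= k < q)%N -> h k = 0) -> (forall i, el i -> h i.-1 = h i) ->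
  forall k, h k = 0.
Proof.
move=> bn dn nh supp cl k; have [kpq|] := boolP (p <= k < q)%N; last exact: supp.
have up m : (p <= m < q)%N -> h m = h p.
  elim: m => [|m IH] mpq; first by congr h; lia.
  have [->//|ne] := eqVneq m.+1 p.
  by rewrite -(cl m.+1) /=; [apply: IH; lia|apply: elig_mid; lia].
have lpq : (p < q)%N by lia.
move: nh; rewrite /hom_cond lpq /=; case: (boolP (el p)) => [ep _|_].
  by rewrite up // -cl // supp //; have := elig_range ep; lia.
case: (boolP (el q)) => // eq _.
rewrite up // -(up q.-1); last by lia.
by rewrite cl // supp //; lia.
Qed.

Lemma cochain_const (h : nat -> K) : (b <= n)%N -> (d <= n)%N ->
  (forall i, el i -> h i.-1 = h i) -> forall k, (p <= k < q)%N -> h k = h p.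
Proof.
move=> bn dn cl; elim=> [|m IH] mpq; first by congr h; lia.
have [->//|ne] := eqVneq m.+1 p.
by rewrite -(cl m.+1) /=; [apply: IH; lia|apply: elig_mid; lia].
Qed.

(** The equation is solved by summation, starting at an outer place that is eligible;
if the other one is eligible too, its equation says that the sum over all the
places vanishes. *)
Lemma cochain_solve (g : nat -> K) :
  (ext_cond n low a b c d -> \sum_(p <= i < q.+1) g i = 0) ->
  exists h : nat -> K, (forall k, ~~ (p <= k < q)%N -> h k = 0) /\
    forall i, el i -> g i = h i.-1 - h i.
Proof.
move=> Hext.
have [/andP[eq nep]|] := boolP (el q && ~~ el p).
  have lpq : (p < q)%N.
    have r := elig_range eq; have ne : p != q by apply: contraNneq nep => ->.
    by lia.
  exists (fun k => if (p <= k < q)%N then \sum_(k.+1 <= i < q.+1) g i else 0); split.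
    by move=> k /negPf->.
  move=> i ei; have := elig_range ei.
  have [e|ni] := eqVneq i p; first by rewrite -e ei in nep.
  move=> r; rewrite ifT; last by lia.
  rewrite prednK; last by lia.
  rewrite big_ltn; last by lia.
  case: ifP => iq; first by rewrite addrK.
  by rewrite big_geq ?addr0 ?subr0 //; lia.
move=> nn; exists (fun k => if (p <= k < q)%N then - \sum_(p <= i < k.+1) g i else 0); split.
  by move=> k /negPf->.
move=> i ei; have r := elig_range ei.
have S : el q -> \sum_(p <= i < q.+1) g i = 0.
  move=> eq; apply: Hext; rewrite /ext_cond eq; move: nn; rewrite eq /= negbK => ->.
  by rewrite !andbT; lia.
have [e|ni] := eqVneq i p.
  rewrite ifF; last by lia.
  case: ifP => iq; first by rewrite e big_nat1 sub0r opprK.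
  have e' : i = q by lia.
  by have := S; rewrite -e' => /(_ ei); rewrite -e big_nat1 => ->; rewrite subr0.
rewrite ifT; last by lia.
rewrite prednK; last by lia.
case: ifP => iq.
  by rewrite opprK big_nat_recr /=; [rewrite addKr|lia].
have e' : i = q by lia.
have := S; rewrite -e' => /(_ ei); rewrite big_nat_recr /=; last by lia.
by move/eqP; rewrite addrC addr_eq0 => /eqP ->; rewrite subr0.
Qed.

Lemma cochain_telescope (g h : nat -> K) : (b <= n)%N -> (d <= n)%N -> ext_cond n low a b c d ->
  (forall k, ~~ (p <= k < q)%N -> h k = 0) -> (forall i, el i -> g i = h i.-1 - h i) ->
  \sum_(p <= i < q.+1) g i = 0.
Proof.
move=> bn dn /and3P[pq ep eq] supp gh.
have rp := elig_range ep.
have el_all i : (p <= i <= q)%N -> el i.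
  move=> r; have [->//|n1] := eqVneq i p; have [->//|n2] := eqVneq i q.
  by apply: elig_mid => //; lia.
rewrite (eq_big_nat _ _ (F2 := fun i => - (h i.+1.-1 - h i.-1))); last first.
  by move=> i r; rewrite gh ?opprB //; apply: el_all; lia.
rewrite sumrN (telescope_sumr (fun i => h i.-1)); last by lia.
by rewrite /= !supp ?subrr ?oppr0 //; lia.
Qed.
End Solve.

(** A numbering of the vertices 0, ..., n-1 and of the inner places 1, ..., n-1 of
the line. The inverse maps [vx] and [ax] are total on nat, and take arbitrary
values outside these ranges. *)
Record line_data (n : nat) (Q : quiver) := LineData {
  vi : Q -> nat;
  ai : arrow Q -> nat;
  vx : nat -> Q;
  ax : nat -> arrow Q;
  vi_lt : forall v, (vi v < n)%N;
  vxK : forall k, (k < n)%N -> vi (vx k) = k;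
  viK : forall v, vx (vi v) = v;
  ai_rng : forall a, (0 < ai a < n)%N;
  axK : forall i, (0 < i < n)%N -> ai (ax i) = i;
  aiK : forall a, ax (ai a) = a;
  ld_ends : forall a, (vi (src a) = ai a /\ vi (tgt a) = (ai a).-1) \/
                      (vi (src a) = (ai a).-1 /\ vi (tgt a) = ai a) }.

Lemma type_A_line n (Q : quiver) : (1 < n)%N -> type_A n Q -> exists _ : line_data n Q, True.
Proof.
case: n => [|[|n]] // _ [v [a [[v' vK v'K] [a' aK a'K] h]]].
have vi0 : forall k, (k < n.+2)%N -> v' (v (inord k)) = k :> nat.
  by move=> k lk; rewrite vK inordK.
unshelve eexists => //.
apply: (@LineData _ _ (fun x => v' x : nat) (fun x => (a' x).+1) (fun k => v (inord k)) (fun i => a (inord i.-1))).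
- by move=> x; apply: ltn_ord.
- exact: vi0.
- by move=> x; rewrite inord_val v'K.
- by move=> x; have := ltn_ord (a' x) => /=; lia.
- by move=> i r; rewrite aK inordK; lia.
- by move=> x /=; rewrite inord_val a'K.
- move=> x; have lx : (a' x < n.+1)%N := ltn_ord (a' x).
  have [||[s t]|[s t]] := h (a' x) (inord (a' x)) (inord (a' x).+1).
  + by rewrite inordK //; lia.
  + by rewrite inordK //; lia.
  + right; rewrite a'K in s t; rewrite s t !vK !inordK //=; exact: ltnW.
  + left; rewrite a'K in s t; rewrite s t !vK !inordK //=; exact: ltnW.
Qed.

(** * One coordinate for Hom and Ext of two interval modules *)

Section Lambda.
Variables (K : fieldType) (n : nat) (Q : quiver) (ld : line_data n Q).
Local Notation L := (path_algebra K Q).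
Local Notation vi := (vi ld).
Local Notation ai := (ai ld).
Local Notation vx := (vx ld).
Local Notation ax := (ax ld).

(** The ends 0 and n of the line count as low, which is what [key] expects. *)
Definition low (i : nat) : bool := ~~ [&& (0 < i)%N, (i < n)%N & vi (tgt (ax i)) == i].
Lemma low0 : low 0. Proof. by []. Qed.
Lemma lown : low n. Proof. by rewrite /low ltnn andbF. Qed.

Lemma arrow_low x : vi (src x) = (if low (ai x) then ai x else (ai x).-1) /\
  vi (tgt x) = (if low (ai x) then (ai x).-1 else ai x).
Proof.
have := ai_rng ld x; rewrite /low aiK => /andP[-> ->] /=.
have := ai_rng ld x; case: (ld_ends ld x) => [[-> ->]|[-> ->]] r; last by rewrite eqxx.
by rewrite (_ : ((ai x).-1 == ai x) = false) //; lia.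
Qed.

Definition seg (a b : nat) : pred Q := fun v => (a <= vi v < b)%N.

Lemma eligE a b c d x : elig n low a b c d (ai x) = seg a b (src x) && seg c d (tgt x).
Proof.
rewrite /elig /seg; have /andP[-> ->] := ai_rng ld x; have [-> ->] := arrow_low x.
by case: (low _).
Qed.

Lemma elig_ax a b c d i : elig n low a b c d i -> ai (ax i) = i.
Proof. by case/and3P=> i0 iN _; rewrite axK ?i0. Qed.

Local Notation homC a b c d := (hom_cond n low a b c d).
Local Notation extC a b c d := (ext_cond n low a b c d).
Definition HE a b c d := homC a b c d || extC a b c d.

Lemma hom_cond_ext a b c d : homC a b c d -> extC a b c d = false.
Proof. by rewrite /hom_cond /ext_cond => /and3P[_ /negPf-> _]; rewrite andbF. Qed.

(** The differential of the complex is source minus target. With this sign it becomes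
the difference of the values at i.-1 and i, whatever the direction of the arrow. *)
Definition sgn (i : nat) (x : K) : K := if low i then - x else x.

(** At most one of Hom and Ext is non-zero, and that one has dimension one. Hom is
read at the first common vertex, since the entries of a homomorphism are constant.
Ext is read by summing over all places of the overlap: this vanishes on
coboundaries because the sum telescopes. *)
Definition lam0 (a b c d : nat) (h : Q -> K) (g : arrow Q -> K) : K :=
  if homC a b c d then h (vx (maxn a c))
  else if extC a b c d then \sum_(maxn a c <= i < (minn b d).+1) sgn i (g (ax i)) else 0.

Lemma lam0_lin a b c d s h g h' g' :
  lam0 a b c d (fun v => s * h v + h' v) (fun x => s * g x + g' x) =
  s * lam0 a b c d h g + lam0 a b c d h' g'.
Proof.
rewrite /lam0; case: ifP => _ //; case: ifP => _; last by rewrite mulr0 addr0.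
rewrite mulr_sumr -big_split; apply: eq_bigr => i _.
by rewrite /sgn /=; case: (low i) => //; ring.
Qed.

Lemma eq_lam0 a b c d h g h' g' : h =1 h' -> g =1 g' -> lam0 a b c d h g = lam0 a b c d h' g'.
Proof.
move=> e1 e2; rewrite /lam0 e1; case: ifP => // _; case: ifP => // _.
by apply: eq_bigr => i _; rewrite e2.
Qed.

Lemma lam0_nHE a b c d h g : ~~ HE a b c d -> lam0 a b c d h g = 0.
Proof. by rewrite /HE /lam0 negb_or => /andP[/negPf-> /negPf->]. Qed.

Section Pair.
Variables (M N : lmodType L) (a b c d : nat).
Hypotheses (bn : (b <= n)%N) (dn : (d <= n)%N).
Variables (bM : Q -> M) (be : Q -> M -> K) (bN : Q -> N) (be' : Q -> N -> K).
Hypotheses (tM : thin (seg a b) bM be) (tN : thin (seg c d) bN be').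
Local Notation p := (maxn a c).
Local Notation q := (minn b d).

Definition nat_fun (h : Q -> K) (k : nat) : K := if (k < n)%N then h (vx k) else 0.

Lemma nat_fun_vi h v : nat_fun h (vi v) = h v.
Proof. by rewrite /nat_fun vi_lt viK. Qed.

Lemma nat_fun_supp h : supp2 (seg a b) (seg c d) h ->
  forall k, ~~ (p <= k < q)%N -> nat_fun h k = 0.
Proof.
move=> sh k nk; rewrite /nat_fun; case: ifP => // kn; apply: sh.
by rewrite /seg vxK //; lia.
Qed.

Lemma nat_fun_arrow h x : nat_fun h (ai x).-1 - nat_fun h (ai x) =
  sgn (ai x) (h (src x) - h (tgt x)).
Proof.
have [es et] := arrow_low x; rewrite -2!(nat_fun_vi h) es et /sgn.
by case: (low _); rewrite ?opprB.
Qed.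

Lemma sgn0 i : sgn i 0 = 0. Proof. by rewrite /sgn oppr0 if_same. Qed.

Lemma nat_fun_closed h : closed0 (seg a b) (seg c d) h ->
  forall i, elig n low a b c d i -> nat_fun h i.-1 = nat_fun h i.
Proof.
move=> ch i el; have e := elig_ax el; rewrite -e in el *.
move: el; rewrite eligE => /andP[Is Jt]; apply/eqP; rewrite -subr_eq0 nat_fun_arrow.
by rewrite (ch _ Is Jt) subrr sgn0.
Qed.

Definition lam (f : M -> N) (co : L -> M -> N) : K := lam0 a b c d (hc bM be' f) (cc bM be' co).

Lemma hc_nhom f : linear f -> ~~ homC a b c d -> forall v, hc bM be' f v = 0.
Proof.
move=> lf nh v; rewrite -nat_fun_vi; apply: (cochain_zero bn dn nh).
  by apply: nat_fun_supp; apply: (hc_supp tM tN); apply: linear_at0.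
by apply: nat_fun_closed; apply: (hc_closed tM tN lf).
Qed.

Lemma hc_const f : linear f -> forall v, (p <= vi v < q)%N -> hc bM be' f v = hc bM be' f (vx p).
Proof.
move=> lf v r; have pn : (p < n)%N by lia.
have cl := nat_fun_closed (hc_closed tM tN lf).
have := cochain_const bn dn cl r.
by rewrite nat_fun_vi /nat_fun pn.
Qed.

(** Together with [lam_zero]: the coordinate detects whether a class of Hom + Ext is
zero. *)
Lemma lam_eq0 f co : linear f -> cocycle co -> lam f co = 0 ->
  (forall x, f x = 0) /\ coboundary co.
Proof.
move=> lf cco l0; split.
  suff h0 v : hc bM be' f v = 0.
    by move=> x; rewrite (hc_exp tM tN lf) big1 // => v _; rewrite h0 mulr0 ksc0.
  have [hP|nh] := boolP (homC a b c d); last exact: hc_nhom.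
  have [r|nr] := boolP (p <= vi v < q)%N; last first.
    rewrite -nat_fun_vi; apply: nat_fun_supp nr; apply: (hc_supp tM tN); exact: linear_at0.
  by rewrite hc_const //; move: l0; rewrite /lam /lam0 hP.
have [|h [hs hh]] := @cochain_solve n low K a b c d (fun i => sgn i (cc bM be' co (ax i))).
  move=> eP; move: l0; rewrite /lam /lam0 eP; case: ifP => // hP.
  by rewrite hom_cond_ext in eP.
apply: (cc_coboundary tM tN cco (h := fun v => h (vi v))) => [v nv|x Is Jt].
  by apply: hs; move: nv; rewrite /seg; lia.
have el : elig n low a b c d (ai x) by rewrite eligE Is Jt.
have := hh _ el; rewrite aiK; have [-> ->] := arrow_low x; rewrite /sgn.
case: (low _) => // e; by rewrite -[LHS]opprK e opprB.
Qed.

Lemma lam_zero f co : (forall x, f x = 0) -> coboundary co -> lam f co = 0.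
Proof.
move=> f0 bc; rewrite /lam /lam0; case: ifP => hP.
  by rewrite /hc f0 (be0 tN).
case: ifP => // eP; have [h sh ch] := coboundary_cc tM tN bc.
apply: (cochain_telescope bn dn eP (nat_fun_supp sh)) => i el.
have e := elig_ax el; rewrite -e in el *; move: el; rewrite eligE => /andP[Is Jt].
by rewrite aiK nat_fun_arrow ch.
Qed.

Lemma lam_lin s f g co co' :
  lam (fun x => s *k f x + g x) (fun z x => s *k co z x + co' z x) = s * lam f co + lam g co'.
Proof.
rewrite /lam -lam0_lin; apply: eq_lam0 => [v|x]; first by rewrite /hc (thin_lin tN).
by rewrite /cc (thin_lin tN).
Qed.

Lemma linear_zero : linear (fun _ : M => 0 : N).
Proof. by move=> z x y; rewrite scaler0 addr0. Qed.

Lemma cocycle_0 : cocycle (fun (_ : L) (_ : M) => 0 : N).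
Proof.
split=> [z s x y|s z w x|z w x]; rewrite ?addr0.
- by rewrite -(kscE s (0 : N)) ksc0r.
- by rewrite -(kscE s (0 : N)) ksc0r.
- by rewrite scaler0.
Qed.

Lemma lam_surj : HE a b c d ->
  exists f co, [/\ linear f, cocycle co & lam f co = 1].
Proof.
case: (boolP (homC a b c d)) => [hP _|nh].
  pose h (v : Q) : K := ((p <= vi v < q)%N)%:R.
  have lpq : (p < q)%N by case/and3P: hP.
  have sh : supp2 (seg a b) (seg c d) h.
    by move=> v nv; rewrite /h (_ : (_ <= _ < _)%N = false) //; move: nv; rewrite /seg; lia.
  have ch : closed0 (seg a b) (seg c d) h.
    move=> x Is Jt; have el : elig n low a b c d (ai x) by rewrite eligE Is Jt.
    have r := elig_range el; have np : ai x != p by apply: contraTneq el => ->; case/and3P: hP.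
    have nq : ai x != q by apply: contraTneq el => ->; case/and3P: hP.
    by rewrite /h; have [-> ->] := arrow_low x; case: (low _); congr (_%:R); congr nat_of_bool; lia.
  exists (hom_of be bN h), (fun _ _ => 0); split.
  - exact: (hom_of_linear tM tN sh ch).
  - exact: cocycle_0.
  - rewrite /lam /lam0 hP (hc_hom_of tM tN) // /h vxK ?leqnn ?lpq //.
    by lia.
move=> eP; rewrite /HE (negPf nh) /= in eP.
have [pq ep eq] := and3P eP.
pose ga (x : arrow Q) : K := (ai x == p)%:R * (if low p then -1 else 1).
exists (fun=> 0), (ext_cocycle tM tN ga); split.
- exact: linear_zero.
- exact: ext_cocycle_cocycle.
- rewrite /lam /lam0 (negPf nh) eP.
  have ccg i : (p <= i <= q)%N -> cc bM be' (ext_cocycle tM tN ga) (ax i) = (i == p)%:R * (if low p then -1 else 1).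
    move=> r; have el : elig n low a b c d i.
      have [->//|n1] := eqVneq i p; have [->//|n2] := eqVneq i q.
      by apply: elig_mid => //; lia.
    have e := elig_ax el; rewrite -e in el; move: el; rewrite eligE => /andP[Is Jt].
    by rewrite (cc_ext_cocycle tM tN) // /ga e.
  rewrite big_ltn; last by lia.
  rewrite big_nat big1 => [|i r]; last first.
    have ip : (i == p) = false by clear -r; lia.
    have ir : (p <= i <= q)%N by clear -r; lia.
    by rewrite (ccg i ir) ip mul0r sgn0.
  rewrite ccg ?eqxx ?leqnn ?pq // mul1r addr0 /sgn.
  by case: (low _); rewrite ?opprK.
Qed.
End Pair.

Section Triple.
Variables (M N P : lmodType L) (a b c d e f : nat).
Hypotheses (ab : (a < b)%N) (bn : (b <= n)%N) (cd : (c < d)%N) (dn : (d <= n)%N) (ef : (e < f)%N) (fn : (f <= n)%N).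
Variables (bM : Q -> M) (be : Q -> M -> K) (bN : Q -> N) (be' : Q -> N -> K) (bP : Q -> P) (be'' : Q -> P -> K).
Hypotheses (tM : thin (seg a b) bM be) (tN : thin (seg c d) bN be') (tP : thin (seg e f) bP be'').

(** The coordinates are chosen such that products of basis elements have the
coefficient 1, so that no signs or scalars have to be carried along. *)
Lemma lam_prod x (u : M -> N) co (w : N -> P) co' :
  linear u -> cocycle co -> linear w -> cocycle co' ->
  ends x a b -> ends x c d -> ends x e f -> HE a b c d -> HE c d e f ->
  lam a b e f bM be'' (w \o u) (fun z m => w (co z m) + co' z (u m)) =
  lam c d e f bN be'' w co' * lam a b c d bM be' u co.
Proof.
move=> lu cco lw cco' xab xcd xef.
have hE v : hc bM be'' (w \o u) v = hc bN be'' w v * hc bM be' u v.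
  rewrite /hc /= (hc_exp tN tP lw) (be_sum tP) (bigD1 v) //= big1 => [|v' nv]; last first.
    by rewrite (beZ tP) (thin_dual tP) eq_sym (negPf nv) mulr0.
  rewrite (beZ tP) (thin_dual tP) eqxx addr0 /= -/(hc bM be' u v).
  have [_|nP] := boolP (seg e f v); first by rewrite mulr1 mulrC.
  by rewrite /hc (be_out tP _ nP) mulr0 mul0r.
have wE v y : be'' v (w y) = hc bN be'' w v * be' v y.
  rewrite (hc_exp tN tP lw) (be_sum tP) (bigD1 v) //= big1 => [|v' nv]; last first.
    by rewrite (beZ tP) (thin_dual tP) eq_sym (negPf nv) mulr0.
  rewrite (beZ tP) (thin_dual tP) eqxx addr0 /=.
  have [_|nP] := boolP (seg e f v); first by rewrite mulr1 mulrC.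
  by rewrite /hc (be_out tP _ nP) mulr0 mul0r.
have uE v : u (bM v) = hc bM be' u v *k bN v.
  have {1}-> : bM v = ev v *: bM v by rewrite (thin_v tM) eqxx.
  by rewrite (linear_addZ lu) (ev_exp tN).
have cE y : cc bM be'' (fun z m => w (co z m) + co' z (u m)) y =
    hc bN be'' w (tgt y) * cc bM be' co y + hc bM be' u (src y) * cc bN be'' co' y.
  by rewrite /cc (beD tP) wE uE (klinZ (coc_klin cco' _)) (beZ tP).

rewrite {1}/HE; case: (boolP (homC a b c d)) => [h1 _|nh1 /= e1]; rewrite /HE;
  case: (boolP (homC c d e f)) => [h2 _|nh2 /= e2].
- have [h3 r] := prod_hom_hom low0 lown ab bn cd dn ef fn xab xcd xef h1 h2.
  have r' : (maxn a e < minn b f)%N by case/and3P: h3.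
  rewrite /lam /lam0 h1 h2 h3 hE; congr (_ * _).
    by rewrite (hc_const dn fn tN tP lw) // vxK //; lia.
  by rewrite (hc_const bn dn tM tN lu) // vxK //; lia.
- have [e3 [m1 [m2 m3]]] := prod_hom_ext low0 lown ab bn cd dn ef fn xab xcd xef h1 e2.
  have nh3 : homC a b e f = false by apply/negP => /hom_cond_ext; rewrite e3.
  rewrite /lam /lam0 h1 (negPf nh2) e2 nh3 e3 m1 m2 m3 !big_nat1 cE.
  rewrite (hc_nhom dn fn tN tP lw nh2) mul0r add0r.
  have [_ el3 _] := and3P e3; have [_ el2 _] := and3P e2; rewrite m1 in el2.
  have ea := elig_ax el3; rewrite -ea !eligE in el3 el2.
  have -> : hc bM be' u (src (ax (maxn a e))) = hc bM be' u (vx (maxn a c)).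
    apply: (hc_const bn dn tM tN lu); move: el3 el2; rewrite /seg; lia.
  by rewrite /sgn; case: ifP => _; ring.
- have [e3 [m1 [m2 m3]]] := prod_ext_hom low0 lown ab bn cd dn ef fn xab xcd xef e1 h2.
  have nh3 : homC a b e f = false by apply/negP => /hom_cond_ext; rewrite e3.
  rewrite /lam /lam0 h2 (negPf nh1) e1 nh3 e3 m1 m2 m3 !big_nat1 cE.
  rewrite (hc_nhom bn dn tM tN lu nh1) mul0r addr0.
  have [_ el3 _] := and3P e3; have [_ el1 _] := and3P e1; rewrite m1 in el1.
  have ea := elig_ax el3; rewrite -ea !eligE in el3 el1.
  have -> : hc bN be'' w (tgt (ax (maxn a e))) = hc bN be'' w (vx (maxn c e)).
    apply: (hc_const dn fn tN tP lw); move: el3 el1; rewrite /seg; lia.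
  by rewrite /sgn; case: ifP => _; ring.
- by have := prod_ext_ext low0 lown ab bn cd dn ef fn xab xcd xef e1 e2.
Qed.
End Triple.
End Lambda.

(** * From intervals to chords *)

Section Circ.
Variables (K : fieldType) (n : nat) (Q : quiver) (ld : line_data n Q).
Local Notation L := (path_algebra K Q).
Local Notation pt := 'I_n.+1.
Local Notation kk := (key n (low ld)).

Definition pos (x : pt) : pt := inord #|[set y : pt | (kk y < kk x)%N]|.

Lemma key_inj (x y : pt) : kk x = kk y -> x = y.
Proof.
move=> e; apply: val_inj; move: e; rewrite /key /=.
have := ltn_ord x; have := ltn_ord y; case: (low ld x); case: (low ld y); lia.
Qed.

Lemma posE (x : pt) : pos x = #|[set y : pt | (kk y < kk x)%N]| :> nat.
Proof.
rewrite inordK // -[X in (_ < X)%N](card_ord n.+1) -cardsT; apply: proper_card.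
apply/properP; split; first exact: subsetT.
by exists x; rewrite ?inE // ltnn.
Qed.

Lemma pos_mono (x y : pt) : (kk x < kk y)%N -> (pos x < pos y)%N.
Proof.
move=> lt; rewrite !posE; apply: proper_card; apply/properP; split.
  by apply/subsetP => z; rewrite !inE => /ltn_trans; apply.
by exists x; rewrite inE ?ltnn.
Qed.

Lemma ltn_pos (x y : pt) : (pos x < pos y)%N = (kk x < kk y)%N.
Proof.
apply/idP/idP; last exact: pos_mono.
case: (ltngtP (kk x) (kk y)) => // [/pos_mono|/key_inj->]; last by rewrite ltnn.
by move=> l1 l2; have := ltn_trans l1 l2; rewrite ltnn.
Qed.

Lemma eq_pos (x y : pt) : (pos x == pos y :> nat) = (kk x == kk y).
Proof.
have := ltn_pos x y; have := ltn_pos y x.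
by case: (ltngtP (kk x) (kk y)); case: (ltngtP (pos x) (pos y)).
Qed.

Lemma leq_pos (x y : pt) : (pos x <= pos y)%N = (kk x <= kk y)%N.
Proof. by rewrite leqNgt ltn_pos -leqNgt. Qed.

Lemma pos_inj : injective pos.
Proof. by move=> x y e; apply: key_inj; apply/eqP; rewrite -eq_pos e. Qed.

Definition gpos : {perm pt} := perm pos_inj.

(** The interval [a, b) becomes the chord between the positions of a and b on the
circle. *)
Definition circ (t : chord n) : chord n := permc gpos t.

Lemma circ_bij : bijective circ.
Proof.
exists (permc (gpos^-1)%g) => t; rewrite /circ -permcM ?mulgV ?mulVg; exact: permc1.
Qed.

Definition HEc (t u : chord n) : bool := HE ld (lo t) (hi t) (lo u) (hi u).

Lemma hi_le (t : chord n) : (hi t <= n)%N. Proof. by rewrite -ltnS; apply: ltn_ord. Qed.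

Lemma circ_sort (t : chord n) : (lo (circ t) = if low ld (lo t) then pos (lo t) else pos (hi t)) /\
  (hi (circ t) = if low ld (lo t) then pos (hi t) else pos (lo t)).
Proof.
have [m1 m2] := key_sort (low0 ld) (lown ld) (lo_lt_hi t) (hi_le t).
rewrite /circ; case/orP: (permcP gpos t); rewrite !permE => /andP[/andP[lt /eqP-> /eqP->]];
  rewrite ltn_pos in lt; move: m1 m2.
  by rewrite (minn_idPl (ltnW lt)) (maxn_idPr (ltnW lt)); case: ifP => // _ e; rewrite -e ltnn in lt.
by rewrite (minn_idPr (ltnW lt)) (maxn_idPl (ltnW lt)); case: ifP => // _ e; rewrite -e ltnn in lt.
Qed.

(** Non-vanishing of Hom + Ext, which depends on the orientation of the quiver, is
turned into the relation of chords, which does not. *)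
Lemma HEc_circ t u : HEc t u = related (circ t) (circ u).
Proof.
rewrite /HEc /HE (HE_key (low0 ld) (lown ld) (lo_lt_hi t) (hi_le t) (lo_lt_hi u) (hi_le u)).
have [m1 m2] := key_sort (low0 ld) (lown ld) (lo_lt_hi t) (hi_le t).
have [m3 m4] := key_sort (low0 ld) (lown ld) (lo_lt_hi u) (hi_le u).
have [c1 c2] := circ_sort t; have [c3 c4] := circ_sort u.
rewrite /pts_related m1 m2 m3 m4 /related c1 c2 c3 c4 /nat_related.
by case: (low ld _); case: (low ld _); rewrite !ltn_pos !leq_pos !eq_pos.
Qed.

Lemma ends_circ (x : pt) (t : chord n) : ends x (lo t) (hi t) = inc (pos x) (circ t).
Proof.
by rewrite /circ -[pos x](permE pos_inj) inc_permc /inc -!val_eqE.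
Qed.

Definition segm (M : lmodType L) (t : chord n) : Prop :=
  exists (b : Q -> M) (be : Q -> M -> K), thin (seg ld (lo t) (hi t)) b be.

Lemma hom_zeroP (M N : lmodType L) : hom_zero M N <-> forall f : M -> N, linear f -> forall x, f x = 0.
Proof.
split=> [h f lf x|h f x]; last by apply: h; apply: linearP.
pose F : {linear M -> N} := HB.pack_for {linear M -> N} f (GRing.isLinear.Build L M N *:%R f lf).
exact: (h F).
Qed.

Lemma segm_zero (M N : lmodType L) t u : segm M t -> segm N u ->
  (hom_zero M N /\ ext_zero M N) <-> ~~ HEc t u.
Proof.
case=> [b [be tM]] [b' [be' tN]]; split.
  case=> /hom_zeroP h e; apply/negP => he.
  have [f [co [lf cco l1]]] := lam_surj (hi_le t) (hi_le u) tM tN he.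
  have := lam_zero (hi_le t) (hi_le u) tM tN (h f lf) (e co cco).
  by rewrite l1 => /eqP; rewrite oner_eq0.
move=> nhe; split.
  apply/hom_zeroP => f lf; have [] // := lam_eq0 (hi_le t) (hi_le u) tM tN lf (cocycle_0 M N) _.
  exact: lam0_nHE.
move=> co cco; have [] // := lam_eq0 (hi_le t) (hi_le u) tM tN (@linear_zero K Q M N) cco _.
exact: lam0_nHE.
Qed.

Lemma segm_iso (M N : lmodType L) t : segm M t -> segm N t -> isomorphic M N.
Proof.
case=> [b [be tM]] [b' [be' tN]].
have sup : supp2 (seg ld (lo t) (hi t)) (seg ld (lo t) (hi t)) (fun v => (seg ld (lo t) (hi t) v)%:R : K).
  by move=> v; rewrite andbb => /negPf->.
have clo : closed0 (seg ld (lo t) (hi t)) (seg ld (lo t) (hi t)) (fun v => (seg ld (lo t) (hi t) v)%:R : K).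
  by move=> a -> ->.
have lf := hom_of_linear tM tN sup clo; have lg := hom_of_linear tN tM sup clo.
pose h (v : Q) : K := (seg ld (lo t) (hi t) v)%:R.
pose F : {linear M -> N} := HB.pack_for {linear M -> N} (hom_of be b' h) (GRing.isLinear.Build L M N *:%R _ lf).
exists F; exists (hom_of be' b h) => x /=.
  apply: (thin_ext tM) => v Iv; rewrite (be_hom_of be' tM) (be_hom_of be tN) /h Iv.
  by rewrite !mul1r !mulr1.
apply: (thin_ext tN) => v Iv; rewrite (be_hom_of be tN) (be_hom_of be' tM) /h Iv.
by rewrite !mul1r !mulr1.
Qed.

Lemma segm_transfer (M N : lmodType L) t : isomorphic M N -> segm M t -> segm N t.
Proof.
case=> F [g FK gK] [b [be tM]]; exists (fun v => F (b v)), (fun v y => be v (g y)).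
have lF : klinear F by apply: linear_klin; apply: linearP.
have gP s x y : g (s *k x + y) = s *k g x + g y.
  by apply: (can_inj FK); rewrite (klinP lF) !gK.
split.
- by move=> v s x y; rewrite gP (thin_lin tM).
- by move=> v w; rewrite FK (thin_dual tM).
- move=> x; rewrite -{1}(gK x) {1}(thin_exp tM (g x)) (klin_sum lF).
  by apply: eq_bigr => v _; rewrite (klinZ lF).
- by move=> u v; rewrite -linearZ (thin_v tM); case: ifP => _ //; rewrite linear0.
- by move=> a v; rewrite -linearZ (thin_a tM); case: ifP => _ //; rewrite linear0.
Qed.

Lemma segm_uniq (M : lmodType L) t u : segm M t -> segm M u -> t = u.
Proof.
case=> [b [be tM]] [b' [be' tM']].
have sub (t1 t2 : chord n) (b1 b2 : Q -> M) (be1 be2 : Q -> M -> K) :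
    thin (seg ld (lo t1) (hi t1)) b1 be1 -> thin (seg ld (lo t2) (hi t2)) b2 be2 ->
    forall k, (lo t1 <= k < hi t1)%N -> (lo t2 <= k < hi t2)%N.
  move=> tt1 tt2 k r; have kn : (k < n)%N by have := hi_le t1; lia.
  have Ik : seg ld (lo t1) (hi t1) (vx ld k) by rewrite /seg vxK.
  have [Jk|nJ] := boolP (seg ld (lo t2) (hi t2) (vx ld k)); first by rewrite /seg vxK in Jk.
  have := congr1 (be1 (vx ld k)) (ev_exp tt2 (vx ld k) (b1 (vx ld k))).
  rewrite (be_out tt2 _ nJ) ksc0 (be0 tt1) (be_ev tt1) eqxx (thin_dual tt1) eqxx Ik => /eqP.
  by rewrite oner_eq0.
have s1 := sub t u _ _ _ _ tM tM'; have s2 := sub u t _ _ _ _ tM' tM.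
have lt := lo_lt_hi t; have lu := lo_lt_hi u.
have a1 := s1 (lo t); have a2 := s1 (hi t).-1; have a3 := s2 (lo u); have a4 := s2 (hi u).-1.
apply: chord_eqP; apply: val_inj => /=; lia.
Qed.

Lemma segm_ex t : exists M : fgmod L, segm M t.
Proof.
have T := @thin_mod_thin K Q (seg ld (lo t) (hi t)).
exists (FgMod (thin_fg T)); exists (@thin_b K Q (seg ld (lo t) (hi t))), (@thin_be K Q _).
exact: T.
Qed.

Lemma hom_cond_refl (t : chord n) : hom_cond n (low ld) (lo t) (hi t) (lo t) (hi t).
Proof.
rewrite (hom_condE (low0 ld) (lown ld)) ?lo_lt_hi ?hi_le // !eqxx.
by rewrite maxnn minnn lo_lt_hi.
Qed.

(** The endomorphisms are scalars, so a projection to a direct summand is 0 or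
invertible. There is no self-extension because Hom is already non-zero. *)
Lemma segm_exceptional (M : fgmod L) t : segm M t -> exceptional M.
Proof.
case=> [b [be tM]]; have hP := hom_cond_refl t.
have lt := lo_lt_hi t; have le := hi_le t.
pose v0 := vx ld (lo t).
have v0E : vi ld v0 = lo t by rewrite /v0 vxK //; lia.
have Iv0 : seg ld (lo t) (hi t) v0 by rewrite /seg v0E leqnn lt.
split; last first.
  move=> co cco; have [] // := lam_eq0 le le tM tM (@linear_zero K Q M M) cco _.
  by rewrite /lam /lam0 hP /hc (be0 tM).
split.
  exists (b v0); apply/eqP => e; have := thin_dual tM v0 v0; rewrite e (be0 tM) eqxx Iv0.
  by move/esym/eqP; rewrite oner_eq0.
move=> A B [F [g FK gK]].
(* The projection onto A commutes with L, so that it is a scalar. *)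
pose pr (m : M) : M := g ((F m).1, 0).
have gl (z : L) x y : g (z *: x + y) = z *: g x + g y.
  by apply: (can_inj FK); rewrite linearP !gK.
have lpr : linear pr.
  move=> z x y; rewrite /pr linearP -gl; congr g.
  by apply: injective_projections; rewrite /= ?scaler0 ?addr0.
have prE : forall m, pr m = hc b be pr v0 *k m.
  move=> m; rewrite (hc_exp tM tM lpr) [in RHS](thin_exp tM m) ksc_sumr; apply: eq_bigr => v _.
  rewrite kscA; have [Iv|nI] := boolP (seg ld (lo t) (hi t) v); last by rewrite (be_out tM _ nI) mul0r mulr0.
  by rewrite (hc_const le le tM tM lpr (v := v)) ?maxnn ?minnn // mulrC.
have gF0 (x : A * B) : g x = 0 -> x = 0 by move=> e; rewrite -(gK x) e linear0.
have g0 : g 0 = 0 by rewrite -(linear0 F) FK.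
have ksc_mod (X : lmodType L) s (y : X) : s *k y = 0 -> s = 0 \/ y = 0.
  move=> e; have [->|ns] := eqVneq s 0; [by left|right].
  by rewrite -(ksc1 y) -(mulVf ns) -kscA e ksc0r.
have [s0|ns0] := eqVneq (hc b be pr v0) 0.
  left => a; have := prE (g (a, 0)); rewrite /pr gK s0 ksc0 => /gF0.
  by case.
right => bb; have := prE (g (0, bb)); rewrite /pr gK /= g0 => /esym /ksc_mod [e|/gF0[]//].
by rewrite e eqxx in ns0.
Qed.
End Circ.

(** * Coordinates on the Yoneda algebra *)

Section CocycleOps.
Variables (K : fieldType) (Q : quiver).
Local Notation L := (path_algebra K Q).

Lemma coc_add (M N : lmodType L) (c d : L -> M -> N) : cocycle c -> cocycle d ->
  cocycle (fun a m => c a m + d a m).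
Proof.
have add4 (V : zmodType) (x y z t : V) : x + y + (z + t) = (x + z) + (y + t) by rewrite addrACA.
move=> cc cd; split=> [a s x y|s a b x|a b x].
- rewrite -(kscE s x) -(kscE s (_ + _)) (klinP (coc_klin cc a)) (klinP (coc_klin cd a)) kscDr.
  exact: add4.
- rewrite -(kscE s (_ + _)) (cocDl cc) (cocDl cd) (cocZl cc) (cocZl cd) kscDr; exact: add4.
- rewrite (cocM cc) (cocM cd) scalerDr; exact: add4.
Qed.

Lemma coc_scale (M N : lmodType L) (c : L -> M -> N) s : cocycle c ->
  cocycle (fun a m => s *k c a m).
Proof.
move=> cc; split=> [a t x y|t a b x|a b x].
- by rewrite -(kscE t x) -(kscE t (s *k c a x)) (klinP (coc_klin cc a)) kscDr !kscA mulrC.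
- by rewrite -(kscE t (s *k c a x)) (cocDl cc) (cocZl cc) kscDr !kscA mulrC.
- by rewrite (cocM cc) kscDr kscC.
Qed.

Lemma coc_push (M N P : lmodType L) (c : L -> M -> N) (g : N -> P) : cocycle c -> linear g ->
  cocycle (fun a m => g (c a m)).
Proof.
move=> cc lg; have kg := linear_klin lg; split=> [a t x y|t a b x|a b x].
- by rewrite -(kscE t x) -(kscE t (g (c a x))) (klinP (coc_klin cc a)) (klinP kg).
- by rewrite -(kscE t (g (c a x))) (cocDl cc) (cocZl cc) (klinP kg).
- by rewrite (cocM cc) (klinD kg) (linear_addZ lg).
Qed.

Lemma coc_pull (M N P : lmodType L) (c : L -> N -> P) (f : M -> N) : cocycle c -> linear f ->
  cocycle (fun a m => c a (f m)).
Proof.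
move=> cc lf; have kf := linear_klin lf; split=> [a t x y|t a b x|a b x].
- by rewrite -(kscE t x) -(kscE t (c a (f x))) (klinP kf) (klinP (coc_klin cc a)).
- by rewrite -(kscE t (c a (f x))) (cocDl cc) (cocZl cc).
- by rewrite (cocM cc) (linear_addZ lf).
Qed.

Lemma coc_sum (M N : lmodType L) (J : Type) (r : seq J) (c : J -> L -> M -> N) :
  (forall j, cocycle (c j)) -> cocycle (fun a m => \sum_(j <- r) c j a m).
Proof.
move=> h; elim: r => [|j r IH].
  have -> : (fun a m => \sum_(j <- [::]) c j a m) = (fun (_ : L) (_ : M) => 0 : N).
    by apply/funext => a; apply/funext => m; rewrite big_nil.
  exact: cocycle_0.
have -> : (fun a m => \sum_(i <- j :: r) c i a m) = (fun a m => c j a m + \sum_(i <- r) c i a m).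
  by apply/funext => a; apply/funext => m; rewrite big_cons.
exact: coc_add.
Qed.
End CocycleOps.

Section YonedaClosed.
Variables (K : fieldType) (Q : quiver) (I : finType).
Local Notation L := (path_algebra K Q).
Variable E : I -> fgmod L.
Implicit Types x y : yoneda E.

Lemma yelt_zero : yelt (yzero E).
Proof. by move=> i j; split; [apply: linear_zero|apply: cocycle_0]. Qed.

Lemma yelt_add x y : yelt x -> yelt y -> yelt (yadd x y).
Proof.
move=> ex ey i j; have [lx cx] := ex i j; have [ly cy] := ey i j; split; last exact: coc_add.
by move=> z m m'; rewrite /= lx ly scalerDr addrACA.
Qed.

Lemma yscaleE s x i j : yscale s x i j = (fun m => s *k (x i j).1 m, fun a m => s *k (x i j).2 a m).
Proof.
by congr (_, _); apply/funext => m; [rewrite kscE|apply/funext => m'; rewrite kscE].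
Qed.

Lemma yelt_scale s x : yelt x -> yelt (yscale s x).
Proof.
move=> ex i j; have [lx cx] := ex i j; rewrite yscaleE; split; last exact: coc_scale.
by move=> z m m' /=; rewrite lx kscDr kscC.
Qed.

Lemma yelt_mul x y : yelt x -> yelt y -> yelt (ymul x y).
Proof.
move=> ex ey i k; split.
  move=> z m m'; rewrite /= scaler_sumr -big_split; apply: eq_bigr => j _ /=.
  by rewrite (proj1 (ey i j)) (proj1 (ex j k)).
apply: coc_sum => j; have [lx cx] := ex j k; have [ly cy] := ey i j.
by apply: coc_add; [apply: coc_push|apply: coc_pull].
Qed.

Lemma yelt_sum (J : Type) (r : seq J) (P : pred J) (F : J -> yoneda E) :
  (forall t, P t -> yelt (F t)) -> yelt (\big[@yadd K _ I E/yzero E]_(t <- r | P t) F t).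
Proof.
move=> h; elim/big_ind: _ => //; first exact: yelt_zero.
by move=> x y; apply: yelt_add.
Qed.

Lemma yidemE v i j (m : E i) : (yidem E v i j).1 m =
  if i =P j is ReflectT ij then if i == v then ecast l (E l) ij m else 0 else 0.
Proof. by []. Qed.

Lemma yidem_diag v i (m : E i) : (yidem E v i i).1 m = if i == v then m else 0.
Proof. by rewrite yidemE; case: eqP => // ij; rewrite (eq_axiomK ij). Qed.

Lemma yidem_off v i j (m : E i) : i != j -> (yidem E v i j).1 m = 0.
Proof. by rewrite yidemE; case: eqP. Qed.

Lemma yelt_idem v : yelt (yidem E v).
Proof.
move=> i j; split; last exact: cocycle_0.
have [<-|ne] := eqVneq i j => z m m'; last by rewrite !yidem_off // scaler0 addr0.
by rewrite !yidem_diag; case: ifP => _; rewrite // scaler0 addr0.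
Qed.
End YonedaClosed.

Section YonedaLambda.
Variables (K : fieldType) (n : nat) (Q : quiver) (ld : line_data n Q) (I : finType).
Local Notation L := (path_algebra K Q).
Variables (E : I -> fgmod L) (f : I -> chord n).
Unset Implicit Arguments.
Variables (b : forall i, Q -> E i) (be : forall i, Q -> E i -> K).
Set Implicit Arguments.
Hypothesis tE : forall i, thin (seg ld (lo (f i)) (hi (f i))) (b i) (be i).
Hypothesis ef : exc_fam (fun i => circ ld (f i)).
Implicit Types x y : yoneda E.

Definition relI (i j : I) : bool := related (circ ld (f i)) (circ ld (f j)).

Definition lamc (i j : I) (u : E i -> E j) (co : L -> E i -> E j) : K :=
  lam ld (lo (f i)) (hi (f i)) (lo (f j)) (hi (f j)) (b i) (be j) u co.

(** The coordinates turn the Yoneda algebra into matrices supported on the related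
pairs: equality of classes is equality of coordinates ([Lam_eq]), all such
matrices occur ([Lam_surj]), and the product is that of matrices, with the
entries at unrelated pairs put to zero ([Lam_mul]). *)
Definition Lam x (i j : I) : K := lamc (x i j).1 (x i j).2.

Lemma lamc_lin i j s (u u' : E i -> E j) co co' :
  lamc (fun m => s *k u m + u' m) (fun z m => s *k co z m + co' z m) = s * lamc u co + lamc u' co'.
Proof. exact: lam_lin (tE j) _ _ _ _ _. Qed.

Lemma lamc_add i j (u u' : E i -> E j) co co' :
  lamc (fun m => u m + u' m) (fun z m => co z m + co' z m) = lamc u co + lamc u' co'.
Proof.
rewrite -[lamc u co]mul1r -lamc_lin; congr lamc; apply/funext => m; first by rewrite ksc1.
by apply/funext => z; rewrite ksc1.
Qed.

Lemma lamc_0 i j : lamc (fun _ : E i => 0 : E j) (fun _ _ => 0) = 0.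
Proof.
apply: (addrI (lamc (fun _ : E i => 0 : E j) (fun _ _ => 0))); rewrite addr0 -lamc_add.
by congr lamc; apply/funext => m; [rewrite addr0|apply/funext => z; rewrite addr0].
Qed.

Lemma lamc_sum i j (J : Type) (r : seq J) (u : J -> E i -> E j) co :
  lamc (fun m => \sum_(t <- r) u t m) (fun z m => \sum_(t <- r) co t z m) =
  \sum_(t <- r) lamc (u t) (co t).
Proof.
elim: r => [|t r IH].
  rewrite big_nil -[RHS](lamc_0 i j).
  by congr lamc; apply/funext => m; [|apply/funext => z]; rewrite big_nil.
rewrite big_cons -IH -lamc_add.
by congr lamc; apply/funext => m; [|apply/funext => z]; rewrite big_cons.
Qed.

Lemma lamc_rel i j u co : ~~ relI i j -> lamc (i := i) (j := j) u co = 0.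
Proof. by rewrite /relI -HEc_circ => nr; apply: lam0_nHE. Qed.

Lemma Lam_rel x i j : ~~ relI i j -> Lam x i j = 0.
Proof. exact: lamc_rel. Qed.

Lemma Lam_zero i j : Lam (yzero E) i j = 0. Proof. exact: lamc_0. Qed.

Lemma Lam_add x y i j : Lam (yadd x y) i j = Lam x i j + Lam y i j.
Proof. exact: lamc_add. Qed.

Lemma Lam_scale s x i j : Lam (yscale s x) i j = s * Lam x i j.
Proof.
rewrite /Lam yscaleE -[RHS]addr0 -(lamc_0 i j) -lamc_lin.
by congr lamc; apply/funext => m; [|apply/funext => z]; rewrite /= addr0.
Qed.

Lemma Lam_sub x y i j : Lam (ysub x y) i j = Lam x i j - Lam y i j.
Proof. by rewrite Lam_add Lam_scale mulN1r. Qed.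

Lemma Lam_sum (J : Type) (r : seq J) (P : pred J) (F : J -> yoneda E) i j :
  Lam (\big[@yadd K _ I E/yzero E]_(t <- r | P t) F t) i j = \sum_(t <- r | P t) Lam (F t) i j.
Proof.
elim/big_ind2: _ => //; first exact: Lam_zero.
by move=> x1 x2 y1 y2 <- <-; rewrite Lam_add.
Qed.

Lemma lamc_eq0 i j (u : E i -> E j) co : linear u -> cocycle co ->
  lamc u co = 0 <-> (forall m, u m = 0) /\ coboundary co.
Proof.
move=> lu cco; split; first by apply: lam_eq0; rewrite ?hi_le.
by case=> u0 bco; apply: lam_zero; rewrite ?hi_le.
Qed.

Lemma Lam_eq x y : yelt x -> yelt y -> yeq x y <-> forall i j, Lam x i j = Lam y i j.
Proof.
move=> ex ey.
have H i j : ((x i j).1 =1 (y i j).1 /\ coboundary (fun a m => (x i j).2 a m - (y i j).2 a m)) <->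
    Lam x i j = Lam y i j.
  have [lx cx] := ex i j; have [ly cy] := ey i j.
  have ld' : linear (fun m => (x i j).1 m - (y i j).1 m).
    by move=> z m m'; rewrite lx ly scalerBr opprD addrACA.
  have := lamc_eq0 ld' (coc_sub cx cy).
  have -> : lamc (fun m => (x i j).1 m - (y i j).1 m) (fun a m => (x i j).2 a m - (y i j).2 a m) =
      Lam x i j - Lam y i j.
    rewrite addrC -mulN1r /Lam -lamc_lin.
    by congr lamc; apply/funext => m; [|apply/funext => z]; rewrite kscNl ksc1 addrC.
  case=> h1 h2; split=> [[e1 e2]|e].
    by apply/eqP; rewrite -subr_eq0; apply/eqP/h2; split=> // m; rewrite e1 subrr.
  have [|h3 h4] := h1; first by rewrite e subrr.
  by split=> // m; apply/eqP; rewrite -subr_eq0 h3.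
by split=> h i j; have /H := h i j.
Qed.

Lemma Lam_idem v i j : Lam (yidem E v) i j = ((i == v) && (j == v))%:R.
Proof.
have [<-|ne] := eqVneq i j; last first.
  rewrite -[LHS]/(lamc _ _).
  have -> : (yidem E v i j).1 = (fun _ => 0) by apply/funext => m; rewrite yidem_off.
  rewrite [LHS]lamc_0; case: eqP => // <-; by rewrite eq_sym (negPf ne).
rewrite andbb /Lam /lamc /lam /lam0 hom_cond_refl /hc yidem_diag.
have lt := lo_lt_hi (f i); have le := hi_le (f i).
case: eqP => _; last by rewrite (be0 (tE i)).
by rewrite (thin_dual (tE i)) eqxx /seg vxK maxnn ?leqnn ?lt //; lia.
Qed.

Lemma Lam_one i j : Lam (yone E) i j = (i == j)%:R.
Proof.
rewrite /yone Lam_sum; under eq_bigr do rewrite Lam_idem.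
rewrite (bigD1 i) //= eqxx big1 ?addr0 => [|v nv]; first by rewrite eq_sym.
by rewrite eq_sym (negPf nv).
Qed.

Lemma relI_refl i : relI i i. Proof. exact: related_refl. Qed.
Lemma relI_anti i j : relI i j -> relI j i -> i = j. Proof. exact: (R_anti ef). Qed.

(** Three pairwise related chords of an exceptional family pass through one point, by
[fam_triangle]; so the three intervals share an end, as [lam_prod] requires. *)
Lemma relI_common i j k : relI i j -> relI j k -> relI i k ->
  exists p : 'I_n.+1, [/\ ends p (lo (f i)) (hi (f i)), ends p (lo (f j)) (hi (f j)) &
                          ends p (lo (f k)) (hi (f k))].
Proof.
move=> rij rjk rik.
suff [q /and3P[qi qj qk]] : exists q, [&& inc q (circ ld (f i)), inc q (circ ld (f j)) & inc q (circ ld (f k))].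
  exists ((gpos ld)^-1 q)%g.
  have e : pos ld ((gpos ld)^-1 q)%g = q by rewrite -[pos ld _](permE (@pos_inj n Q ld)) permKV.
  by split; rewrite (ends_circ ld) e.
have m1 := R_meet ef rij; have m2 := R_meet ef rjk; have m3 := R_meet ef rik.
have [e|nij] := eqVneq i j.
  by have /existsP[q /andP[q1 q2]] := m2; exists q; rewrite e q1 q2.
have [e|njk] := eqVneq j k.
  by have /existsP[q /andP[q1 q2]] := m1; exists q; rewrite -e q1 q2.
have [e|nik] := eqVneq i k.
  by rewrite -e in rjk; have ee := relI_anti rij rjk; rewrite ee eqxx in nij.
have [q /and3P[q1 q2 q3]] := fam_triangle ef nij nik njk m1 m3 m2.
by exists q; rewrite q1 q2 q3.
Qed.

Lemma Lam_mul x y i k : yelt x -> yelt y ->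
  Lam (ymul x y) i k = (relI i k)%:R * \sum_j Lam x j k * Lam y i j.
Proof.
move=> ex ey; have [rik|nr] := boolP (relI i k); last by rewrite Lam_rel // mul0r.
rewrite mul1r -[LHS]/(lamc _ _) [LHS]lamc_sum; apply: eq_bigr => j _.
have [lx cx] := ex j k; have [ly cy] := ey i j.
have lxy : linear (fun m => (x j k).1 ((y i j).1 m)) by move=> z m m'; rewrite ly lx.
have cxy : cocycle (fun a m => (x j k).1 ((y i j).2 a m) + (x j k).2 a ((y i j).1 m)).
  by apply: coc_add; [apply: coc_push|apply: coc_pull].
have [rij|nij] := boolP (relI i j); last first.
  have y0 := Lam_rel y nij; rewrite y0 mulr0; apply/(lamc_eq0 lxy cxy).
  have [u0 [h kh ch]] := proj1 (lamc_eq0 ly cy) y0.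
  split=> [m|]; first by rewrite u0 (linear_at0 lx).
  exists (fun m => (x j k).1 (h m)) => [s m m'|a m].
    by rewrite -(kscE s m) -(kscE s ((x j k).1 (h m))) (klinP kh) (klinP (linear_klin lx)).
  rewrite u0 (klin0 (coc_klin cx a)) addr0 ch.
  have kx := linear_klin lx.
  by rewrite (klinD kx) -[- h _](scaleN1r) !(linear_addZ lx) scaleN1r.
have [rjk|njk] := boolP (relI j k); last first.
  have x0 := Lam_rel x njk; rewrite x0 mul0r; apply/(lamc_eq0 lxy cxy).
  have [u0 [h kh ch]] := proj1 (lamc_eq0 lx cx) x0.
  split=> [m|]; first by rewrite u0.
  exists (fun m => h ((y i j).1 m)) => [s m m'|a m].
    by rewrite -(kscE s m) -(kscE s (h _)) (klinP (linear_klin ly)) (klinP kh).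
  by rewrite u0 add0r ch (linear_addZ ly).
have [p [pi pj pk]] := relI_common rij rjk rik.
move: (rij) (rjk); rewrite /relI -!HEc_circ => hij hjk.
exact: (lam_prod (lo_lt_hi _) (hi_le _) (lo_lt_hi _) (hi_le _) (lo_lt_hi _) (hi_le _)
  (tE i) (tE j) (tE k) ly cy lx cx pi pj pk hij hjk).
Qed.

Lemma Lam_surj (s : I -> I -> K) :
  exists x, yelt x /\ forall i j, Lam x i j = (relI i j)%:R * s i j.
Proof.
have ex1 (ij : I * I) : exists uc : (E ij.1 -> E ij.2) * (L -> E ij.1 -> E ij.2),
    [/\ linear uc.1, cocycle uc.2 & lamc uc.1 uc.2 = (relI ij.1 ij.2)%:R].
  case: ij => i j /=; have [r|nr] := boolP (relI i j); last first.
    exists (fun=> 0, fun _ _ => 0); split; [exact: linear_zero|exact: cocycle_0|exact: lamc_0].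
  move: (r); rewrite /relI -HEc_circ => he.
  have [u [co [lu cco l1]]] := lam_surj (hi_le (f i)) (hi_le (f j)) (tE i) (tE j) he.
  by exists (u, co).
pose g ij := projT1 (cid (ex1 ij)).
have gP ij := projT2 (cid (ex1 ij)).
pose x : yoneda E := fun i j => (fun m => s i j *k (g (i, j)).1 m, fun a m => s i j *k (g (i, j)).2 a m).
exists x; split=> i j; have [l1 c1 e1] := gP (i, j).
  split; last exact: coc_scale.
  by move=> z m m'; rewrite /= (l1 z m m') kscDr kscC.
rewrite -[LHS]/(lamc _ _) -[RHS]addr0 -(lamc_0 i j) [X in X + _]mulrC -e1 -lamc_lin.
by congr lamc; apply/funext => m; [|apply/funext => z]; rewrite /= addr0.
Qed.
End YonedaLambda.

(** * The radical of the Yoneda algebra *)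

Section Radical.
Variables (K : fieldType) (n : nat) (Q : quiver) (ld : line_data n Q) (I : finType).
Local Notation L := (path_algebra K Q).
Variables (E : I -> fgmod L) (f : I -> chord n).
Unset Implicit Arguments.
Variables (b : forall i, Q -> E i) (be : forall i, Q -> E i -> K).
Set Implicit Arguments.
Hypothesis tE : forall i, thin (seg ld (lo (f i)) (hi (f i))) (b i) (be i).
Hypothesis ef : exc_fam (fun i => circ ld (f i)).
Local Notation Lm := (Lam ld f b be).
Local Notation R := (relI ld f).
Local Notation cov := (covers (fun i => circ ld (f i))).
Implicit Types x y : yoneda E.

Lemma Lam_mul_diag x y i : yelt x -> yelt y -> Lm (ymul x y) i i = Lm x i i * Lm y i i.
Proof.
move=> ex ey; rewrite (Lam_mul tE ef) // relI_refl mul1r (bigD1 i) //= big1 ?addr0 // => j nj.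
have [rij|nij] := boolP (R i j); last by rewrite (Lam_rel _ _ y nij) mulr0.
have [rji|nji] := boolP (R j i); last by rewrite (Lam_rel _ _ x nji) mul0r.
by have e := relI_anti ef rij rji; rewrite e eqxx in nj.
Qed.

(** With respect to an exceptional ordering the matrix of y is unitriangular, so the
equation c y = 1 can be solved by back substitution. Iterating the substitution n
times suffices, because a row is stable after as many steps as there are rows
from it to the last. *)
Lemma left_inverse_exists y : yelt y -> (forall i, Lm y i i = 1) ->
  exists c, yelt c /\ yeq (ymul c y) (yone E).
Proof.
move=> ey y1; case: (ef) => s bs so; case: (bs) => s' sK s'K.
have rk i j : R i j -> i != j -> (s' i < s' j)%N.
  move=> r ne; have le : (s' i <= s' j)%N by apply: (R_order so); rewrite !s'K.
  by rewrite ltn_neqAle le andbT; apply: contra ne => /eqP/val_inj/(can_inj s'K)->.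
pose step (B : I -> I -> K) (i k : I) : K := (i == k)%:R - \sum_(j | j != i) (R j k)%:R * B j k * Lm y i j.
pose B m := iter m step (fun _ _ => 0).
have BS m i k : B m.+1 i k = (i == k)%:R - \sum_(j | j != i) (R j k)%:R * B m j k * Lm y i j by [].
clearbody B.
have stab m i k : (n - s' i <= m)%N -> B m.+1 i k = B m i k.
  elim: m i k => [|m IH] i k le; first by have := ltn_ord (s' i); lia.
  rewrite [LHS]BS [RHS]BS; congr (_ - _); apply: eq_bigr => j nj.
  have [rij|nij] := boolP (R i j); last by rewrite (Lam_rel _ _ y nij) !mulr0.
  rewrite IH //.
  by have := rk i j rij; rewrite eq_sym nj => /(_ isT); lia.
have [c [ec cE]] := Lam_surj tE (fun j k => B n j k).
have eone : yelt (yone E) by apply: yelt_sum => v _; apply: yelt_idem.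
exists c; split=> //; apply/(Lam_eq tE (yelt_mul ec ey) eone) => i k.
rewrite (Lam_mul tE ef) // (Lam_one tE).
have [rik|nik] := boolP (R i k); last first.
  by rewrite mul0r; case: eqP => // e; rewrite e relI_refl in nik.
rewrite mul1r (bigD1 i) //= y1 mulr1 cE rik mul1r -stab ?leq_subr //.
rewrite BS -addrA [X in _ + X](_ : _ = 0) ?addr0 //.
apply/eqP; rewrite addrC subr_eq0; apply/eqP; apply: eq_bigr => j nj.
by rewrite cE.
Qed.

Lemma yelt_one : yelt (yone E).
Proof. by apply: yelt_sum => v _; apply: yelt_idem. Qed.

Lemma yelt_sub x y : yelt x -> yelt y -> yelt (ysub x y).
Proof. by move=> ex ey; apply: yelt_add => //; apply: yelt_scale. Qed.

(** The radical is the part off the diagonal: there 1 - a x is unitriangular, hence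
invertible, and a non-zero diagonal entry is invertible. *)
Lemma yradP x : yrad x <-> yelt x /\ forall i, Lm x i i = 0.
Proof.
split=> [[ex h]|[ex h]]; split=> //.
  move=> i; apply/eqP/negPn/negP => nz.
  pose a := yscale (Lm x i i)^-1 (yidem E i).
  have ea : yelt a by apply/yelt_scale/yelt_idem.
  have [c [ec ce]] := h a ea.
  have eax := yelt_mul ea ex; have e1 := yelt_sub yelt_one eax.
  have := proj1 (Lam_eq tE (yelt_mul ec e1) yelt_one) ce i i.
  rewrite Lam_mul_diag // (Lam_sub tE) Lam_mul_diag // (Lam_one tE) eqxx.
  rewrite (Lam_scale tE) (Lam_idem tE) eqxx mulr1 mulVf // subrr mulr0 => /esym/eqP.
  by rewrite oner_eq0.
move=> a ea; have eax := yelt_mul ea ex; have e1 := yelt_sub yelt_one eax.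
apply: left_inverse_exists => // i.
by rewrite (Lam_sub tE) Lam_mul_diag // (Lam_one tE) eqxx h mulr0 subr0.
Qed.

(** A product of two elements off the diagonal has an entry at (i, k) only if some j
is strictly between i and k; and if there is one, the basis element at (i, k) is
such a product. *)
Lemma yrad2P x : yrad2 x <-> yelt x /\ forall i j, (i == j) || cov i j -> Lm x i j = 0.
Proof.
split=> [[ex [r [u [v [uv xe]]]]]|[ex h]].
  split=> // i k ik.
  have eu t : yelt (u t) by case: (uv t) => /yradP[].
  have evt t : yelt (v t) by case: (uv t) => _ /yradP[].
  have es : yelt (\big[@yadd K _ I E/yzero E]_t ymul (u t) (v t)).
    by apply: yelt_sum => t _; apply: yelt_mul.
  rewrite (proj1 (Lam_eq tE ex es) xe) (Lam_sum tE) big1 // => t _.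
  have [/yradP[_ u0] /yradP[_ v0]] := uv t.
  case/orP: ik => [/eqP<-|ik]; first by rewrite Lam_mul_diag // u0 mul0r.
  rewrite (Lam_mul tE ef) // big1 ?mulr0 // => j _.
  have [->|nji] := eqVneq j i; first by rewrite v0 mulr0.
  have [->|njk] := eqVneq j k; first by rewrite u0 mul0r.
  have [rij|nij] := boolP (R i j); last by rewrite (Lam_rel _ _ (v t) nij) mulr0.
  have [rjk|njk'] := boolP (R j k); last by rewrite (Lam_rel _ _ (u t) njk') mul0r.
  case/and3P: ik => _ _ /forallP/(_ j).
  by rewrite nji njk -!/(R _ _) rij rjk.
split=> //.
have mid (ij : I * I) : exists uv : yoneda E * yoneda E, [/\ yrad uv.1, yrad uv.2 &
    forall a c, Lm (ymul uv.1 uv.2) a c = ((a == ij.1) && (c == ij.2))%:R * Lm x a c].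
  case: ij => i k /=.
  have [ik|nik] := boolP ((i == k) || cov i k || ~~ R i k).
    exists (yzero E, yzero E); have yr : yrad (yzero E).
      by apply/yradP; split; [apply: yelt_zero|move=> j; rewrite (Lam_zero tE)].
    split=> // a c /=; rewrite (Lam_mul tE ef); try exact: yelt_zero.
    rewrite big1 ?mulr0 => [|j _]; last by rewrite (Lam_zero tE) mul0r.
    case: andP => [[/eqP-> /eqP->]|_]; rewrite ?mul0r // mul1r.
    by case/orP: ik => [/h->|/(Lam_rel _ _ x)->].
  case/norP: nik => /norP[nik ncov] /negPn rik.
  have [j [nji njk rij rjk]] : exists j, [/\ j != i, j != k, R i j & R j k].
    move: ncov; rewrite /covers nik -/(R i k) rik /= negb_forall => /existsP[j /negPn/and4P[? ? ? ?]].
    by exists j.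
  have [u [eu uE]] := Lam_surj tE (fun a c => ((a == j) && (c == k))%:R).
  have [v [ev vE]] := Lam_surj tE (fun a c => ((a == i) && (c == j))%:R * Lm x i k).
  exists (u, v); split=> /=.
  - apply/yradP; split=> // a; rewrite uE; case: eqP => [->|_]; last by rewrite mulr0.
    by rewrite (negPf njk) mulr0.
  - apply/yradP; split=> // a; rewrite vE; case: eqP => [->|_]; last by rewrite mul0r mulr0.
    by rewrite [i == j]eq_sym (negPf nji) mul0r mulr0.
  - move=> a c; rewrite (Lam_mul tE ef) // (bigD1 j) //= big1 => [|l nl]; last first.
      by rewrite uE (negPf nl) mulr0 mul0r.
    rewrite uE vE eqxx andbT addr0 /=.
    case: (a =P i) => [->|_]; last by rewrite !(mul0r, mulr0).
    case: (c =P k) => [->|_]; last by rewrite !(mul0r, mulr0).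
    by rewrite rik rij rjk !mul1r.
pose uv (t : 'I_#|{: I * I}|) := projT1 (cid (mid (enum_val t))).
have uvP (t : 'I_#|{: I * I}|) := projT2 (cid (mid (enum_val t))).
exists #|{: I * I}|, (fun t => (uv t).1), (fun t => (uv t).2).
split; first by move=> t; have [] := uvP t.
have es : yelt (\big[@yadd K _ I E/yzero E]_t ymul (uv t).1 (uv t).2).
  apply: yelt_sum => t _; have [/yradP[h1 _] /yradP[h2 _] _] := uvP t.
  exact: yelt_mul.
apply/(Lam_eq tE ex es) => i k; rewrite (Lam_sum tE).
rewrite (bigD1 (enum_rank (i, k))) //= big1 => [|t nt]; last first.
  have [_ _ ->] := uvP t; case: andP => [[/eqP e1 /eqP e2]|_]; last by rewrite mul0r.
  by case/eqP: nt; rewrite e1 e2 -surjective_pairing enum_valK.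
have [_ _ ->] := uvP (enum_rank (i, k)); rewrite enum_rankK /= !eqxx mul1r addr0 //.
Qed.

Lemma ycomponentP i j x : ycomponent i j x <->
  yelt x /\ forall u v, ~~ ((u == i) && (v == j)) -> Lm x u v = 0.
Proof.
have Lc u v : yelt x -> Lm (ymul (yidem E j) (ymul x (yidem E i))) u v = ((u == i) && (v == j))%:R * Lm x u v.
  move=> ex; rewrite (Lam_mul tE ef); [|exact: yelt_idem|exact: yelt_mul ex (yelt_idem E i)].
  rewrite (bigD1 v) //= big1 => [|l nl]; last first.
    have nlv : (l == j) && (v == j) = false.
      by apply/negP => /andP[/eqP e1 /eqP e2]; rewrite e1 e2 eqxx in nl.
    by rewrite (Lam_idem tE) nlv mul0r.
  rewrite (Lam_idem tE) andbb addr0 (Lam_mul tE ef) //; last exact: yelt_idem.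
  rewrite (bigD1 u) //= big1 => [|l nl]; last first.
    have nlu : (u == i) && (l == i) = false.
      by apply/negP => /andP[/eqP e1 /eqP e2]; rewrite e1 e2 eqxx in nl.
    by rewrite (Lam_idem tE) nlu mulr0.
  rewrite (Lam_idem tE) andbb addr0.
  have [r|nr] := boolP (R u v); last by rewrite (Lam_rel _ _ x nr) !(mul0r, mulr0).
  by case: (u == i); case: (v == j); rewrite ?(mul0r, mulr0, mul1r, mulr1).
have ec : yelt x -> yelt (ymul (yidem E j) (ymul x (yidem E i))).
  by move=> ex; apply: yelt_mul; [exact: yelt_idem|apply: yelt_mul => //; exact: yelt_idem].
split=> [[ex he]|[ex h]]; split=> //.
  by move=> u v /negPf nuv; rewrite (proj1 (Lam_eq tE ex (ec ex)) he) Lc // nuv mul0r.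
apply/(Lam_eq tE ex (ec ex)) => u v; rewrite Lc //.
by case: (boolP (_ && _)) => [_|/h->]; rewrite ?mul1r ?mulr0.
Qed.
End Radical.

(** * Presentations of the Yoneda algebra *)

Section PresentationTheory.
Variables (K : fieldType) (n : nat) (Q : quiver) (ld : line_data n Q) (G : quiver).
Local Notation L := (path_algebra K Q).
Variables (E : G -> fgmod L) (f : G -> chord n).
Unset Implicit Arguments.
Variables (b : forall i, Q -> E i) (be : forall i, Q -> E i -> K).
Set Implicit Arguments.
Hypothesis tE : forall i, thin (seg ld (lo (f i)) (hi (f i))) (b i) (be i).
Hypothesis ef : exc_fam (fun i => circ ld (f i)).
Variable x : arrow G -> yoneda E.
Local Notation Lm := (Lam ld f b be).
Local Notation R := (relI ld f).
Local Notation dr := (fun i => circ ld (f i)).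
Local Notation cov := (covers dr).

Lemma arrow_comb_Lam i j s u v : Lm (arrow_comb x i j s) u v =
  \sum_(a | (src a == i) && (tgt a == j)) s a * Lm (x a) u v.
Proof. by rewrite /arrow_comb (Lam_sum tE); apply: eq_bigr => a _; rewrite (Lam_scale tE). Qed.

Hypothesis ex : forall a, yelt (x a).

Lemma arrow_comb_yelt i j s : yelt (arrow_comb x i j s).
Proof. by apply: yelt_sum => a _; apply: yelt_scale. Qed.

Hypothesis xsupp : forall a u v, ~~ ((u == src a) && (v == tgt a)) -> Lm (x a) u v = 0.

Lemma path_eval_yelt p : yelt (path_eval x p).
Proof.
rewrite /path_eval; elim/last_ind: (qarrows p) => [|s a IH] /=; first exact: yelt_idem.
by rewrite foldl_rcons; apply: yelt_mul.
Qed.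

Lemma path_eval_rcons (v : G) s a (w : walk v (rcons s a)) (w' : walk v s) :
  path_eval x (QPath (qpath_val := (v, rcons s a)) w) =
  ymul (x a) (path_eval x (QPath (qpath_val := (v, s)) w')).
Proof. by rewrite /path_eval /qarrows /qstart /= foldl_rcons. Qed.

Lemma path_eval_off p u v : ~~ ((u == qstart p) && (v == qend p)) -> Lm (path_eval x p) u v = 0.
Proof.
case: p => [[y s] w]; elim/last_ind: s w v => [|s a IH] w v.
  by rewrite /path_eval /= (Lam_idem tE) /qend /qstart /= => /negPf->.
have [w' e _] := good_rcons dr w.
rewrite (path_eval_rcons w w') /qend /qstart /= /walk_end map_rcons last_rcons => nuv.
rewrite (Lam_mul tE ef) //; last exact: path_eval_yelt.
rewrite big1 ?mulr0 // => l _.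
have [/andP[/eqP el /eqP ev]|nlv] := boolP ((l == src a) && (v == tgt a)); last by rewrite xsupp // mul0r.
rewrite IH ?mulr0 //; apply: contra nuv => /andP[-> _]; by rewrite ev eqxx.
Qed.

Hypothesis xnz : forall a, Lm (x a) (src a) (tgt a) != 0.

(** By [Lam_mul], each step of the path multiplies the value by a non-zero scalar, if
the start is related to the vertex reached, and by zero otherwise. *)
Lemma path_eval_good p : (Lm (path_eval x p) (qstart p) (qend p) != 0) = good dr p.
Proof.
case: p => [[y s] w]; elim/last_ind: s w => [|s a IH] w.
  by rewrite /path_eval /= (Lam_idem tE) /qend /qstart /= !eqxx oner_eq0 /good /= related_refl.
have [w' e ->] := good_rcons dr w; rewrite -IH (path_eval_rcons w w').
rewrite /qend /qstart /= /walk_end map_rcons last_rcons (Lam_mul tE ef) //; last exact: path_eval_yelt.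
rewrite (bigD1 (src a)) //= big1 => [|l nl]; last by rewrite xsupp ?mul0r // (negPf nl).
rewrite addr0 -/(walk_end y s) -e mulf_eq0 negb_or mulf_eq0 negb_or xnz /=.
rewrite -/(relI ld f y (tgt a)) andbC; congr (_ && _).
by case: (R y (tgt a)); rewrite ?oner_eq0 // eqxx.
Qed.

Lemma pa_eval_Lam z u v : Lm (pa_eval x z) u v = \sum_(p <- msupp z) z@_p * Lm (path_eval x p) u v.
Proof. by rewrite /pa_eval (Lam_sum tE); apply: eq_bigr => p _; rewrite (Lam_scale tE). Qed.

Lemma pa_eval_yelt z : yelt (pa_eval x z).
Proof. by apply: yelt_sum => p _; apply: yelt_scale; apply: path_eval_yelt. Qed.

(** Different good paths have different ends, so their values are multiples of
different basis elements. *)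
Lemma pa_eval_zero : draws dr -> forall z : path_algebra K G,
  yeq (pa_eval x z) (yzero E) <-> forall p, good dr p -> z@_p = 0.
Proof.
move=> dd z; split=> [H p gp|H].
  have := proj1 (Lam_eq tE (pa_eval_yelt z) (yelt_zero E)) H (qstart p) (qend p).
  rewrite pa_eval_Lam (Lam_zero tE).
  have [pz|npz] := boolP (p \in msupp z); last by rewrite mcoeff_outdom.
  rewrite (big_fsetD1 p) //= big1_fset => [|q]; last first.
    rewrite !inE => /andP[nqp _] _; apply/eqP; rewrite mulf_eq0; apply/orP; right; apply/eqP.
    have [/andP[/eqP e1 /eqP e2]|n2] := boolP ((qstart p == qstart q) && (qend p == qend q)); last exact: path_eval_off.
    apply/eqP/negPn/negP; rewrite e1 e2 path_eval_good => gq.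
    by rewrite (good_uniq dd gp gq e1 e2) eqxx in nqp.
  rewrite addr0 => /eqP; rewrite mulf_eq0 => /orP[/eqP//|].
  by have := path_eval_good p; rewrite gp => /negPf->.
apply/(Lam_eq tE (pa_eval_yelt z) (yelt_zero E)) => u v; rewrite pa_eval_Lam (Lam_zero tE).
rewrite big1 // => p _.
have [/andP[/eqP-> /eqP->]|n2] := boolP ((u == qstart p) && (v == qend p)); last by rewrite path_eval_off // mulr0.
have [gp|ngp] := boolP (good dr p); first by rewrite H // mul0r.
by move: ngp; rewrite -path_eval_good negbK => /eqP->; rewrite mulr0.
Qed.
End PresentationTheory.

Section Both.
Variables (K : fieldType) (n : nat) (Q : quiver) (ld : line_data n Q) (G : quiver).
Local Notation L := (path_algebra K Q).
Variables (E : G -> fgmod L) (f : G -> chord n).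
Unset Implicit Arguments.
Variables (b : forall i, Q -> E i) (be : forall i, Q -> E i -> K).
Set Implicit Arguments.
Hypothesis tE : forall i, thin (seg ld (lo (f i)) (hi (f i))) (b i) (be i).
Hypothesis ef : exc_fam (fun i => circ ld (f i)).
Local Notation Lm := (Lam ld f b be).
Local Notation R := (relI ld f).
Local Notation dr := (fun i => circ ld (f i)).
Local Notation cov := (covers dr).

(** By [yrad2P], rad / rad^2 has a basis indexed by the covering pairs, so the arrows
are these pairs. *)
Lemma arrow_lift_draws (x : arrow G -> yoneda E) : arrow_lift x ->
  [/\ draws dr, forall a, yelt (x a),
      forall a u v, ~~ ((u == src a) && (v == tgt a)) -> Lm (x a) u v = 0
    & forall a, Lm (x a) (src a) (tgt a) != 0].
Proof.
case=> xa basis.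
have ex a : yelt (x a) by case: (xa a) => /(ycomponentP tE ef)[].
have xs a u v : ~~ ((u == src a) && (v == tgt a)) -> Lm (x a) u v = 0.
  by case: (xa a) => /(ycomponentP tE ef)[_ h] _; apply: h.
(* A linear combination of parallel arrows whose coordinate vanishes lies in rad^2, so it is
   trivial. *)
have indep i j s : \sum_(a | (src a == i) && (tgt a == j)) s a * Lm (x a) i j = 0 ->
    forall a, src a = i -> tgt a = j -> s a = 0.
  move=> s0; apply: (proj1 (basis i j)); apply/(yrad2P tE ef); split; first exact: arrow_comb_yelt.
  move=> u v _; rewrite (arrow_comb_Lam tE).
  have [/andP[/eqP-> /eqP->]//|nuv] := boolP ((u == i) && (v == j)).
  by rewrite big1 // => a /andP[/eqP e1 /eqP e2]; rewrite xs ?mulr0 // e1 e2.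
have nz a : Lm (x a) (src a) (tgt a) != 0.
  apply/negP => /eqP e.
  have := indep (src a) (tgt a) (fun c => (c == a)%:R) _ a erefl erefl; rewrite eqxx => h.
  suff /eqP : (1 : K) = 0 by rewrite oner_eq0.
  apply: h; rewrite big1 // => c _; case: eqP => [->|_]; last by rewrite mul0r.
  by rewrite e mulr0.
have ca a : cov (src a) (tgt a).
  have rad0 : Lm (x a) (src a) (src a) = 0.
    by case: (xa a) => _ /(yradP tE ef)[_ ->].
  have nst : src a != tgt a by apply: contraNneq (nz a) => e; rewrite -e rad0.
  apply/negPn/negP => nc.
  have : yrad2 (arrow_comb x (src a) (tgt a) (fun c => (c == a)%:R)).
    apply/(yrad2P tE ef); split; first exact: arrow_comb_yelt.
    move=> u v uv; rewrite (arrow_comb_Lam tE).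
    have nuv : ~~ ((u == src a) && (v == tgt a)).
      apply/negP => /andP[/eqP e1 /eqP e2]; move: uv; rewrite e1 e2.
      by rewrite (negPf nst) (negPf nc).
    rewrite big1 // => c _; case: eqP => [->|_]; last by rewrite mul0r.
    by rewrite xs ?mulr0.
  move=> /(proj1 (basis _ _)) /(_ a erefl erefl) /eqP; rewrite eqxx oner_eq0 //.
split=> //; split=> //.
- move=> a c sac tac; apply/eqP/negPn/negP => nac.
  have := indep (src a) (tgt a)
    (fun d => if d == a then Lm (x c) (src a) (tgt a) else if d == c then - Lm (x a) (src a) (tgt a) else 0) _ a erefl erefl.
  rewrite eqxx => h; have := nz c; rewrite -sac -tac => /eqP; apply; apply: h.
  rewrite (bigD1 a) ?eqxx //= (bigD1 c) /=; last by rewrite sac tac !eqxx eq_sym.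
  rewrite eq_sym (negPf nac) eqxx big1 => [|d /andP[/andP[_ n1] n2]].
    by rewrite addr0 mulNr mulrC subrr.
  by rewrite (negPf n1) (negPf n2) mul0r.
- move=> i j cij; have [[/existsP[a /andP[/eqP sa /eqP ta]]]|none] := boolP [exists a, (src a == i) && (tgt a == j)].
    by exists a.
  have rij : R i j by case/and3P: cij.
  have nij : i != j by case/and3P: cij.
  have [y [ey yE]] := Lam_surj tE (fun u v => ((u == i) && (v == j))%:R).
  have cy : ycomponent i j y.
    by apply/(ycomponentP tE ef); split=> // u v /negPf nuv; rewrite yE nuv mulr0.
  have ry : yrad y.
    apply/(yradP tE ef); split=> // u; rewrite yE; case: eqP => [->|_]; last by rewrite mulr0.
    by rewrite (negPf nij) mulr0.
  have [s /(yrad2P tE ef)[_ /(_ i j)]] := proj2 (basis i j) y cy ry.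
  rewrite cij orbT (Lam_sub tE) yE rij !eqxx mul1r (arrow_comb_Lam tE) big_pred0 => [|a].
    by rewrite subr0 => /(_ isT)/eqP; rewrite oner_eq0.
  by apply/negbTE; move: none; rewrite negb_exists => /forallP/(_ a).
Qed.

Lemma draws_arrow_lift : draws dr -> exists x : arrow G -> yoneda E, arrow_lift x.
Proof.
move=> dd; case: (dd) => _ ca ua ea.
have ch a : exists y : yoneda E, yelt y /\ forall u v, Lm y u v = (R u v)%:R * ((u == src a) && (v == tgt a))%:R.
  exact: Lam_surj.
have [x xP] := choice ch; exists x.
have ex a : yelt (x a) by case: (xP a).
have xE a u v : Lm (x a) u v = ((u == src a) && (v == tgt a))%:R.
  case: (xP a) => _ ->; case: andP => [[/eqP-> /eqP->]|_]; last by rewrite mulr0.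
  have [r _] := arrow_rel dd a; by rewrite /relI r mul1r.
split=> [a|i j]; split.
- by apply/(ycomponentP tE ef); split=> // u v /negPf nuv; rewrite xE nuv.
- apply/(yradP tE ef); split=> // u; rewrite xE; case: eqP => [->|//].
  by have [_ /negPf->] := arrow_rel dd a.
- move=> s /(yrad2P tE ef)[_ h] a sa ta.
  have := h i j; rewrite -sa -ta ca orbT (arrow_comb_Lam tE) (bigD1 a) ?eqxx //= => /(_ isT).
  rewrite xE !eqxx mulr1 big1 ?addr0 // => c /andP[/andP[/eqP sc /eqP tc] nc].
  by rewrite (ua _ _ sc tc) eqxx in nc.
- move=> y /(ycomponentP tE ef)[ey ys] /(yradP tE ef)[_ y0].
  exists (fun=> Lm y i j); apply/(yrad2P tE ef); split.
    by apply: yelt_sub => //; apply: arrow_comb_yelt.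
  move=> u v uv; rewrite (Lam_sub tE) (arrow_comb_Lam tE).
  have [/andP[/eqP eu /eqP ev]|nuv] := boolP ((u == i) && (v == j)); last first.
    rewrite ys // big1 ?subrr // => a /andP[/eqP sa /eqP ta].
    by rewrite xE sa ta (negPf nuv) mulr0.
  rewrite eu ev in uv *; case/orP: uv => [/eqP e|/ea [a sa ta]].
    have z : Lm y i j = 0 by rewrite -e y0.
    by rewrite z sub0r big1 ?oppr0 // => a _; rewrite mul0r.
  rewrite (bigD1 a) ?sa ?ta ?eqxx //= xE sa ta !eqxx mulr1 big1 => [|c /andP[/andP[/eqP sc /eqP tc] nc]].
    by rewrite addr0 subrr.
  by rewrite (ua c a) ?sa ?ta ?eqxx // in nc.
Qed.
End Both.

(** * Splitting vectors and forms along a string of linear maps *)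

Section OneSided.
Variables (F : fieldType) (d : nat).

(** A linear system is solvable if the right-hand side satisfies all linear relations
between the rows. *)
Lemma solve_col m (A : 'M[F]_(m, d)) (be : 'cV[F]_m) :
  (forall u : 'rV_m, u *m A = 0 -> u *m be = 0) -> exists psi : 'cV_d, A *m psi = be.
Proof.
move=> h; exists (pinvmx A *m be).
have e : (A *m pinvmx A - 1%:M) *m A = 0 by rewrite mulmxBl mul1mx mulmxKpV // subrr.
apply/eqP; rewrite -subr_eq0 mulmxA -[X in _ - X]mul1mx -mulmxBl; apply/eqP/row_matrixP => i.
by rewrite row_mul row0; apply: h; rewrite -row_mul e row0.
Qed.

Lemma separate m (A : 'M[F]_(m, d)) (x : 'rV_d) : ~~ (x <= A)%MS ->
  exists psi : 'cV_d, A *m psi = 0 /\ x *m psi = 1%:M.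
Proof.
rewrite submxE => /rowV0Pn; case=> // y /submxP[e ->] ne.
have [j nj] : exists j, (x *m cokermx A) 0 j != 0.
  apply/existsP; rewrite -[[exists _, _]]negbK negb_exists; apply/negP => /forallP h.
  case/negP: ne; suff -> : x *m cokermx A = 0 by rewrite mulmx0.
  by apply/rowP => j; rewrite [RHS]mxE; apply/eqP; have := h j; rewrite negbK.
exists (((x *m cokermx A) 0 j)^-1 *: col j (cokermx A)); split.
  by rewrite -scalemxAr colE (mulmxA A) mulmx_coker mul0mx scaler0.
have -> (c : F) : x *m (c *: col j (cokermx A)) = c *: col j (x *m cokermx A).
  by rewrite -scalemxAr !colE (mulmxA x).
move: (x *m cokermx A) nj => z nj; apply/matrixP => i k.
by rewrite !ord1 [LHS]mxE [X in _ * X]mxE [RHS]mxE eqxx mulVf.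
Qed.

Definition pre (f : 'M[F]_d) (G : 'M[F]_d) : 'M[F]_d := kermx (f *m cokermx G).

Lemma preE m (x : 'M[F]_(m, d)) f G : (x <= pre f G)%MS = (x *m f <= G)%MS.
Proof. by rewrite /pre sub_kermx mulmxA -submxE. Qed.

(** The maps fm 0, fm 1, ... form a string: at the j-th step the vector is mapped
forward if [dir j], and otherwise a preimage is chosen. The string of vectors
ends after m steps if it cannot be continued by a non-zero vector. *)
Definition string_vec (len : nat) (dir : nat -> bool) (fm : nat -> 'M[F]_d) (m : nat) (x : 'rV[F]_d) : Prop :=
  exists vs : nat -> 'rV[F]_d, [/\ vs 0%N = x,
    forall j, (j < m)%N -> if dir j then vs j *m fm j = vs j.+1 else vs j.+1 *m fm j = vs j &
    (m < len)%N -> dir m -> vs m *m fm m = 0].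

(** A string of linear forms, dual to the string of vectors: forms are pulled back
where vectors are pushed forward. It ends after m steps on the same condition
with the directions exchanged. *)
Definition string_form (len : nat) (dir : nat -> bool) (fm : nat -> 'M[F]_d) (m : nat) (phi : 'cV[F]_d) : Prop :=
  exists ps : nat -> 'cV[F]_d, [/\ ps 0%N = phi,
    forall j, (j < m)%N -> if dir j then fm j *m ps j.+1 = ps j else fm j *m ps j = ps j.+1 &
    (m < len)%N -> ~~ dir m -> fm m *m ps m = 0].

(** A vector of W outside W0 can be followed along the string, and all the linear
forms that can be followed for as long are controlled by one subspace G meeting W
only inside W0: so a form that kills W0 and G but not the vector exists, and vector
and form together split off a string from the representation.

By induction on the length. A forward map f with a kernel in W outside W0 stops the
string; otherwise f identifies W modulo W0 with its image, the rest of the string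
starts there, and the subspace is pulled back. A backward map f whose image does not
reach beyond W0 inside W stops the string, with its image as G; otherwise the rest
of the string starts at the preimages, and the subspace is pushed forward. *)
Lemma one_sided len dir fm (W W0 : 'M[F]_d) : (W0 <= W)%MS -> ~~ (W <= W0)%MS ->
  exists (m : nat) (G : 'M[F]_d), [/\ (m <= len)%N,
    exists x : 'rV_d, [/\ (x <= W)%MS, ~~ (x <= W0)%MS & string_vec len dir fm m x],
    (W :&: G <= W0)%MS &
    forall phi : 'cV_d, G *m phi = 0 -> string_form len dir fm m phi].
Proof.
elim: len dir fm W W0 => [|len IH] dir fm W W0 W0W nW.
  exists 0%N, 0; split=> //; first last.
  - by move=> phi _; exists (fun=> phi).
  - by rewrite capmx0 sub0mx.
  - have /row_subPn[i ni] := nW; exists (row i W); split; rewrite ?row_sub //.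
    by exists (fun=> row i W).
pose f := fm 0%N.
have IH' := IH (fun j => dir j.+1) (fun j => fm j.+1).
case d0 : (dir 0%N).
- have [kW|] := boolP (W :&: kermx f <= W0)%MS; last first.
    case/row_subPn => i ni; exists 0%N, 0; split=> //; first last.
    + by move=> phi _; exists (fun=> phi); split=> // _; rewrite d0.
    + by rewrite capmx0 sub0mx.
    + exists (row i (W :&: kermx f)%MS).
      have := row_sub i (W :&: kermx f)%MS; rewrite sub_capmx => /andP[xW /sub_kermxP xk].
      by split=> //; exists (fun=> row i (W :&: kermx f)%MS).
  have lift u : (u <= W)%MS -> (u *m f <= W0 *m f)%MS -> forall z : 'rV_d, u = z -> (z <= W0)%MS.
    move=> uW uf z uz; rewrite -uz; have [D e] := submxP uf.
    have : (u - D *m W0 <= W :&: kermx f)%MS.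
      rewrite sub_capmx; apply/andP; split.
        by rewrite addmx_sub // eqmx_opp (submx_trans (submxMl _ _)).
      by apply/sub_kermxP; rewrite mulmxBl e mulmxA subrr.
    move/submx_trans => /(_ _ _ kW) h; rewrite -[u](subrK (D *m W0)); apply: addmx_sub => //.
    exact: submxMl.
  have [||m [G [ml [y [yW nyW [vs [v0 vj vend]]]] capG form]]] := IH' (W *m f) (W0 *m f).
  + exact: submxMr.
  + apply: contra nW => h; apply/rV_subP => u uW; apply: (lift u) => //.
    exact: submx_trans (submxMr _ uW) h.
  have [D yE] := submxP yW; rewrite mulmxA in yE.
  exists m.+1, (pre f G); split=> //.
  + exists (D *m W); split; first exact: submxMl.
      by apply: contra nyW => h; rewrite yE; apply: submxMr.
    exists (fun j => if j is j'.+1 then vs j' else D *m W); split=> //.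
      by case=> [|j] lj; [rewrite d0 v0 yE|apply: vj].
  + apply/rV_subP => u; rewrite sub_capmx preE => /andP[uW uG].
    apply: (lift u) => //; apply: submx_trans capG; rewrite sub_capmx uG andbT.
    exact: submxMr.
  + move=> phi Gphi.
    have [psi e] : exists psi : 'cV_d, col_mx f G *m psi = col_mx phi 0.
      apply: solve_col => u; rewrite -[u]hsubmxK !mul_row_col mulmx0 addr0 => e.
      have : (lsubmx u <= pre f G)%MS.
        by rewrite preE; move/eqP: e; rewrite addr_eq0 => /eqP->; rewrite eqmx_opp submxMl.
      by case/submxP => C ->; rewrite -mulmxA Gphi mulmx0.
    move: e; rewrite mul_col_mx => /eq_col_mx[e1 e2].
    have [ps [p0 pj pend]] := form psi e2.
    exists (fun j => if j is j'.+1 then ps j' else phi); split=> //.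
      by case=> [|j] lj; [rewrite d0 p0|apply: pj].
- have [kW|] := boolP (W :&: f <= W0)%MS.
    exists 0%N, f; split=> //.
    + have /row_subPn[i ni] := nW; exists (row i W); split; rewrite ?row_sub //.
      by exists (fun=> row i W); split=> // _; rewrite d0.
    + by move=> phi e; exists (fun=> phi).
  case/row_subPn => i ni.
  have := row_sub i (W :&: f)%MS; rewrite sub_capmx => /andP[xW /submxP[D xf]].
  have [||m [G [ml [y [yW nyW [vs [v0 vj vend]]]] capG form]]] := IH' (pre f W) (pre f W0).
  + by rewrite preE; apply: submx_trans W0W; rewrite -preE.
  + apply/negP => h; case/negP: ni; rewrite xf -preE; apply: submx_trans h.
    by rewrite preE -xf.
  exists m.+1, (G *m f); split=> //.
  + exists (y *m f); split; rewrite -?preE //.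
    exists (fun j => if j is j'.+1 then vs j' else y *m f); split=> //.
      by case=> [|j] lj; [rewrite d0 v0|apply: vj].
  + apply/rV_subP => u; rewrite sub_capmx => /andP[uW /submxP[C uE]].
    rewrite uE mulmxA -preE; apply: submx_trans capG; rewrite sub_capmx submxMl andbT.
    by rewrite preE -mulmxA -uE.
  + move=> phi Gphi; have [|ps [p0 pj pend]] := form (f *m phi).
      by rewrite mulmxA.
    exists (fun j => if j is j'.+1 then ps j' else phi); split=> //.
      by case=> [|j] lj; [rewrite d0 p0|apply: pj].
Qed.
End OneSided.

(** * Finite dimension of finitely generated modules *)

Section FiniteDimension.
Variables (K : fieldType) (n : nat) (Q : quiver) (ld : line_data n Q).
Local Notation L := (path_algebra K Q).

Lemma arrow_step a : ai ld a = maxn (vi ld (src a)) (vi ld (tgt a)) /\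
  (vi ld (tgt a) = (vi ld (src a)).+1 \/ vi ld (src a) = (vi ld (tgt a)).+1).
Proof. by have := ai_rng ld a; case: (ld_ends ld a) => [[-> ->]|[-> ->]]; lia. Qed.

Lemma ai_inj a a' : ai ld a = ai ld a' -> a = a'.
Proof. by move=> e; rewrite -(aiK ld a) -(aiK ld a') e. Qed.

(** A walk cannot turn back, because it would have to use the same arrow in the
opposite direction. *)
Lemma walk_right a s : walk (src a) (a :: s) -> vi ld (tgt a) = (vi ld (src a)).+1 ->
  vi ld (walk_end (src a) (a :: s)) = (vi ld (src a) + (size s).+1)%N.
Proof.
elim: s a => [|c s IH] a; first by move=> _; rewrite /walk_end /= addn1.
rewrite /= => /andP[_ /andP[/eqP sc w]] va.
have [e1 [r|l]] := arrow_step c; last first.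
  have [e2 _] := arrow_step a.
  have e : c = a by apply: ai_inj; rewrite e1 e2; move: l; rewrite sc va; lia.
  by move: va; rewrite -sc e; lia.
have := IH c; rewrite /= eqxx w => /(_ isT r).
by rewrite /walk_end /= sc va => ->; lia.
Qed.

Lemma walk_left a s : walk (src a) (a :: s) -> vi ld (src a) = (vi ld (tgt a)).+1 ->
  vi ld (src a) = (vi ld (walk_end (src a) (a :: s)) + (size s).+1)%N.
Proof.
elim: s a => [|c s IH] a; first by move=> _; rewrite /walk_end /= addn1.
rewrite /= => /andP[_ /andP[/eqP sc w]] va.
have [e1 [r|l]] := arrow_step c.
  have [e2 _] := arrow_step a.
  have e : c = a by apply: ai_inj; rewrite e1 e2; move: r; rewrite sc va; lia.
  by move: va; rewrite -sc e; lia.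
have := IH c; rewrite /= eqxx w => /(_ isT l).
by rewrite /walk_end /= sc va => ->; lia.
Qed.

(** The quiver is a line and at each place there is only one arrow, so a walk moves
in one direction. Hence there are finitely many paths. *)
Lemma walk_size (v : Q) s : walk v s -> (size s <= n)%N.
Proof.
case: s => // a s w; have /andP[/eqP e w'] := w; rewrite -e in w.
have [_ [r|l]] := arrow_step a.
  by have := walk_right w r; have := vi_lt ld (walk_end (src a) (a :: s)); rewrite /=; lia.
by have := walk_left w l; have := vi_lt ld (src a); rewrite /=; lia.
Qed.

Variable M : lmodType L.

Definition kspan (T : finType) (h : T -> M) (m : M) : Prop :=
  exists c : T -> K, m = \sum_t c t *k h t.

Lemma kspan_lin (T : finType) (h : T -> M) s x y : kspan h x -> kspan h y -> kspan h (s *k x + y).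
Proof.
move=> [c ->] [c' ->]; exists (fun t => s * c t + c' t).
by rewrite ksc_sumr -big_split; apply: eq_bigr => t _; rewrite kscDl kscA.
Qed.

Lemma kspan_0 (T : finType) (h : T -> M) : kspan h 0.
Proof. by exists (fun=> 0); rewrite big1 // => t _; rewrite ksc0. Qed.

Lemma kspan_gen (T : finType) (h : T -> M) t : kspan h (h t).
Proof.
exists (fun u => (u == t)%:R); rewrite (bigD1 t) //= eqxx ksc1 big1 ?addr0 // => u /negPf->.
by rewrite ksc0.
Qed.

Lemma fg_finite_dim : (exists (d : nat) (g : 'I_d -> M), forall m : M, exists c : 'I_d -> L, m = \sum_i c i *: g i) ->
  exists (D : nat) (h : 'I_D -> M), forall m, kspan h m.
Proof.
move=> [d [g hg]].
pose T : finType := ('I_d * (Q * (n.-bseq (arrow Q))))%type.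
pose h (t : T) : M := walk_elt t.2.1 t.2.2 *: g t.1.
have hz i (z : L) : kspan h (z *: g i).
  elim/pa_ind: z => [s y z hy hz||v s w].
  - by rewrite scalerDl kscZ; apply: kspan_lin.
  - by rewrite scale0r; apply: kspan_0.
  - exact: (kspan_gen h (i, (v, Bseq (walk_size w)))).
have hm m : kspan h m.
  have [c ->] := hg m; elim/big_ind: _ => //; first exact: kspan_0.
  by move=> x y hx hy; rewrite -[x]ksc1; apply: kspan_lin.
exists #|T|, (fun i => h (enum_val i)) => m; have [c ->] := hm m.
exists (fun i => c (enum_val i)).
by rewrite -(big_enum_val (A := T) (fun t => c t *k h t)); apply: eq_bigl.
Qed.

(** A spanning family with the least number of elements is a basis. *)
Lemma finite_coordinates (D : nat) (h : 'I_D -> M) : (forall m, kspan h m) ->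
  exists (d : nat) (ka : M -> 'rV[K]_d) (ka' : 'rV[K]_d -> M),
    [/\ cancel ka ka', cancel ka' ka & forall s x y, ka (s *k x + y) = s *: ka x + ka y].
Proof.
move=> hD.
pose P d := `[< exists h : 'I_d -> M, forall m, kspan h m >].
have exP : exists d, P d by exists D; apply/asboolP; exists h.
case: (ex_minnP exP) => d /asboolP[g hg] mind.
have indep (c : 'I_d -> K) : \sum_i c i *k g i = 0 -> forall i, c i = 0.
  move=> c0 i; apply/eqP/negPn/negP => nz.
  have dpos : (0 < d)%N by apply: leq_ltn_trans (ltn_ord i).
  have dE : d.-1.+1 = d by rewrite prednK.
  suff : P d.-1 by move/mind; lia.
  case: d dE {dpos mind exP} g hg c c0 i nz => // d _ g hg c c0 i nz.
  apply/asboolP; exists (fun j => g (lift i j)) => m; have [a ->] := hg m.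
  exists (fun j => a (lift i j) - a i / c i * c (lift i j)).
  have gi : g i = - \sum_(j < d) (c (lift i j) / c i) *k g (lift i j).
    move: c0; rewrite (bigD1_ord i) //= => /eqP; rewrite addr_eq0 => /eqP e.
    rewrite -(ksc1 (g i)) -(mulVf nz) -kscA e kscNr ksc_sumr; congr (- _).
    by apply: eq_bigr => j _; rewrite kscA mulrC.
  rewrite (bigD1_ord i) //= gi kscNr ksc_sumr addrC -sumrB; apply: eq_bigr => j _.
  by rewrite kscDl kscNl kscA; congr (_ - _ *k _); ring.
have [ka kaP] := choice hg.
pose ka' (r : 'rV[K]_d) : M := \sum_i r 0 i *k g i.
have uq (c c' : 'I_d -> K) : \sum_i c i *k g i = \sum_i c' i *k g i -> c =1 c'.
  move=> e i; apply/eqP; rewrite -subr_eq0; apply/eqP; apply: (indep (fun i => c i - c' i)).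
  rewrite (eq_bigr (fun i => c i *k g i - c' i *k g i)) => [|j _]; last by rewrite kscDl kscNl.
  by rewrite sumrB e subrr.
exists d, (fun m => \row_i ka m i), ka'; split.
- move=> m; rewrite /ka' [RHS]kaP; apply: eq_bigr => i _; by rewrite mxE.
- by move=> r; apply/rowP => i; rewrite mxE; apply: uq; rewrite -kaP.
- move=> s x y; apply/rowP => i; rewrite !mxE.
  apply: (uq _ (fun i => s * ka x i + ka y i)); rewrite -kaP {1}(kaP x) {1}(kaP y) ksc_sumr -big_split.
  by apply: eq_bigr => j _; rewrite kscDl kscA.
Qed.
End FiniteDimension.

(** * Splitting off a string module *)

Section FixedPoints.
Variables (R : pzRingType) (M : lmodType R) (p : {linear M -> M}).
Definition fixed : {pred M} := fun m => p m == m.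
Fact fixed_submod : submod_closed fixed.
Proof.
split=> [|a x y]; rewrite ?inE /fixed unfold_in ?linear0 // => /eqP hx.
rewrite unfold_in => /eqP hy.
by rewrite unfold_in linearP hx hy.
Qed.
HB.instance Definition _ := GRing.isSubmodClosed.Build R M fixed fixed_submod.
Record fixed_sub := FixedSub { fixed_val : M; _ : fixed_val \in fixed }.
HB.instance Definition _ := [isSub for fixed_val].
HB.instance Definition _ := [Choice of fixed_sub by <:].
HB.instance Definition _ := [SubChoice_isSubLmodule of fixed_sub by <:].
End FixedPoints.

(** An idempotent endomorphism splits the module into its fixed points and those of
the complementary idempotent. *)
Lemma indecomposable_idem (K : fieldType) (L : algType K) (M : lmodType L) (p : M -> M) :
  indecomposable M -> linear p -> (forall m, p (p m) = p m) -> (exists m, p m != 0) ->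
  forall m, p m = m.
Proof.
move=> [_ ind] lp pp [m0 nz].
pose P : {linear M -> M} := HB.pack_for {linear M -> M} p (GRing.isLinear.Build L M M *:%R p lp).
have lq : linear (fun m => m - p m).
  by move=> z x y; rewrite lp scalerBr opprD addrACA.
pose C : {linear M -> M} := HB.pack_for {linear M -> M} (fun m => m - p m) (GRing.isLinear.Build L M M *:%R _ lq).
have fP m : p m \in fixed P by rewrite unfold_in /= pp.
have pB m : p (m - p m) = 0 by have := linearB P m (p m); rewrite /= => ->; rewrite pp subrr.
have fC m : m - p m \in fixed C by rewrite unfold_in /= pB subr0.
pose F (m : M) : fixed_sub P * fixed_sub C := (FixedSub (fP m), FixedSub (fC m)).
have lF : linear F.
  move=> z x y; apply: injective_projections; apply: val_inj.
    by rewrite /= lp.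
  by rewrite /= lq.
pose FL : {linear M -> (fixed_sub P * fixed_sub C)%type} :=
  HB.pack_for {linear M -> (fixed_sub P * fixed_sub C)%type} F (GRing.isLinear.Build L M _ *:%R _ lF).
have iso : isomorphic M (fixed_sub P * fixed_sub C)%type.
  exists FL; exists (fun ab => fixed_val ab.1 + fixed_val ab.2) => [m|[[a ha] [c hc]]] /=.
    by rewrite addrC subrK.
  have pa : p a = a by apply/eqP; rewrite -[p a]/(P a).
  have pc : p c = 0.
    have /eqP : C c == c by []; rewrite /= => /eqP; rewrite -subr_eq0 addrC addrA addNr add0r oppr_eq0.
    by move/eqP.
  have pac : p (a + c) = a by rewrite -[p _]/(P _) linearD /= pa pc addr0.
  apply: injective_projections; apply: val_inj; rewrite /= pac //.
  by rewrite addrC addKr.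
case: (ind _ _ iso) => h m.
  have := congr1 (@fixed_val _ _ P) (h (FixedSub (fP m0))) => /= e; by rewrite e eqxx in nz.
have := congr1 (@fixed_val _ _ C) (h (FixedSub (fC m))) => /= /eqP.
by rewrite subr_eq0 => /eqP.
Qed.

Section Strings.
Variables (K : fieldType) (n : nat) (Q : quiver) (ld : line_data n Q).
Local Notation L := (path_algebra K Q).
Variable M : lmodType L.
Local Notation vx := (vx ld).
Local Notation ax := (ax ld).
Local Notation low := (low ld).

(** The vectors w span a submodule, since they are carried to each other or to zero by
the arrows, and the forms psi define a projection to it that commutes with the
arrows for the same reason. As the module is indecomposable, it is this submodule. *)
Lemma thin_of_string (a b k : nat) (w : nat -> M) (psi : nat -> M -> K) :
  indecomposable M -> (a <= k < b)%N -> (b <= n)%N ->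
  (forall i s x y, psi i (s *k x + y) = s * psi i x + psi i y) ->
  (forall i, (a <= i < b)%N -> ev (vx i) *: w i = w i /\ forall m, psi i (ev (vx i) *: m) = psi i m) ->
  (forall p, (a < p < b)%N -> if low p
     then arr (ax p) *: w p = w p.-1 /\ forall m, psi p.-1 (arr (ax p) *: m) = psi p m
     else arr (ax p) *: w p.-1 = w p /\ forall m, psi p (arr (ax p) *: m) = psi p.-1 m) ->
  ((0 < a)%N -> if low a then arr (ax a) *: w a = 0 else forall m, psi a (arr (ax a) *: m) = 0) ->
  ((b < n)%N -> if low b then forall m, psi b.-1 (arr (ax b) *: m) = 0 else arr (ax b) *: w b.-1 = 0) ->
  psi k (w k) = 1 ->
  exists (bb : Q -> M) (be : Q -> M -> K), thin (seg ld a b) bb be.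
Proof.
move=> ind akb bn plin He Hp Ha Hb pk.
have p0 i : psi i 0 = 0.
  by have := plin i (-1) 0 0; rewrite ksc0r addr0 mulN1r addNr.
have pZ i s x : psi i (s *k x) = s * psi i x by have := plin i s x 0; rewrite !addr0 p0 addr0.
have pD i x y : psi i (x + y) = psi i x + psi i y by have := plin i 1 x y; rewrite ksc1 mul1r.
have step p : (a < p < b)%N -> psi p (w p) = psi p.-1 (w p.-1).
  by move=> r; have := Hp p r; case: ifP => _ [<- <-].
have pa i : (a <= i < b)%N -> psi i (w i) = psi a (w a).
  elim: i => [|i IH] r; first by have -> : a = 0%N by lia.
  have [->//|ne] := eqVneq i.+1 a.
  by rewrite step ?IH //=; lia.
have p1 i : (a <= i < b)%N -> psi i (w i) = 1 by move=> r; rewrite pa // -(pa k) ?pk //; lia.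
pose I := seg ld a b.
have Ivi v : I v -> (a <= vi ld v < b)%N by [].
pose bb v : M := if I v then w (vi ld v) else 0.
pose be v m : K := if I v then psi (vi ld v) m else 0.
have bev u v m : be u (ev v *: m) = if u == v then be u m else 0.
  rewrite /be; case: ifP => Iu; last by rewrite if_same.
  have [_ h] := He _ (Ivi u Iu); rewrite viK in h.
  have [e|ne] := eqVneq u v; first by rewrite -e h.
  by rewrite -h (scalerA (ev u)) ev_mul (negPf ne) scale0r p0.
have evb u v : ev u *: bb v = if u == v then bb v else 0.
  rewrite /bb; case: ifP => Iv; last by rewrite scaler0 if_same.
  have [h _] := He _ (Ivi v Iv); rewrite viK in h.
  have [e|ne] := eqVneq u v; first by rewrite e.
  by rewrite -h (scalerA (ev u)) ev_mul (negPf ne) scale0r.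
have dual v u : be v (bb u) = ((v == u) && I v)%:R.
  have [->|ne] := eqVneq v u; last first.
    have := bev v u (bb u); rewrite evb eqxx (negPf ne) => ->; by [].
  rewrite /be /bb /=; case: (boolP (I u)) => Iu //.
  exact: (p1 _ (Ivi u Iu)).
have sE x : (vi ld (src x) = if low (ai ld x) then ai ld x else (ai ld x).-1) by case: (arrow_low ld x).
have tE x : (vi ld (tgt x) = if low (ai ld x) then (ai ld x).-1 else ai ld x) by case: (arrow_low ld x).
have arb x : arr x *: bb (src x) = if I (src x) then bb (tgt x) else 0.
  rewrite {1}/bb; case: ifP => Is; last by rewrite scaler0.
  have rs := Ivi _ Is; have rx := ai_rng ld x; rewrite /bb.
  case: (boolP (I (tgt x))) => [It|nIt].
    have rt := Ivi _ It; have := Hp (ai ld x); rewrite aiK sE tE; rewrite sE in rs; rewrite tE in rt.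
    by case: (low _) rs rt => rs rt h; case: h => //; lia.
  have nrt : ~~ (a <= vi ld (tgt x) < b)%N by [].
  rewrite sE in rs *; rewrite tE in nrt.
  case lw: (low (ai ld x)) rs nrt => rs nrt.
    have e : ai ld x = a by lia.
    by have := Ha; rewrite -e lw aiK; apply; lia.
  have e : ai ld x = b by lia.
  by have := Hb; rewrite -e lw aiK; apply; lia.
have bar x m : be (tgt x) (arr x *: m) = if I (src x) then be (src x) m * (I (tgt x))%:R else 0.
  rewrite {1}/be; case: (boolP (I (tgt x))) => It; last by rewrite mulr0 if_same.
  have rt := Ivi _ It; have rx := ai_rng ld x; rewrite mulr1 /be.
  case: (boolP (I (src x))) => [Is|nIs].
    have rs := Ivi _ Is; have := Hp (ai ld x); rewrite aiK sE tE; rewrite sE in rs; rewrite tE in rt.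
    by case: (low _) rs rt => rs rt h; case: h => //; lia.
  have nrs : ~~ (a <= vi ld (src x) < b)%N by [].
  rewrite tE in rt *; rewrite sE in nrs.
  case lw: (low (ai ld x)) rt nrs => rt nrs.
    have e : ai ld x = b by lia.
    by have := Hb; rewrite -e lw aiK => h; rewrite h //; lia.
  have e : ai ld x = a by lia.
  by have := Ha; rewrite -e lw aiK => h; rewrite h //; lia.
have belin v s x y : be v (s *k x + y) = s * be v x + be v y.
  by rewrite /be; case: ifP => _; rewrite ?plin // mulr0 addr0.
have arr_src x m : arr x *: m = arr x *: (ev (src x) *: m).
  by rewrite (scalerA (arr x)) arr_ev eqxx.
have arr_tgt x m : arr x *: m = ev (tgt x) *: (arr x *: m).
  by rewrite (scalerA (ev _)) ev_arr eqxx.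
have arbv x v : arr x *: bb v = if (src x == v) && I v then bb (tgt x) else 0.
  have [<-|ne] := eqVneq (src x) v; first by rewrite arb.
  by rewrite arr_src evb (negPf ne) scaler0.
pose pr m := \sum_v be v m *k bb v.
have kpr : klinear pr.
  move=> s x y; rewrite -(kscE s x) -(kscE s (pr x)) /pr ksc_sumr -big_split.
  by apply: eq_bigr => v _; rewrite belin kscDl kscA.
have lpr : linear pr.
  apply: linear_crit => // [v m|x m].
    rewrite /pr scaler_sumr (bigD1 v) //= [RHS](bigD1 v) //= bev eqxx -kscC evb eqxx.
    congr (_ + _); rewrite !big1 // => u nu.
      by rewrite -kscC evb eq_sym (negPf nu) ksc0r.
    by rewrite bev (negPf nu) ksc0.
  rewrite /pr scaler_sumr (bigD1 (tgt x)) //= [RHS](bigD1 (src x)) //= bar -kscC arb.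
  congr (_ + _).
    case: ifP => Is; last by rewrite ksc0 ksc0r.
    have [It|nIt] := boolP (I (tgt x)); first by rewrite mulr1.
    by rewrite mulr0 ksc0 /bb (negPf nIt) ksc0r.
  rewrite !big1 // => u nu.
    by rewrite -kscC arbv eq_sym (negPf nu) ksc0r.
  by rewrite arr_tgt bev (negPf nu) ksc0.
have prb v : pr (bb v) = bb v.
  rewrite /pr (bigD1 v) //= dual eqxx big1 => [|u nu]; last by rewrite dual (negPf nu) ksc0.
  by rewrite addr0 /bb; case: ifP => _; rewrite ?ksc1 // ksc0.
have prK m : pr (pr m) = pr m.
  rewrite {2}/pr (klin_sum kpr); apply: eq_bigr => v _.
  by rewrite (klinZ kpr) prb.
have id : forall m, pr m = m.
  apply: indecomposable_idem ind lpr prK _; exists (bb (vx k)); rewrite prb.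
  have Ik : I (vx k) by rewrite /I /seg vxK; lia.
  apply/eqP => e; have := dual (vx k) (vx k); rewrite e eqxx Ik /be Ik p0 => /esym/eqP.
  by rewrite oner_eq0.
exists bb, be; split; [exact: belin|exact: dual| |exact: evb|exact: arbv].
by move=> x; rewrite -{1}(id x).
Qed.
End Strings.

(** * Indecomposable modules are interval modules *)

Section Gabriel.
Variables (K : fieldType) (n : nat) (Q : quiver) (ld : line_data n Q).
Local Notation L := (path_algebra K Q).
Variable M : lmodType L.
Local Notation vx := (vx ld).
Local Notation ax := (ax ld).
Local Notation low := (low ld).

Variables (d : nat) (ka : M -> 'rV[K]_d) (ka' : 'rV[K]_d -> M).
Hypotheses (kaK : cancel ka ka') (ka'K : cancel ka' ka)
  (kaP : forall s x y, ka (s *k x + y) = s *: ka x + ka y).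

Lemma ka'P s x y : ka' (s *: x + y) = s *k ka' x + ka' y.
Proof. by apply: (can_inj kaK); rewrite kaP !ka'K. Qed.
Lemma ka0 : ka 0 = 0.
Proof. by have := kaP (-1) 0 0; rewrite ksc0r addr0 scaleN1r addNr. Qed.
Lemma ka'0 : ka' 0 = 0. Proof. by rewrite -ka0 kaK. Qed.

Definition mat (T : M -> M) : 'M[K]_d := \matrix_i ka (T (ka' (delta_mx 0 i))).

Lemma matP T m : klinear T -> ka (T m) = ka m *m mat T.
Proof.
move=> kT; rewrite -{1}(kaK m) {1}[ka m]row_sum_delta mulmx_sum_row.
have H : forall (r : seq 'I_d) (u : 'I_d -> K),
    ka (T (ka' (\sum_(i <- r) u i *: delta_mx 0 i))) = \sum_(i <- r) u i *: row i (mat T).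
  move=> r u; elim: r => [|i r IH]; first by rewrite !big_nil ka'0 (klin0 kT) ka0.
  by rewrite !big_cons ka'P (klinP kT) kaP IH rowK.
exact: H.
Qed.

Lemma act_klin (z : L) : klinear (fun m : M => z *: m).
Proof. by move=> s x y; rewrite -(kscE s x) -(kscE s (z *: x)) scalerP. Qed.

Definition amat (z : L) : 'M[K]_d := mat (fun m => z *: m).
Lemma amatP z m : ka (z *: m) = ka m *m amat z. Proof. exact: matP (act_klin z). Qed.
Lemma amatP' z (r : 'rV_d) : z *: ka' r = ka' (r *m amat z).
Proof. by apply: (can_inj kaK); rewrite amatP !ka'K. Qed.

Lemma ax_low p : (0 < p < n)%N -> low p -> src (ax p) = vx p /\ tgt (ax p) = vx p.-1.
Proof.
move=> r lp; have [e1 e2] := arrow_low ld (ax p); rewrite (axK ld) // lp in e1 e2.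
by split; [rewrite -[LHS](viK ld) e1|rewrite -[LHS](viK ld) e2].
Qed.
Lemma ax_up p : (0 < p < n)%N -> ~~ low p -> src (ax p) = vx p.-1 /\ tgt (ax p) = vx p.
Proof.
move=> r /negPf lp; have [e1 e2] := arrow_low ld (ax p); rewrite (axK ld) // lp in e1 e2.
by split; [rewrite -[LHS](viK ld) e1|rewrite -[LHS](viK ld) e2].
Qed.

(** Start at a vertex k where the module is not zero, and apply [one_sided] to the
string of arrows to the left of k, with W everything and W0 the kernel C of the
idempotent of k. This gives a vector xl; apply [one_sided] again to the right of k,
now with W = C + <xl>, so that the new vector is a multiple of xl modulo C. A form
that kills C and both subspaces G, but not this vector, extends in both directions,
and [thin_of_string] applies. *)
Lemma gabriel_coord : indecomposable M ->
  exists a b : nat, [/\ (a < b)%N, (b <= n)%N &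
    exists (bb : Q -> M) (be : Q -> M -> K), thin (seg ld a b) bb be].
Proof.
move=> ind; have [[m0 m0nz] _] := ind.
have [v nv] : exists v, ev v *: m0 != 0.
  apply/existsP; rewrite -[[exists _, _]]negbK negb_exists; apply/negP => /forallP h.
  case/eqP: m0nz; rewrite -(scale1r m0) -(sum_ev K Q) scaler_suml big1 // => v _.
  by apply/eqP; have := h v; rewrite negbK.
have [k [kn vxk]] : exists k, (k < n)%N /\ vx k = v by exists (vi ld v); rewrite vi_lt viK.
pose Ek := amat (ev v); pose C := 1%:M - Ek.
have EkE : Ek *m Ek = Ek.
  apply/row_matrixP => i; rewrite !rowE mulmxA.
  by rewrite -(ka'K (delta_mx 0 i)) -!amatP (scalerA (ev v)) ev_mul eqxx.
have inC m (x : 'M_(m, d)) : (x <= C)%MS = (x *m Ek == 0).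
  apply/idP/eqP => [/submxP[D ->]|e].
    by rewrite -mulmxA mulmxBl mul1mx EkE subrr mulmx0.
  by apply/submxP; exists x; rewrite mulmxBr mulmx1 e subr0.
have nC : ~~ (1%:M <= C)%MS.
  rewrite inC mul1mx; apply: contra nv => /eqP e.
  by rewrite -(kaK (_ *: _)) amatP -/Ek e mulmx0 ka'0.
have C1 : (C <= 1%:M)%MS by apply: submx1.
have [ml [Gl [mlk [xl [_ nxl [vl [vl0 vlj vlend]]]] capl forml]]] :=
  one_sided k (fun j => low (k - j)) (fun j => amat (arr (ax (k - j)))) C1 nC.
have CW : (C <= xl + C)%MS by apply: addsmxSr.
have nW : ~~ ((xl + C)%MS <= C)%MS by rewrite addsmx_sub submx_refl andbT.
have nW' : ~~ (<<(xl + C)%MS>> <= C)%MS by rewrite genmxE.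
have CW' : (C <= <<(xl + C)%MS>>)%MS by rewrite genmxE.
have [mr [Gr [mrk [xr [xrW nxr [vr [vr0 vrj vrend]]]] capr formr]]] :=
  one_sided (n.-1 - k) (fun j => ~~ low (k + j.+1)) (fun j => amat (arr (ax (k + j.+1)))) CW' nW'.
rewrite genmxE in xrW.
have [c xrE] : exists c : K, xr *m Ek = c *: (xl *m Ek).
  have [[u1 u2] /= e] := sub_addsmxP xrW.
  exists (u1 0 0); rewrite e mulmxDl -[u2 *m C *m Ek]mulmxA.
  have -> : C *m Ek = 0 by apply/eqP; rewrite -inC.
  by rewrite mulmx0 addr0 -mulmxA [u1]mx11_scalar mul_scalar_mx mxE mulr1n.
(* The form phi is 1 on xr, and kills C and both subspaces. *)
have [phi [Aphi xphi]] : exists phi : 'cV_d, (C + Gr)%MS *m phi = 0 /\ xr *m phi = 1%:M.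
  apply: separate; apply: contra nxr => /sub_addsmxP[[u1 u2] /= e].
  have h2 : (u2 *m Gr <= C)%MS.
    apply: submx_trans capr; rewrite sub_capmx submxMl andbT genmxE.
    have -> : u2 *m Gr = xr - u1 *m C by rewrite e addrC addKr.
    by rewrite addmx_sub // eqmx_opp (submx_trans (submxMl _ _)).
  by rewrite e addmx_sub // submxMl.
have killed (G : 'M_d) : (G <= C + Gr)%MS -> G *m phi = 0.
  by case/submxP => D ->; rewrite -mulmxA Aphi mulmx0.
have Cphi : C *m phi = 0 by apply: killed; apply: addsmxSl.
have Grphi : Gr *m phi = 0 by apply: killed; apply: addsmxSr.
have Glphi : Gl *m phi = 0.
  have : (Gl <= C)%MS by apply: submx_trans capl; rewrite sub_capmx submx1 submx_refl.
  by case/submxP => D ->; rewrite -mulmxA Cphi mulmx0.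
have [pl [pl0 plj plend]] := forml phi Glphi.
have [pr [pr0 prj prend]] := formr phi Grphi.
(* The two strings are joined at k; the vectors on the left are scaled by c, because
   xr is c times xl modulo C. *)
pose w0 i : M := if (i <= k)%N then c *k ka' (vl (k - i)%N) else ka' (vr (i - k)%N).
pose f0 i : 'cV[K]_d := if (i <= k)%N then pl (k - i)%N else pr (i - k)%N.
pose w i := ev (vx i) *: w0 i.
pose psi i m : K := (ka (ev (vx i) *: m) *m f0 i) 0 0.
have w0k : ev (vx k) *: w0 k = ev (vx k) *: ka' (vr 0%N).
  rewrite /w0 leqnn subnn -kscC !amatP' vl0 vr0 vxk -/Ek xrE.
  by have := ka'P c (xl *m Ek) 0; rewrite !addr0 ka'0 addr0 => ->.
have f0k : f0 k = pr 0%N by rewrite /f0 leqnn subnn pl0 pr0.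
have wl i : (i <= k)%N -> w i = ev (vx i) *: (c *k ka' (vl (k - i)%N)) by move=> ik; rewrite /w /w0 ik.
have wr i : (k <= i)%N -> w i = ev (vx i) *: ka' (vr (i - k)%N).
  rewrite leq_eqVlt => /orP[/eqP<-|ki]; first by rewrite /w w0k subnn.
  by rewrite /w /w0 leqNgt ki.
have fl i : (i <= k)%N -> f0 i = pl (k - i)%N by move=> ik; rewrite /f0 ik.
have fr i : (k <= i)%N -> f0 i = pr (i - k)%N.
  rewrite leq_eqVlt => /orP[/eqP<-|ki]; first by rewrite f0k subnn.
  by rewrite /f0 leqNgt ki.
have arr_s p u : src (ax p) = vx u -> forall m : M, arr (ax p) *: (ev (vx u) *: m) = arr (ax p) *: m.
  by move=> <- m; rewrite (scalerA (arr _)) arr_ev eqxx.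
have arr_t p u : tgt (ax p) = vx u -> forall m : M, ev (vx u) *: (arr (ax p) *: m) = arr (ax p) *: m.
  by move=> <- m; rewrite (scalerA (ev _)) ev_arr eqxx.
have evev u (m : M) : ev (vx u) *: (ev (vx u) *: m) = ev (vx u) *: m by rewrite (scalerA (ev _)) ev_mul eqxx.
(* Steps along the arrow at p, from the matrices back to the module. *)
have stepw p s t : src (ax p) = vx s -> tgt (ax p) = vx t -> forall y z : 'rV_d, forall e : K,
    y *m amat (arr (ax p)) = z ->
    arr (ax p) *: (ev (vx s) *: (e *k ka' y)) = ev (vx t) *: (e *k ka' z).
  move=> hs ht y z e <-; rewrite (arr_s _ _ hs) -!kscC -(arr_t _ _ ht) amatP'.
  by [].
have stepf p s t : src (ax p) = vx s -> tgt (ax p) = vx t -> forall y z : 'cV_d,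
    amat (arr (ax p)) *m y = z -> forall m,
    (ka (ev (vx t) *: (arr (ax p) *: m)) *m y) 0 0 = (ka (ev (vx s) *: m) *m z) 0 0.
  move=> hs ht y z <- m; rewrite (arr_t _ _ ht) -(arr_s _ _ hs) amatP mulmxA.
  by [].
exists (k - ml)%N, (k + mr.+1)%N; split; [by clear; lia|by clear -mrk kn; lia|].
have r1 i : ka' i = 1 *k ka' i by rewrite ksc1.
apply: (thin_of_string ind (k := k) (w := w) (psi := psi)); [by clear; lia|by clear -mrk kn; lia|..].
- move=> i s x y; rewrite /psi scalerP kaP mulmxDl -scalemxAl mxE; congr (_ + _).
  by rewrite mxE.
- by move=> i _; split=> [|m]; rewrite /w /psi evev.
- move=> p rp; have rn : (0 < p < n)%N by clear -kn mlk mrk rp; lia.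
  have [pk|kp] := leqP p k.
    have j : (k - p < ml)%N by clear -kn mlk mrk rp pk; lia.
    have pk' : (p.-1 <= k)%N by clear -kn mlk mrk rp pk; lia.
    have ek : (k - p.-1 = (k - p).+1)%N by clear -kn mlk mrk rp pk; lia.
    have ep : (k - (k - p) = p)%N by clear -kn mlk mrk rp pk; lia.
    have hv := vlj _ j; have hf := plj _ j; rewrite ep in hv hf.
    case: (boolP (low p)) hv hf => lp hv hf.
      have [hs ht] := ax_low rn lp; split=> [|m].
        by rewrite !wl // ek; apply: (stepw _ _ _ hs ht).
      by rewrite /psi !fl // ek; apply: (stepf _ _ _ hs ht).
    have [hs ht] := ax_up rn lp; split=> [|m].
      by rewrite !wl // ek; apply: (stepw _ _ _ hs ht).
    by rewrite /psi !fl // ek; apply: (stepf _ _ _ hs ht).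
  have j : (p.-1 - k < mr)%N by clear -kn mlk mrk rp kp; lia.
  have kp' : (k <= p.-1)%N by clear -kn mlk mrk rp kp; lia.
  have kp'' : (k <= p)%N by clear -kn mlk mrk rp kp; lia.
  have ek : (p - k = (p.-1 - k).+1)%N by clear -kn mlk mrk rp kp; lia.
  have ep : (k + (p.-1 - k).+1 = p)%N by clear -kn mlk mrk rp kp; lia.
  have hv := vrj _ j; have hf := prj _ j; rewrite ep in hv hf.
  case: (boolP (low p)) hv hf => lp hv hf.
    have [hs ht] := ax_low rn lp; split=> [|m].
      by rewrite !wr // ek r1 [X in _ = _ *: X]r1; apply: (stepw _ _ _ hs ht).
    by rewrite /psi !fr // ek; apply: (stepf _ _ _ hs ht).
  have [hs ht] := ax_up rn lp; split=> [|m].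
    by rewrite !wr // ek r1 [X in _ = _ *: X]r1; apply: (stepw _ _ _ hs ht).
  by rewrite /psi !fr // ek; apply: (stepf _ _ _ hs ht).
- move=> a0; have rn : (0 < k - ml < n)%N by clear -kn mlk a0; lia.
  have mk : (ml < k)%N by clear -kn mlk a0; lia.
  have ak : (k - ml <= k)%N by clear -kn mlk a0; lia.
  have ek : (k - (k - ml) = ml)%N by clear -kn mlk a0; lia.
  have hv := vlend mk; have hf := plend mk.
  case: (boolP (low (k - ml))) hv hf => la hv hf.
    have [hs ht] := ax_low rn la.
    rewrite wl // ek (stepw _ _ _ hs ht _ _ _ (hv isT)) ka'0 ksc0r scaler0 //.
  have [hs ht] := ax_up rn la.
  by move=> m; rewrite /psi fl // ek (stepf _ _ _ hs ht _ _ (hf isT)) mulmx0 mxE.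
- move=> bn; have rn : (0 < k + mr.+1 < n)%N by clear -kn mrk bn; lia.
  have mk : (mr < n.-1 - k)%N by clear -kn mrk bn; lia.
  have eb : ((k + mr.+1).-1 = k + mr)%N by clear -kn mrk bn; lia.
  have ak : (k <= k + mr)%N by clear -kn mrk bn; lia.
  have ek : (k + mr - k = mr)%N by clear -kn mrk bn; lia.
  have hv := vrend mk; have hf := prend mk.
  case: (boolP (low (k + mr.+1))) hv hf => lb hv hf.
    have [hs ht] := ax_low rn lb.
    rewrite eb in hs ht *.
    by move=> m; rewrite /psi fr // ek (stepf _ _ _ hs ht _ _ (hf isT)) mulmx0 mxE.
  have [hs ht] := ax_up rn lb; rewrite eb in hs ht *.
  by rewrite wr // ek r1 (stepw _ _ _ hs ht _ _ _ (hv isT)) ka'0 ksc0r scaler0.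
- have e : xr *m Ek *m phi = 1%:M.
    have : xr *m C *m phi = 0 by rewrite -mulmxA Cphi mulmx0.
    by rewrite mulmxBr mulmx1 mulmxBl xphi => /eqP; rewrite subr_eq0 => /eqP.
  rewrite /psi wr // evev subnn vr0 f0k pr0 vxk amatP' ka'K -/Ek e.
  by rewrite mxE eqxx.
Qed.
End Gabriel.

Lemma indecomposable_segm (K : fieldType) (n : nat) (Q : quiver) (ld : line_data n Q)
    (M : fgmod (path_algebra K Q)) :
  indecomposable M -> exists t : chord n, segm ld M t.
Proof.
move=> ind; have [D [h hD]] : exists (D : nat) (h : 'I_D -> M), forall m, kspan h m.
  by apply: (fg_finite_dim ld); case: (M).
have [d [ka [ka' [k1 k2 k3]]]] := finite_coordinates hD.
have [a [b [ab bn tM]]] := gabriel_coord ld k1 k2 k3 ind.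
have an : (a < n.+1)%N by lia.
have bn' : (b < n.+1)%N by lia.
have lt : ((inord a : 'I_n.+1, inord b : 'I_n.+1).1 < (inord a : 'I_n.+1, inord b : 'I_n.+1).2)%N.
  by rewrite /= !inordK.
by exists (Sub (inord a, inord b) lt : chord n); rewrite /segm /lo /hi SubK /= !inordK.
Qed.

(** * Exceptional sequences and Hom-Ext quivers as families of chords *)

Section Assembly.
Variables (K : fieldType) (n : nat) (Q : quiver) (ld : line_data n Q).
Hypothesis n1 : (1 < n)%N.
Local Notation L := (path_algebra K Q).

Lemma segm_choice (I : Type) (c : I -> chord n) : exists E : I -> fgmod L,
  exists f : I -> chord n, (forall i, segm ld (E i) (f i)) /\ forall i, circ ld (f i) = c i.
Proof.
have [g gK cK] := circ_bij ld.
have [E EP] := choice (fun i => segm_ex K ld (g (c i))).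
by exists E, (g \o c); split=> // i; rewrite /= cK.
Qed.

Lemma exceptional_labels (I : Type) (E : I -> fgmod L) : (forall i, exceptional (E i)) ->
  exists f : I -> chord n, forall i, segm ld (E i) (f i).
Proof.
move=> ee; have h i : exists t, segm ld (E i) t by case: (ee i) => /(indecomposable_segm ld).
by have [f fP] := choice h; exists f.
Qed.

Lemma exceptional_seqP (E : 'I_n -> fgmod L) (f : 'I_n -> chord n) :
  (forall i, segm ld (E i) (f i)) ->
  exceptional_seq E <-> exc_order (fun i => circ ld (f i)) id.
Proof.
move=> sE; have hz i j := segm_zero (sE i) (sE j).
split=> [[_ h] a b ab|h].
  by rewrite /compat -HEc_circ; apply/hz; apply: h.
split=> [i|i j ji]; first exact: segm_exceptional (sE i).
by apply/hz; rewrite HEc_circ; apply: h.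
Qed.

(** s lists the chords of the modules of the sequence E. This identifies exceptional
sequences up to isomorphism with exceptional sequences of chords. *)
Definition labelled (E : 'I_n -> fgmod L) (s : {ffun 'I_n -> chord n}) : Prop :=
  exists f : 'I_n -> chord n, (forall i, segm ld (E i) (f i)) /\ forall i, circ ld (f i) = s i.

Lemma labelled_iso E E' s : labelled E s -> labelled E' s -> seq_iso E E'.
Proof.
case=> f [sf cf] [f' [sf' cf']] i.
have /(bij_inj (circ_bij ld)) e : circ ld (f i) = circ ld (f' i) by rewrite cf cf'.
by apply: segm_iso (sf i) _; rewrite e.
Qed.

Lemma labelled_uniq E E' s s' : labelled E s -> labelled E' s' -> seq_iso E E' -> s = s'.
Proof.
case=> f [sf cf] [f' [sf' cf']] iso; apply/ffunP => i; rewrite -cf -cf'; congr (circ ld _).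
exact: segm_uniq (segm_transfer (iso i) (sf i)) (sf' i).
Qed.

Lemma exceptional_labelled E : exceptional_seq E -> exists2 s, s \in exc_seqs n & labelled E s.
Proof.
move=> es; have [f sf] := exceptional_labels (proj1 es).
exists [ffun i => circ ld (f i)]; last by exists f; split=> // i; rewrite ffunE.
by apply/exc_seqsP => a b /(proj1 (exceptional_seqP sf) es); rewrite !ffunE.
Qed.

Lemma labelled_exists s : s \in exc_seqs n -> exists2 E, exceptional_seq E & labelled E s.
Proof.
move/exc_seqsP => es; have [E [f [sf cf]]] := segm_choice s.
exists E; last by exists f.
by apply/(exceptional_seqP sf) => a b /es; rewrite /= !cf.
Qed.

Lemma seq_reps_exist : exists (e : nat) (S : 'I_e -> 'I_n -> fgmod L),
  class_reps (@exceptional_seq K L n) (@seq_iso K L n) S.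
Proof.
have ch (i : 'I_#|exc_seqs n|) : exists E, exceptional_seq E /\ labelled E (enum_val i).
  by have [E] := labelled_exists (enum_valP i); exists E.
have [S SP] := choice ch; exists #|exc_seqs n|, S; split=> [i|i j|E es].
- by case: (SP i).
- by move/(labelled_uniq (proj2 (SP i)) (proj2 (SP j)))/enum_val_inj.
- have [s es' ls] := exceptional_labelled es; exists (enum_rank_in es' s).
  by apply: labelled_iso ls _; have [_] := SP (enum_rank_in es' s); rewrite enum_rankK_in.
Qed.

Lemma seq_reps_card (e : nat) (S : 'I_e -> 'I_n -> fgmod L) :
  class_reps (@exceptional_seq K L n) (@seq_iso K L n) S -> e = #|exc_seqs n|.
Proof.
case=> eS iS cS.
have ch i : exists s, s \in exc_seqs n /\ labelled (S i) s.
  by have [s] := exceptional_labelled (eS i); exists s.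
have [l lP] := choice ch.
have lE i : labelled (S i) (l i) by case: (lP i).
have linj : injective l.
  by move=> i j eij; apply: iS; apply: labelled_iso (lE i) _; rewrite eij.
rewrite -(card_ord e) -(card_imset _ linj); apply: eq_card => s.
apply/imsetP/idP => [[i _ ->]|es]; first by case: (lP i).
have [E eE lE'] := labelled_exists es; have [i iso] := cS _ eE.
by exists i => //; apply: labelled_uniq lE' (lE i) iso.
Qed.

Lemma segm_bases (G : finType) (E : G -> fgmod L) (f : G -> chord n) : (forall i, segm ld (E i) (f i)) ->
  exists (b : forall i, Q -> E i) (be : forall i, Q -> E i -> K),
    forall i, thin (seg ld (lo (f i)) (hi (f i))) (b i) (be i).
Proof.
move=> sE; pose b i := projT1 (cid (sE i)); pose be i := projT1 (cid (projT2 (cid (sE i)))).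
by exists b, be => i; apply: (projT2 (cid (projT2 (cid (sE i))))).
Qed.

Lemma coll_exc_fam (G : finType) (E : G -> fgmod L) (f : G -> chord n) : (forall i, segm ld (E i) (f i)) ->
  exceptional_coll n E <-> exc_fam (fun i => circ ld (f i)).
Proof.
move=> sE; split=> -[s bs es]; exists s => //.
  exact: (proj1 (exceptional_seqP (fun i => sE (s i))) es).
exact: (proj2 (exceptional_seqP (fun i => sE (s i))) es).
Qed.

Lemma coll_exceptional (G : finType) (E : G -> fgmod L) : exceptional_coll n E -> forall i, exceptional (E i).
Proof. by case=> s [s' _ s'K] [es _] i; rewrite -(s'K i); apply: es. Qed.

Lemma hom_ext_quiver_drawing (B : bound_quiver K) : hom_ext_quiver L n B ->
  exists f : B -> chord n, drawing f.
Proof.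
case=> E [coll [x [lx relx]]].
have [f sf] := exceptional_labels (coll_exceptional coll).
have ef := proj1 (coll_exc_fam sf) coll; have [b [be tE]] := segm_bases sf.
have [dd yx xs xn] := arrow_lift_draws tE ef lx.
exists (fun i => circ ld (f i)); split=> // z.
by rewrite relx; apply: pa_eval_zero.
Qed.

Lemma ord_card_gt0 : (0 < #|'I_n|)%N. Proof. by rewrite card_ord ltnW. Qed.

(** Any exceptional sequence of chords s draws the quiver of its covering pairs; the
Yoneda algebra of the corresponding modules provides the relations. *)
Definition cover_quiver (s : 'I_n -> chord n) : quiver :=
  @Quiver 'I_n {ij : 'I_n * 'I_n | covers s ij.1 ij.2}
    (fun a => (val a).1) (fun a => (val a).2) ord_card_gt0.

Lemma cover_quiver_draws (s : 'I_n -> chord n) : exc_order s id ->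
  draws (Q := cover_quiver s) s.
Proof.
move=> es; split.
- by exists id => //; exists id.
- by move=> a; apply: (valP a).
- move=> a b sab tab; apply: val_inj; move: sab tab => /=.
  by case: (val a) (val b) => [i j] [i' j'] /= -> ->.
- by move=> i j cij; exists (Sub (i, j) cij).
Qed.

Lemma hom_ext_quiver_exists (s : {ffun 'I_n -> chord n}) : s \in exc_seqs n ->
  exists2 B, hom_ext_quiver L n B & s \in seqs_of n B.
Proof.
move=> es0; have /exc_seqsP es := es0.
pose G := cover_quiver s.
have [E [f [sf /funext cf]]] := @segm_choice G s.
have [b [be tE]] := segm_bases sf.
have dd : draws (Q := G) (fun i => circ ld (f i)) by rewrite cf; apply: cover_quiver_draws.
have ef := draws_exc dd.
have [x lx] := draws_arrow_lift tE ef dd.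
have [_ yx xs xn] := arrow_lift_draws tE ef lx.
pose B := @BoundQuiver K G (fun z => yeq (pa_eval x z) (yzero E)).
exists B.
  by exists E; split; [apply/(coll_exc_fam sf)|exists x].
rewrite inE es0; apply/asboolP; exists (s : B -> chord n); split; last first.
  by exists id => //; exists id.
have -> : (s : B -> chord n) = (fun i => circ ld (f i)) by rewrite cf.
by split=> // z; apply: pa_eval_zero.
Qed.
End Assembly.

(* The hypothesis 1 < n is needed: for n = 1 the left-hand side is 1 and the
   right-hand side is 2. *)
Theorem theorem4p16 (K : closedFieldType) (n : nat) (hn : (1 < n)%N)
    (Q : quiver) (hQ : type_A n Q) :
  let L : algType K := path_algebra K Q in
  [/\ exists (e : nat) (S : 'I_e -> 'I_n -> fgmod L),
        class_reps (@exceptional_seq K L n) (@seq_iso K L n) S,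
      exists (m : nat) (B : 'I_m -> bound_quiver K),
        class_reps (hom_ext_quiver L n) (@bq_isomorphic K) B
    & forall (e : nat) (S : 'I_e -> 'I_n -> fgmod L)
        (m : nat) (B : 'I_m -> bound_quiver K),
        class_reps (@exceptional_seq K L n) (@seq_iso K L n) S ->
        class_reps (hom_ext_quiver L n) (@bq_isomorphic K) B ->
        e%:R = n.+1%:R *
          \sum_(i < m) #|linear_extensions (B i)|%:R / #|bq_aut (B i)|%:R :> rat].
Proof.
have [ld _] := type_A_line hn hQ.
move=> L; split.
- exact: seq_reps_exist ld.
- exact: (reps_exist (hom_ext_quiver_drawing ld) (hom_ext_quiver_exists K ld hn)).
move=> e S m B rS rB; rewrite (seq_reps_card ld rS).
exact: (reps_formula hn (hom_ext_quiver_drawing ld) (hom_ext_quiver_exists K ld hn)).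
Qed.
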